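(* Let $A$ be a finite dimensional Frobenius algebra over a field $k$ with Nakayama automorphism $\nu$, let $M,N$ be $A$-bimodules, and let $r\ge0$ and $s\ge1$ be integers such that $r-s\le-1$. Then there exists a commutative diagram $$\begin{array}{ccc}\mathrm H^{r}(A,M)\otimes\widehat{\mathrm H}_{s-1}(A,{}_1N_{\nu^{-1}})&\xrightarrow{\ \frown\ }&\widehat{\mathrm H}_{s-r-1}(A,{}_1(M\otimes_AN)_{\nu^{-1}})\\ \downarrow&&\downarrow\\ \widehat{\mathrm H}^{r}(A,M)\otimes\widehat{\mathrm H}^{-s}(A,N)&\xrightarrow{\ \widehat\smile\ }&\widehat{\mathrm H}^{r-s}(A,M\otimes_AN)\end{array}$$ where the vertical morphism on the right hand side is always an isomorphism, and the vertical morphism on the left hand side is an isomorphism if $r\ne0$ and an epimorphism otherwise. Here $\frown$ is the Hochschild cap product and $\widehat\smile$ is the cup product on Tate-Hochschild cohomology.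
   Context: $\otimes$ means $\otimes_k$. $A$ is Frobenius: there is a non-degenerate bilinear form $\langle-,-\rangle:A\otimes A\to k$ with $\langle ab,c\rangle=\langle a,bc\rangle$. The Nakayama automorphism $\nu$ is the algebra automorphism of $A$ with $\langle a,b\rangle=\langle b,\nu(a)\rangle$. For algebra automorphisms $\alpha,\beta$ of $A$, ${}_\alpha X_\beta$ is the bimodule $X$ with actions $a*x*b=\alpha(a)x\beta(b)$; a subscript $1$ denotes the identity automorphism. $A^{\mathrm e}=A\otimes A^{\mathrm{op}}$; a bimodule is a left $A^{\mathrm e}$-module by $(a\otimes b^\circ)m=amb$ and a right one by $m(a\otimes b^\circ)=bma$. A complete resolution $\mathbf T\xrightarrow{\varepsilon}A$ is an acyclic chain complex $\mathbf T=(T_i,d_i)_{i\in\mathbb Z}$ of finitely generated projective $A$-bimodules together with a factorization $d_0=\eta\varepsilon$ with $\varepsilon:T_0\to A$ surjective and $\eta:A\to T_{-1}$ injective; $\varepsilon$, extended by $0$, is the augmentation. The Tate-Hochschild groups are $\widehat{\mathrm H}^n(A,X)=\mathrm H^n(\mathrm{Hom}_{A^{\mathrm e}}(\mathbf T,X))$ (degree-$n$ cochains are maps $T_n\to X$) and $\widehat{\mathrm H}_n(A,X)=\mathrm H_n(\mathbf T\otimes_{A^{\mathrm e}}X)$, for $n\in\mathbb Z$. With $\mathbf P=\mathbf T_{\ge0}$ (a projective resolution of $A$ over $A^{\mathrm e}$), the Hochschild groups are $\mathrm H^n(A,X)=\mathrm H^n(\mathrm{Hom}_{A^{\mathrm e}}(\mathbf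 P,X))$ and $\mathrm H_n(A,X)=\mathrm H_n(\mathbf P\otimes_{A^{\mathrm e}}X)$. The canonical chain map $\mathbf T\to\mathbf P$ induces, for $n\ge0$, maps $\widehat{\mathrm H}_n(A,X)\to\mathrm H_n(A,X)$ that are bijective for $n>0$ and injective for $n=0$; so $\widehat{\mathrm H}_n(A,X)$ is regarded as a subspace of $\mathrm H_n(A,X)$ for $n\ge0$, and the top row is the Hochschild cap product on these subspaces (it takes values in $\widehat{\mathrm H}_{s-r-1}$ in the degrees considered), with the identification $M\otimes_A{}_1N_{\nu^{-1}}={}_1(M\otimes_AN)_{\nu^{-1}}$. Products. The complete tensor product $\mathbf T\widehat\otimes_A\mathbf T$ has degree-$n$ component $\prod_{i\in\mathbb Z}T_{n-i}\otimes_AT_i$ and differential $x\otimes y\mapsto d(x)\otimes y+(-1)^{|x|}x\otimes d(y)$. A diagonal approximation is a chain map of bimodule complexes $\widehat\Delta:\mathbf T\to\mathbf T\widehat\otimes_A\mathbf T$ with $(\varepsilon\widehat\otimes_A\varepsilon)\widehat\Delta=\varepsilon$; it exists. The cup product $\widehat\smile:\widehat{\mathrm H}^p(A,M)\otimes\widehat{\mathrm H}^q(A,N)\to\widehat{\mathrm H}^{p+q}(A,M\otimes_AN)$ is induced as follows: for $u:T_p\to M$ and $v:T_q\to N$, $u\,\widehat\smile\,v$ is the component $T_{p+q}\to T_p\otimes_AT_q$ of $\widehat\Delta$ followed by $x\otimes y\mapsto(-1)^{pq}u(x)\otimes_A v(y)$. The Hochschild cap product $\frown:\mathrm H^p(A,M)\otimes\mathrm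 H_q(A,N)\to\mathrm H_{q-p}(A,M\otimes_AN)$ is induced by $u\frown(a\otimes_{A^{\mathrm e}}n)=\sum(-1)^{p(q-p)}x\otimes_{A^{\mathrm e}}(u(y)\otimes_An)$, where $u:P_p\to M$, $a\in P_q$, and $\sum x\otimes y$ is the component in $P_{q-p}\otimes_AP_p$ of $\Delta(a)$ for an augmentation-preserving chain map $\Delta:\mathbf P\to\mathbf P\otimes_A\mathbf P$ of bimodule complexes. The products are independent of the choices. *)

(* Defs.v *)
From HB Require Import structures.
From mathcomp Require Import all_boot all_order all_algebra all_field.
From mathcomp Require Import ring_quotient.
From mathcomp Require Import freeg.
From mathcomp Require Import boolp functions.

Set Implicit Arguments.
Unset Strict Implicit.
Unset Printing Implicit Defensive.

Import GRing.Theory.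
Local Open Scope ring_scope.
Local Open Scope quotient_scope.

Record submodule (k : fieldType) (V : lmodType k) := Submodule {
  sm_pred :> {pred V};
  sm_closed : submod_closed sm_pred }.

HB.instance Definition _ (k : fieldType) (V : lmodType k) (S : submodule V) :=
  GRing.isSubmodClosed.Build k V (sm_pred S) (GRing.submod_closed_semi (sm_closed S)).

Section Quot.
Variables (k : fieldType) (V : lmodType k) (S : submodule V).

Definition quot : Type := Quotient.quot (sm_pred S).
HB.instance Definition _ := GRing.Zmodule.on quot.

Definition qpi (v : V) : quot := \pi_(Quotient.quot (sm_pred S)) v.
Definition qrepr (q : quot) : V := repr (q : Quotient.quot (sm_pred S)).

Lemma qreprK q : qpi (qrepr q) = q.
Proof. exact: reprK. Qed.

Lemma qpi_eqP u v : qpi u = qpi v <-> u - v \in S.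
Proof. by rewrite Quotient.idealrBE; split=> [/eqP|/eqP]. Qed.

Lemma qpiD u v : qpi (u + v) = qpi u + qpi v.
Proof. exact: (raddfD (\pi_(Quotient.quot (sm_pred S)))). Qed.

Definition qscale (a : k) (q : quot) : quot := qpi (a *: qrepr q).

Lemma qpiZ a v : qpi (a *: v) = qscale a (qpi v).
Proof.
apply/qpi_eqP; rewrite -scalerBr rpredZ //.
by apply/qpi_eqP; rewrite qreprK.
Qed.

Lemma qscaleA a b q : qscale a (qscale b q) = qscale (a * b) q.
Proof. by rewrite -[q]qreprK -!qpiZ scalerA. Qed.
Lemma qscale1 : left_id 1 qscale.
Proof. by move=> q; rewrite -[q]qreprK -!qpiZ scale1r. Qed.
Lemma qscaleDr : right_distributive qscale +%R.
Proof.
by move=> a p q; rewrite -[p]qreprK -[q]qreprK -qpiD -!qpiZ scalerDr qpiD.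
Qed.
Lemma qscaleDl q : {morph qscale^~ q : a b / a + b}.
Proof. by move=> a b; rewrite -[q]qreprK -!qpiZ scalerDl qpiD. Qed.

HB.instance Definition _ :=
  GRing.Zmodule_isLmodule.Build k quot qscaleA qscale1 qscaleDr qscaleDl.

Lemma qpi_linear : linear qpi.
Proof. by move=> a u v; rewrite qpiD qpiZ. Qed.
HB.instance Definition _ := GRing.isLinear.Build k V quot *:%R qpi qpi_linear.

End Quot.

Section Subquot.
Variables (k : fieldType) (V : lmodType k) (Z B : submodule V).

Record subspace := Subspace { sval_ : V; _ : sval_ \in Z }.
HB.instance Definition _ := [isSub for sval_].
HB.instance Definition _ := [Choice of subspace by <:].
HB.instance Definition _ := [SubChoice_isSubLmodule of subspace by <:].

Definition trace_pred : {pred subspace} := fun z => val z \in B.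

Lemma trace_closed : submod_closed trace_pred.
Proof.
split=> [|a u v uB vB]; first exact: (rpred0 B).
by rewrite /in_mem /= /trace_pred linearP rpredD // rpredZ.
Qed.
Definition trace : submodule subspace := Submodule trace_closed.

Definition subquot : Type := quot trace.
HB.instance Definition _ := GRing.Lmodule.on subquot.

(** The class of [z]; junk value 0 when [z] is not in [Z]. *)
Definition cls (z : V) : subquot := qpi trace (insubd (0 : subspace) z).
Definition rep (q : subquot) : V := val (qrepr q).

Lemma rep_mem q : rep q \in Z.
Proof. exact: valP. Qed.

Lemma repK q : cls (rep q) = q.
Proof. by rewrite /cls /rep valKd [LHS]qreprK. Qed.

Lemma cls_eqP u v : u \in Z -> v \in Z -> cls u = cls v <-> u - v \in B.
Proof.
move=> uZ vZ; rewrite /cls; split=> [/qpi_eqP|uvB].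
  by rewrite /in_mem /= /trace_pred raddfB /= !insubdK.
by apply/qpi_eqP; rewrite /in_mem /= /trace_pred raddfB /= !insubdK.
Qed.

Lemma cls_lin a u v : u \in Z -> v \in Z ->
  cls (a *: u + v) = a *: cls u + cls v.
Proof.
move=> uZ vZ; rewrite /cls -linearP; congr (qpi _ _); apply: val_inj.
by rewrite linearP /= !insubdK // rpredD // rpredZ.
Qed.

End Subquot.

Section SubquotMap.
Variables (k : fieldType) (V V' : lmodType k).
Variables (Z B : submodule V) (Z' B' : submodule V') (F : V -> V').
Hypothesis Flin : linear F.
Hypothesis FZ : forall z, z \in Z -> F z \in Z'.
Hypothesis FB : forall z, z \in B -> F z \in B'.

Let FD u v : F (u - v) = F u - F v.
Proof. by rewrite addrC -scaleN1r Flin scaleN1r addrC. Qed.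

Lemma clsF z : z \in Z -> cls Z' B' (F (rep (cls Z B z))) = cls Z' B' (F z).
Proof.
move=> zZ; apply/cls_eqP; rewrite ?FZ ?rep_mem // -FD FB //.
by apply: (cls_eqP B (rep_mem _) zZ).1; rewrite repK.
Qed.

Lemma clsF_linear : linear (fun q : subquot Z B => cls Z' B' (F (rep q))).
Proof.
move=> a p q; rewrite -{1}[p]repK -{1}[q]repK -cls_lin ?rep_mem // clsF.
  by rewrite Flin cls_lin // FZ // rep_mem.
by rewrite rpredD ?rpredZ // rep_mem.
Qed.

End SubquotMap.

Definition bilin (k : fieldType) (U V W : lmodType k) (f : U -> V -> W) :=
  (forall u, linear (f u)) /\ (forall v, linear (f^~ v)).

Section SubquotMap2.
Variables (k : fieldType) (V1 V2 V' : lmodType k).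
Variables (Z1 B1 : submodule V1) (Z2 B2 : submodule V2).
Variables (Z' B' : submodule V') (F : V1 -> V2 -> V').
Hypothesis FZ : forall x y, x \in Z1 -> y \in Z2 -> F x y \in Z'.
Hypothesis FB1 : forall x y, x \in B1 -> x \in Z1 -> y \in Z2 -> F x y \in B'.
Hypothesis FB2 : forall x y, x \in Z1 -> y \in B2 -> y \in Z2 -> F x y \in B'.
Hypothesis Fl : forall y, y \in Z2 -> forall a u v, u \in Z1 -> v \in Z1 ->
  F (a *: u + v) y = a *: F u y + F v y.
Hypothesis Fr : forall x, x \in Z1 -> forall a u v, u \in Z2 -> v \in Z2 ->
  F x (a *: u + v) = a *: F x u + F x v.

Lemma clsF2 x y : x \in Z1 -> y \in Z2 ->
  cls Z' B' (F (rep (cls Z1 B1 x)) (rep (cls Z2 B2 y))) = cls Z' B' (F x y).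
Proof.
move=> xZ yZ; set x' := rep _; set y' := rep _.
have x'Z : x' \in Z1 := rep_mem _; have y'Z : y' \in Z2 := rep_mem _.
have xx' : x' - x \in B1 by apply: (cls_eqP B1 x'Z xZ).1; rewrite repK.
have yy' : y' - y \in B2 by apply: (cls_eqP B2 y'Z yZ).1; rewrite repK.
apply/cls_eqP; rewrite ?FZ //.
have -> : F x' y' - F x y = F x' (y' - y) + F (x' - x) y.
  have -> : y' - y = (-1) *: y + y' by rewrite scaleN1r addrC.
  have -> : x' - x = (-1) *: x + x' by rewrite scaleN1r addrC.
  rewrite (Fr x'Z _ yZ y'Z) (Fl yZ _ xZ x'Z) !scaleN1r.
  by rewrite [X in _ = X + _]addrC -addrA [X in _ = _ + X]addrCA addNr addr0.
by apply: rpredD; [apply: FB2|apply: FB1]; rewrite // rpredB.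
Qed.

Lemma clsF2_bilin : 
  bilin (fun (p : subquot Z1 B1) (q : subquot Z2 B2) => cls Z' B' (F (rep p) (rep q))).
Proof.
split=> [p|q] a.
  move=> q q'; rewrite -{1}[p]repK -{1}[q]repK -{1}[q']repK.
  rewrite -cls_lin ?rep_mem // clsF2 ?rpredD ?rpredZ ?rep_mem //.
  by rewrite Fr ?rep_mem // cls_lin // FZ ?rep_mem.
move=> p p'; rewrite -{1}[p]repK -{1}[p']repK -{1}[q]repK.
rewrite -cls_lin ?rep_mem // clsF2 ?rpredD ?rpredZ ?rep_mem //.
by rewrite Fl ?rep_mem // cls_lin ?FZ ?rep_mem.
Qed.

End SubquotMap2.

Section LinearPred.
Variables (k : fieldType) (U V : lmodType k) (f : U -> V).
Hypothesis fl : linear f.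
Let fL : {linear U -> V} := HB.pack f (GRing.isLinear.Build _ _ _ _ f fl).
Lemma lin0 : f 0 = 0. Proof. exact: (linear0 fL). Qed.
Lemma linD u v : f (u + v) = f u + f v. Proof. exact: (linearD fL). Qed.
Lemma linB u v : f (u - v) = f u - f v. Proof. exact: (linearB fL). Qed.
Lemma linN u : f (- u) = - f u. Proof. exact: (linearN fL). Qed.
Lemma linZ a u : f (a *: u) = a *: f u. Proof. exact: (linearZ_LR fL). Qed.
Lemma lin_sum J (s : seq J) (F : J -> U) :
  f (\sum_(j <- s) F j) = \sum_(j <- s) f (F j).
Proof. exact: (linear_sum fL). Qed.
End LinearPred.

Definition span_pred (k : fieldType) (V : lmodType k) (X : V -> Prop) : {pred V} :=
  fun v => `[< forall S : submodule V, (forall x, X x -> x \in S) -> v \in S >].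

Lemma span_closed (k : fieldType) (V : lmodType k) (X : V -> Prop) :
  submod_closed (span_pred X).
Proof.
split=> [|a u v /asboolP uS /asboolP vS]; apply/asboolP=> S XS.
  exact: rpred0.
by rewrite rpredD ?rpredZ ?uS ?vS.
Qed.

Definition span (k : fieldType) (V : lmodType k) (X : V -> Prop) : submodule V :=
  Submodule (span_closed X).

Lemma span_sub (k : fieldType) (V : lmodType k) (X : V -> Prop) (S : submodule V) :
  (forall x, X x -> x \in S) -> forall x, x \in span X -> x \in S.
Proof. by move=> XS x /asboolP; apply. Qed.

Lemma mem_span (k : fieldType) (V : lmodType k) (X : V -> Prop) x :
  X x -> x \in span X.
Proof. by move=> Xx; apply/asboolP => S; apply. Qed.

(** [tens r l] is V ⊗_k W modulo [r i v ⊗ w = v ⊗ l i w], the quotient of the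
    free vector space on V × W by the usual relations.  A right module V and a
    left module W over a k-algebra are given by the families of operators [r]
    and [l] indexed by a spanning set of the algebra. *)

Section Tensor.
Variables (k : fieldType) (V W : lmodType k) (I : Type).
Variables (r : I -> V -> V) (l : I -> W -> W).
Local Notation F := {freeg (V * W)%type / k}.

Inductive tens_rel : F -> Prop :=
| TensDl a v v' w :
    tens_rel (<<(a *: v + v', w)>> - (a *: <<(v, w)>> + <<(v', w)>>))
| TensDr a v w w' :
    tens_rel (<<(v, a *: w + w')>> - (a *: <<(v, w)>> + <<(v, w')>>))
| TensBal i v w : tens_rel (<<(r i v, w)>> - <<(v, l i w)>>).

Definition tens : Type := quot (span tens_rel).
HB.instance Definition _ := GRing.Lmodule.on tens.

Definition tpure (v : V) (w : W) : tens := qpi (span tens_rel) <<(v, w)>>.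

Lemma tpure_bilin : bilin tpure.
Proof.
have ql := @qpi_linear _ _ (span tens_rel).
split=> [v a w w'|w a v v']; rewrite /tpure -ql; apply/qpi_eqP; apply: mem_span.
  exact: TensDr.
exact: TensDl.
Qed.

Lemma tpure_bal i v w : tpure (r i v) w = tpure v (l i w).
Proof. by apply/qpi_eqP; apply: mem_span; apply: TensBal. Qed.

Lemma tens_ext (U : lmodType k) (f g : tens -> U) : linear f -> linear g ->
  (forall v w, f (tpure v w) = g (tpure v w)) -> f =1 g.
Proof.
move=> fl gl fg t; rewrite -[t]qreprK.
have ql := @qpi_linear _ _ (span tens_rel).
rewrite -[qrepr t]freeg_sumE !(lin_sum ql) (lin_sum fl) (lin_sum gl).
apply: eq_bigr => -[v w] _; set c := coeff _ _.
have -> : << c *g (v, w) >> = c *: << (v, w) >> :> F.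
  by apply/eqP/freeg_eqP => z; rewrite coeffZ !coeffU mul1r.
by rewrite (linZ ql) (linZ fl) (linZ gl); congr (_ *: _); exact: fg.
Qed.

(** The linear map [v ⊗ w ↦ f v w], for a balanced bilinear [f]. *)
Definition tlift (U : lmodType k) (f : V -> W -> U) (t : tens) : U :=
  fglift (fun p : V * W => f p.1 p.2) (qrepr t).

Section Lift.
Variables (U : lmodType k) (f : V -> W -> U).
Hypothesis fbilin : bilin f.
Hypothesis fbal : forall i v w, f (r i v) w = f v (l i w).
Let g := fun p : V * W => f p.1 p.2.

Lemma fglift_linear : linear (fglift g).
Proof.
have fD := lift_is_additive g.
have f0 : fglift g 0 = 0 by rewrite -[X in fglift g X](subrr 0) fD subrr.
have fN v : fglift g (- v) = - fglift g v by rewrite -sub0r fD f0 sub0r.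
have fadd u v : fglift g (u + v) = fglift g u + fglift g v.
  by rewrite -[v in LHS]opprK fD fN opprK.
move=> a u v; rewrite fadd; congr (_ + _).
have scal : forall s : seq _, fglift g (a *: \sum_(z <- s) << coeff z u *g z>>)
    = a *: fglift g (\sum_(z <- s) << coeff z u *g z>>).
  elim=> [|z s IH].
    by rewrite !big_nil scaler0 f0 scaler0.
  rewrite !big_cons scalerDr !fadd scalerDr IH; congr (_ + _).
  have -> : a *: << coeff z u *g z >> = << a * coeff z u *g z >> :> F.
    by apply/eqP/freeg_eqP => y; rewrite coeffZ !coeffU mulrA.
  by rewrite !liftU scalerA.
by rewrite -[u]freeg_sumE; exact: scal.
Qed.

Definition lift_ker_pred : {pred F} := fun x => fglift g x == 0.
Lemma lift_ker_closed : submod_closed lift_ker_pred.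
Proof.
split=> [|a u v]; first by rewrite /in_mem /= /lift_ker_pred (lin0 fglift_linear).
rewrite /in_mem /= /lift_ker_pred => /eqP u0 /eqP v0.
by rewrite fglift_linear u0 v0 scaler0 addr0.
Qed.
Definition lift_ker := Submodule lift_ker_closed.

Lemma fglift_span x : x \in span tens_rel -> fglift g x = 0.
Proof.
move=> xs; apply/eqP; apply: (span_sub (S := lift_ker) _ xs) => {xs}y Ry.
rewrite /in_mem /= /lift_ker_pred; apply/eqP.
have gl := fglift_linear; case: Ry => *.
- by rewrite (linB gl) gl !liftU !scale1r /g /= fbilin.2 subrr.
- by rewrite (linB gl) gl !liftU !scale1r /g /= fbilin.1 subrr.
- by rewrite (linB gl) !liftU !scale1r /g /= fbal subrr.
Qed.

Lemma tlift_qpi x : tlift f (qpi (span tens_rel) x) = fglift g x.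
Proof.
apply/eqP; rewrite -subr_eq0; apply/eqP.
rewrite -(linB fglift_linear); apply: fglift_span.
by apply/qpi_eqP; rewrite qreprK.
Qed.

Lemma tlift_pure v w : tlift f (tpure v w) = f v w.
Proof. by rewrite tlift_qpi liftU scale1r. Qed.

Lemma tlift_linear : linear (tlift f).
Proof.
move=> a s t; have ql := @qpi_linear _ _ (span tens_rel).
rewrite -[s]qreprK -[t]qreprK -ql !tlift_qpi.
exact: fglift_linear.
Qed.

End Lift.
End Tensor.

Section TensorMap.
Variables (k : fieldType) (I : Type).

Definition tmap (V W V' W' : lmodType k) (r : I -> V -> V) (l : I -> W -> W)
    (r' : I -> V' -> V') (l' : I -> W' -> W') (f : V -> V') (g : W -> W') :
    tens r l -> tens r' l' :=
  tlift (fun v w => tpure r' l' (f v) (g w)).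
Arguments tmap {V W V' W' r l r' l'} f g.

Section Map.
Variables (V W V' W' : lmodType k) (r : I -> V -> V) (l : I -> W -> W).
Variables (r' : I -> V' -> V') (l' : I -> W' -> W') (f : V -> V') (g : W -> W').
Hypotheses (fl : linear f) (gl : linear g).
Hypotheses (fr : forall i v, f (r i v) = r' i (f v)).
Hypotheses (gr : forall i w, g (l i w) = l' i (g w)).

Let T v w := tpure r' l' (f v) (g w).
Let Tbilin : bilin T.
Proof.
have [tr tl] := tpure_bilin r' l'.
by split=> [v|w] a x y; rewrite /T ?gl ?fl ?tr ?tl.
Qed.
Let Tbal i v w : T (r i v) w = T v (l i w).
Proof. by rewrite /T fr gr tpure_bal. Qed.

Lemma tmap_linear : linear (tmap f g : tens r l -> tens r' l').
Proof. exact: tlift_linear. Qed.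
Lemma tmap_pure v w :
  tmap f g (tpure r l v w) = tpure r' l' (f v) (g w) :> tens r' l'.
Proof. exact: (tlift_pure Tbilin Tbal). Qed.
End Map.
End TensorMap.
Arguments tmap {k I V W V' W' r l r' l'} f g.

Definition tensk (k : fieldType) (V W : lmodType k) : lmodType k :=
  tens (fun (i : void) (v : V) => v) (fun (i : void) (w : W) => w).

(** Left A^e-modules; k acts centrally, since [lact] and [ract] are bilinear
    over k and unital. *)
Record bimod (k : fieldType) (A : algType k) := Bimod {
  bcar :> lmodType k;
  lact : A -> bcar -> bcar;
  ract : bcar -> A -> bcar;
  lact_bilin : bilin lact;
  ract_bilin : bilin ract;
  lact1 : forall x, lact 1 x = x;
  lactM : forall a b x, lact (a * b) x = lact a (lact b x);
  ract1 : forall x, ract x 1 = x;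
  ractM : forall x a b, ract x (a * b) = ract (ract x a) b;
  lractA : forall a x b, ract (lact a x) b = lact a (ract x b) }.

Section Bimod.
Variables (k : fieldType) (A : algType k).
Implicit Types (X Y Z M N : bimod A).

Definition is_bhom X Y (f : X -> Y) : Prop :=
  [/\ linear f, forall a x, f (lact a x) = lact a (f x)
    & forall x b, f (ract x b) = ract (f x) b].

Definition regbimod : bimod A.
Proof.
refine (@Bimod k A A (fun a x => a * x) (fun x b => x * b) _ _ _ _ _ _ _).
- by split=> [a|x] c u v; rewrite ?mulrDr ?mulrDl -?scalerAr -?scalerAl.
- by split=> [a|x] c u v; rewrite ?mulrDr ?mulrDl -?scalerAr -?scalerAl.
- exact: mul1r.
- by move=> a b x; rewrite mulrA.
- exact: mulr1.
- by move=> x a b; rewrite mulrA.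
- by move=> a x b; rewrite mulrA.
Defined.

Definition bimod0 : bimod A.
Proof.
have e (x y : 'rV[k]_0) : x = y by rewrite [x]thinmx0 [y]thinmx0.
by refine (@Bimod k A 'rV[k]_0 (fun _ x => x) (fun x _ => x) _ _ _ _ _ _ _);
  first [move=> *; exact: e | split=> ? ? ? ?; exact: e].
Defined.

Definition twist (alpha beta : {lrmorphism A -> A}) X : bimod A.
Proof.
refine (@Bimod k A X (fun a x => lact (alpha a) x) (fun x b => ract x (beta b))
  _ _ _ _ _ _ _).
- split=> [a|x]; first exact: (lact_bilin X).1.
  by move=> c a b; rewrite linearP (lact_bilin X).2.
- split=> [x|b]; last exact: (ract_bilin X).2.
  by move=> c a b; rewrite linearP (ract_bilin X).1.
- by move=> x; rewrite rmorph1 lact1.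
- by move=> a b x; rewrite rmorphM lactM.
- by move=> x; rewrite rmorph1 ract1.
- by move=> x a b; rewrite rmorphM ractM.
- by move=> a x b; rewrite lractA.
Defined.

Definition tensA M N : lmodType k :=
  tens (fun (a : A) (m : M) => ract m a) (fun (a : A) (n : N) => lact a n).
Definition pureA M N (m : M) (n : N) : tensA M N := tpure _ _ m n.

Lemma pureA_bilin M N : bilin (@pureA M N).
Proof. exact: tpure_bilin. Qed.
Lemma pureA_bal M N m a n : @pureA M N (ract m a) n = pureA m (lact a n).
Proof. exact: (tpure_bal (fun (a : A) (m : M) => ract m a)). Qed.

Definition balA M N (U : lmodType k) (f : M -> N -> U) :=
  forall a m n, f (ract m a) n = f m (lact a n).

Lemma tliftA_pure M N (U : lmodType k) (f : M -> N -> U) m n :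
  bilin f -> balA f -> tlift f (pureA m n) = f m n.
Proof. by move=> fb fe; exact: (tlift_pure fb fe). Qed.

Lemma tliftA_linear M N (U : lmodType k) (f : M -> N -> U) :
  bilin f -> balA f -> linear (tlift f : tensA M N -> U).
Proof. by move=> fb fe; exact: (tlift_linear fb fe). Qed.

Lemma tensA_ext M N (U : lmodType k) (f g : tensA M N -> U) :
  linear f -> linear g -> (forall m n, f (pureA m n) = g (pureA m n)) -> f =1 g.
Proof. exact: tens_ext. Qed.

Section TmapA.
Variables (M N M' N' : bimod A) (f : M -> M') (g : N -> N').
Hypotheses (fl : linear f) (gl : linear g).
Hypotheses (fr : forall x a, f (ract x a) = ract (f x) a).
Hypotheses (gr : forall a x, g (lact a x) = lact a (g x)).
Lemma tmapA_linear : linear (tmap f g : tensA M N -> tensA M' N').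
Proof. by apply: tmap_linear. Qed.
Lemma tmapA_pure m n :
  (tmap f g : tensA M N -> tensA M' N') (pureA m n) = pureA (f m) (g n).
Proof. by apply: tmap_pure. Qed.
End TmapA.

Definition tlact M N (a : A) : tensA M N -> tensA M N := tmap (lact a) id.
Definition tract M N (x : tensA M N) (b : A) : tensA M N :=
  tmap id (fun n => ract n b) x.

Lemma idlin (V : lmodType k) : linear (@id V).
Proof. by []. Qed.

Lemma tlact_linear M N a : linear (@tlact M N a).
Proof.
apply: tmapA_linear => //; [exact: (lact_bilin M).1|by move=> *; rewrite lractA].
Qed.
Lemma tlact_pure M N a m n : tlact a (@pureA M N m n) = pureA (lact a m) n.
Proof.
apply: tmapA_pure => //; [exact: (lact_bilin M).1|by move=> *; rewrite lractA].
Qed.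
Lemma tract_linear M N b : linear (fun x => @tract M N x b).
Proof.
by apply: tmapA_linear => //; [exact: (ract_bilin N).2|move=> *; rewrite lractA].
Qed.
Lemma tract_pure M N b m n : tract (@pureA M N m n) b = pureA m (ract n b).
Proof.
by apply: tmapA_pure => //; [exact: (ract_bilin N).2|move=> *; rewrite lractA].
Qed.

Lemma lin_comp (U V W : lmodType k) (f : U -> V) (g : V -> W) :
  linear f -> linear g -> linear (fun x => g (f x)).
Proof. by move=> fl gl a u v; rewrite fl gl. Qed.
Lemma lin_add (U V : lmodType k) (f g : U -> V) (c : k) :
  linear f -> linear g -> linear (fun x => c *: f x + g x).
Proof.
move=> fl gl a u v; rewrite fl gl !scalerDr addrACA; congr (_ + _ + _).
by rewrite !scalerA mulrC.
Qed.
Lemma lin_scale (U V : lmodType k) (f : U -> V) (c : k) :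
  linear f -> linear (fun x => c *: f x).
Proof. by move=> fl a u v; rewrite fl scalerDr !scalerA mulrC. Qed.
Lemma lin_cst0 (U V : lmodType k) : linear (fun _ : U => 0 : V).
Proof. by move=> a u v /=; rewrite scaler0 addr0. Qed.

Local Ltac tlin := repeat first [ exact: idlin | exact: tlact_linear
  | exact: tract_linear | exact: lin_cst0 | apply: lin_add | apply: lin_scale
  | exact: (lin_comp (tlact_linear _) (tlact_linear _))
  | exact: (lin_comp (tract_linear _) (tract_linear _))
  | exact: (lin_comp (tract_linear _) (tlact_linear _))
  | exact: (lin_comp (tlact_linear _) (tract_linear _)) ].

(** M ⊗_A N with actions a(m ⊗ n)b = am ⊗ nb *)
Definition bitens M N : bimod A.
Proof.
refine (@Bimod k A (tensA M N) (@tlact M N) (@tract M N) _ _ _ _ _ _ _).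
- split=> [a|x c a b]; first exact: tlact_linear.
  have := pureA_bilin M N => -[_ pl].
  apply: (tensA_ext (f := tlact (c *: a + b))
    (g := fun x => c *: tlact a x + tlact b x)) => [||m n]; first by tlin.
    by tlin.
  by rewrite !tlact_pure (lact_bilin M).2 pl.
- split=> [x c a b|b]; last exact: tract_linear.
  have := pureA_bilin M N => -[pr _].
  apply: (tensA_ext (f := fun x => tract x (c *: a + b))
    (g := fun x => c *: tract x a + tract x b)) => [||m n]; first by tlin.
    by tlin.
  by rewrite !tract_pure (ract_bilin N).1 pr.
- apply: tensA_ext => [||m n]; [by tlin..|].
  by rewrite tlact_pure lact1.
- move=> a b; apply: tensA_ext => [||m n]; [by tlin..|].
  by rewrite !tlact_pure lactM.
- apply: tensA_ext => [||m n]; [by tlin..|].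
  by rewrite tract_pure ract1.
- move=> x a b; move: x; apply: tensA_ext => [||m n]; [by tlin..|].
  by rewrite !tract_pure ractM.
- move=> a x b; move: x; apply: tensA_ext => [||m n]; [by tlin..|].
  by rewrite !tlact_pure !tract_pure tlact_pure.
Defined.

(** X ⊗_{A^e} Y, where x(a ⊗ b°) = b x a and (a ⊗ b°)y = a y b; the pure tensors
    a ⊗ b°, here pairs (a, b), span A^e. *)
Definition tensE X Y : lmodType k :=
  tens (fun (ab : A * A) (x : X) => ract (lact ab.2 x) ab.1)
       (fun (ab : A * A) (y : Y) => ract (lact ab.1 y) ab.2).
Definition pureE X Y (x : X) (y : Y) : tensE X Y := tpure _ _ x y.

Lemma pureE_bilin X Y : bilin (@pureE X Y).
Proof. exact: tpure_bilin. Qed.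
Lemma pureE_bal X Y a b x y :
  @pureE X Y (ract (lact b x) a) y = pureE x (ract (lact a y) b).
Proof. exact: (tpure_bal (fun (ab : A * A) (x : X) => ract (lact ab.2 x) ab.1)
  (fun (ab : A * A) (y : Y) => ract (lact ab.1 y) ab.2) (a, b)). Qed.

Definition balE X Y (U : lmodType k) (f : X -> Y -> U) :=
  forall a b x y, f (ract (lact b x) a) y = f x (ract (lact a y) b).

Lemma tliftE_pure X Y (U : lmodType k) (f : X -> Y -> U) x y :
  bilin f -> balE f -> tlift f (pureE x y) = f x y.
Proof. by move=> fb fE; apply: tlift_pure => // -[a b]; apply: fE. Qed.

Lemma tliftE_linear X Y (U : lmodType k) (f : X -> Y -> U) :
  bilin f -> balE f -> linear (tlift f : tensE X Y -> U).
Proof. by move=> fb fE; apply: tlift_linear => // -[a b]; apply: fE. Qed.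

Lemma tensE_ext X Y (U : lmodType k) (f g : tensE X Y -> U) :
  linear f -> linear g -> (forall x y, f (pureE x y) = g (pureE x y)) -> f =1 g.
Proof. exact: tens_ext. Qed.

Section TmapE.
Variables (X Y X' Y' : bimod A) (f : X -> X') (g : Y -> Y').
Hypotheses (fh : is_bhom f) (gh : is_bhom g).
Lemma tmapE_linear : linear (tmap f g : tensE X Y -> tensE X' Y').
Proof.
case: fh gh => [fl fL fR] [gl gL gR].
by apply: tmap_linear => // -[a b] x /=; rewrite ?fR ?fL ?gR ?gL.
Qed.
Lemma tmapE_pure x y :
  (tmap f g : tensE X Y -> tensE X' Y') (pureE x y) = pureE (f x) (g y).
Proof.
case: fh gh => [fl fL fR] [gl gL gR].
by apply: tmap_pure => // -[a b] z /=; rewrite ?fR ?fL ?gR ?gL.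
Qed.
End TmapE.

Lemma bhom_id X : is_bhom (@id X).
Proof. by []. Qed.

Lemma bhom_comp X Y Z (f : X -> Y) (g : Y -> Z) :
  is_bhom f -> is_bhom g -> is_bhom (fun x => g (f x)).
Proof.
move=> [fl fL fR] [gl gL gR]; split=> [|a x|x a]; first exact: lin_comp.
  by rewrite fL gL.
by rewrite fR gR.
Qed.

Lemma bhom_0 X Y : is_bhom (fun _ : X => 0 : Y).
Proof.
split=> [|a x|x a]; first exact: lin_cst0.
  by rewrite (lin0 ((lact_bilin Y).1 a)).
by rewrite (lin0 ((ract_bilin Y).2 a)).
Qed.

Lemma bhom_lin X Y (f g : X -> Y) (c : k) :
  is_bhom f -> is_bhom g -> is_bhom (fun x => c *: f x + g x).
Proof.
move=> [fl fL fR] [gl gL gR]; split=> [|a x|x a]; first exact: lin_add.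
  by rewrite fL gL (lact_bilin Y).1.
by rewrite fR gR (ract_bilin Y).2.
Qed.

Lemma bhom_tmap M N M' N' (f : M -> M') (g : N -> N') :
  is_bhom f -> is_bhom g -> is_bhom (tmap f g : bitens M N -> bitens M' N').
Proof.
move=> [fl fL fR] [gl gL gR]; have tl : linear (tmap f g : tensA M N -> tensA M' N').
  by apply: tmapA_linear.
split=> [//|a|x b].
  apply: (tensA_ext (f := fun x => tmap f g (tlact a x))
    (g := fun x => tlact a (tmap f g x))) => [||m n].
  - exact: (lin_comp (tlact_linear _)).
  - exact: (lin_comp _ (tlact_linear _)).
  - by rewrite tlact_pure !tmapA_pure // tlact_pure fL.
move: x; apply: (tensA_ext (f := fun x => tmap f g (tract x b))
    (g := fun x => tract (tmap f g x) b)) => [||m n].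
- exact: (lin_comp (tract_linear _)).
- exact: (lin_comp _ (tract_linear _)).
- by rewrite tract_pure !tmapA_pure // tract_pure gR.
Qed.

Definition projective X : Prop :=
  forall (Y Z : bimod A) (g : Y -> Z) (f : X -> Z),
    is_bhom g -> (forall z, exists y, g y = z) -> is_bhom f ->
    exists2 h : X -> Y, is_bhom h & forall x, g (h x) = f x.

Definition finitely_generated X : Prop :=
  exists s : seq X, forall S : submodule X,
    (forall a x b, x \in S -> ract (lact a x) b \in S) ->
    {subset s <= S} -> forall x, x \in S.

End Bimod.

Section Frobenius.
Variables (k : fieldType) (A : algType k).

Definition frobenius_form (form : A -> A -> k) : Prop :=
  [/\ bilin (form : A -> A -> k^o),
      forall a b c, form (a * b) c = form a (b * c),
      forall a, (forall b, form a b = 0) -> a = 0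
    & forall b, (forall a, form a b = 0) -> b = 0].

Record alg_aut := AlgAut {
  aut_fun :> {lrmorphism A -> A};
  aut_inv : {lrmorphism A -> A};
  aut_funK : cancel aut_fun aut_inv;
  aut_invK : cancel aut_inv aut_fun }.

Definition nakayama (form : A -> A -> k) (nu : alg_aut) : Prop :=
  forall a b, form a b = form b (nu a).

End Frobenius.

Section Complexes.
Variables (k : fieldType) (A : algType k).
Implicit Types (X Y M N : bimod A).

(** Differentials are given for every pair of degrees and vanish outside the
    pairs (j + 1, j). *)
Record bicomplex := Bicomplex {
  term :> int -> bimod A;
  diff : forall i j : int, term i -> term j;
  diff_hom : forall i j, is_bhom (@diff i j);
  diff_shape : forall i j x, i != j + 1 -> @diff i j x = 0;
  diffK : forall i j l x, @diff j l (@diff i j x) = 0 }.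

Arguments diff : clear implicits.
Implicit Types (C D : bicomplex).

Definition acyclic C : Prop :=
  forall (i : int) (x : C i), diff C i (i - 1) x = 0 ->
    exists y : C (i + 1), diff C (i + 1) i y = x.

Record chain_map C D := ChainMap {
  cmap :> forall i, C i -> D i;
  cmap_hom : forall i, is_bhom (@cmap i);
  cmap_diff : forall i j x, cmap (diff C i j x) = diff D i j (cmap x) }.

Record bhom X Y := BHom {
  bhom_fun :> X -> Y;
  bhom_prop : is_bhom bhom_fun }.

Section Cohomology.
Variables (C : bicomplex) (X : bimod A) (n : int).

(** Degree-n cocycles and coboundaries of Hom_{A^e}(C, X), inside the space of
    all functions C n -> X *)
Definition cocycle_pred : {pred (C n -> X)} := fun f =>
  `[< is_bhom f /\ forall x, f (diff C (n + 1) n x) = 0 >].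

Definition coboundary_pred : {pred (C n -> X)} := fun f =>
  `[< exists2 g : C (n - 1) -> X, is_bhom g
        & forall x, f x = g (diff C n (n - 1) x) >].

Lemma cocycle_closed : submod_closed cocycle_pred.
Proof.
split=> [|a u v /asboolP[uh u0] /asboolP[vh v0]]; apply/asboolP.
  by split=> //; exact: bhom_0.
split=> [|x]; first exact: (bhom_lin a uh vh).
by rewrite /= /GRing.add /= /GRing.scale /= u0 v0 scaler0 addr0.
Qed.

Lemma coboundary_closed : submod_closed coboundary_pred.
Proof.
split=> [|a u v /asboolP[f fh uf] /asboolP[g gh vg]]; apply/asboolP.
  by exists (fun _ => 0) => //; exact: bhom_0.
exists (fun x => a *: f x + g x) => [|x]; first exact: bhom_lin.
by rewrite /= /GRing.add /= /GRing.scale /= uf vg.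
Qed.

Definition cocycle : submodule (C n -> X) := Submodule cocycle_closed.
Definition coboundary : submodule (C n -> X) := Submodule coboundary_closed.

Definition cohom : lmodType k := subquot cocycle coboundary.

End Cohomology.

Section Homology.
Variables (C : bicomplex) (X : bimod A).

Definition tdiff (i j : int) : tensE (C i) X -> tensE (C j) X :=
  tmap (diff C i j) id.

Lemma tdiff_linear i j : linear (@tdiff i j).
Proof. by apply: tmapE_linear; [exact: diff_hom|exact: bhom_id]. Qed.
Lemma tdiff_pure i j c x : @tdiff i j (pureE c x) = pureE (diff C i j c) x.
Proof. by apply: tmapE_pure; [exact: diff_hom|exact: bhom_id]. Qed.

Variable n : int.

Definition cycle_pred : {pred tensE (C n) X} := fun z => tdiff (n - 1) z == 0.
Definition boundary_pred : {pred tensE (C n) X} := fun z =>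
  `[< exists y : tensE (C (n + 1)) X, z = tdiff n y >].

Lemma cycle_closed : submod_closed cycle_pred.
Proof.
have dl := @tdiff_linear n (n - 1).
split=> [|a u v /eqP u0 /eqP v0]; apply/eqP; first exact: (lin0 dl).
by rewrite dl u0 v0 scaler0 addr0.
Qed.

Lemma boundary_closed : submod_closed boundary_pred.
Proof.
have dl := @tdiff_linear (n + 1) n.
split=> [|a u v /asboolP[y uy] /asboolP[z vz]]; apply/asboolP.
  by exists 0; rewrite (lin0 dl).
by exists (a *: y + z); rewrite dl uy vz.
Qed.

Definition cycle : submodule (tensE (C n) X) := Submodule cycle_closed.
Definition boundary : submodule (tensE (C n) X) := Submodule boundary_closed.

Definition homol : lmodType k := subquot cycle boundary.

End Homology.

Definition hcls C X n : tensE (C n) X -> homol C X n :=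
  cls (cycle C X n) (boundary C X n).
Definition ccls C X n : (C n -> X) -> cohom C X n :=
  cls (cocycle C X n) (coboundary C X n).

Definition homol_map C D X Y (f : chain_map C D) (g : bhom X Y) (n : int)
    (z : homol C X n) : homol D Y n :=
  hcls (tmap (f n) g (rep z) : tensE (D n) Y).

Section HomolMap.
Variables (C D : bicomplex) (X Y : bimod A) (f : chain_map C D) (g : bhom X Y).
Let F n : tensE (C n) X -> tensE (D n) Y := tmap (f n) g.

Let Flin n : linear (@F n).
Proof. by apply: tmapE_linear; [exact: cmap_hom|exact: bhom_prop]. Qed.
Let Fpure n c x : @F n (pureE c x) = pureE (f n c) (g x).
Proof. by apply: tmapE_pure; [exact: cmap_hom|exact: bhom_prop]. Qed.
Let Fdiff i j z : @F j (tdiff j z) = tdiff j (@F i z).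
Proof.
move: z; apply: tensE_ext => [||c x].
- exact: (lin_comp (@tdiff_linear C X i j)).
- exact: (lin_comp _ (@tdiff_linear D Y i j)).
- by rewrite tdiff_pure !Fpure tdiff_pure cmap_diff.
Qed.
Let FZ n z : z \in cycle C X n -> F z \in cycle D Y n.
Proof.
by move=> /eqP z0; apply/eqP; rewrite -Fdiff z0 (lin0 (@Flin _)).
Qed.
Let FB n z : z \in boundary C X n -> F z \in boundary D Y n.
Proof.
by move=> /asboolP[y ->]; apply/asboolP; exists (F y); rewrite Fdiff.
Qed.

Lemma homol_mapE n z : z \in cycle C X n ->
  homol_map f g (hcls z) = hcls (tmap (f n) g z : tensE (D n) Y).
Proof. by move=> zZ; apply: (clsF (@Flin n) (@FZ n) (@FB n) zZ). Qed.

Lemma homol_map_linear n : linear (@homol_map C D X Y f g n).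
Proof. exact: (clsF_linear (@Flin n) (@FZ n) (@FB n)). Qed.
End HomolMap.

Definition trunc_term C (i : int) : bimod A :=
  match i with Posz n => C (Posz n) | Negz _ => bimod0 A end.

Definition trunc_diff C (i j : int) : trunc_term C i -> trunc_term C j :=
  match i, j return trunc_term C i -> trunc_term C j with
  | Posz m, Posz n => diff C (Posz m) (Posz n)
  | _, _ => fun _ => 0
  end.

Definition trunc C : bicomplex.
Proof.
refine (@Bicomplex (trunc_term C) (@trunc_diff C) _ _ _).
- by case=> m [] n /=; try exact: bhom_0; exact: diff_hom.
- by case=> m [] n x //=; exact: diff_shape.
- case=> m [] n [] l x //=; first exact: diffK.
  by rewrite (lin0 (let: And3 l _ _ := diff_hom C n l in l)).
Defined.

Definition trunc_fun C (i : int) : C i -> trunc C i :=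
  match i return C i -> trunc C i with
  | Posz n => fun x => x
  | Negz _ => fun _ => 0
  end.

Definition trunc_map C : chain_map C (trunc C).
Proof.
refine (@ChainMap C (trunc C) (@trunc_fun C) _ _).
- by case=> n; [exact: bhom_id|exact: bhom_0].
- case=> m [] n x //=; first by rewrite diff_shape.
Defined.

Record complete_resolution := CompleteResolution {
  cres :> bicomplex;
  cres_proj : forall i, projective (cres i);
  cres_fg : forall i, finitely_generated (cres i);
  cres_acyclic : acyclic cres;
  aug : cres 0 -> regbimod A;
  coaug : regbimod A -> cres (- 1);
  aug_hom : is_bhom aug;
  coaug_hom : is_bhom coaug;
  aug_surj : forall a, exists x, aug x = a;
  coaug_inj : injective coaug;
  aug_factor : forall x, diff cres 0 (- 1) x = coaug (aug x) }.

(** A chain map C -> C ⊗^_A C compatible with [eps : C 0 -> A].  In degree n,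
    the complete tensor product is the product of the C p ⊗_A C q over
    p + q = n, so a map to it is the family of its components [dg n p q]; the
    components with n <> p + q are set to 0.  For a complex concentrated in
    degrees >= 0 the product is finite and this is the usual C ⊗_A C.
    The condition [dg_aug] is written after the identification A ⊗_A A = A. *)
Record diag_approx C (eps : C 0 -> regbimod A) := DiagApprox {
  dg :> forall n p q : int, C n -> bitens (C p) (C q);
  dg_hom : forall n p q, is_bhom (@dg n p q);
  dg_shape : forall n p q x, n != p + q -> @dg n p q x = 0;
  dg_chain : forall p q (x : C (p + q + 1)),
    dg p q (diff C (p + q + 1) (p + q) x) =
      tmap (diff C (p + 1) p) id (dg (p + 1) q x)
      + (-1) ^ p *: tmap id (diff C (q + 1) q) (dg p (q + 1) x);
  dg_aug : forall x : C 0,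
    tlift (fun a b : C 0 => (eps a : A) * eps b : regbimod A) (dg 0 0 x) = eps x }.

Section Products.
Variables (C : bicomplex) (eps : C 0 -> regbimod A) (Delta : diag_approx eps).
Variables (M N : bimod A).

(** The component C n -> C p ⊗_A C q of [Delta] followed by
    [x ⊗ y ↦ (-1)^(pq) u x ⊗ v y]; here n = p + q, and the result is 0 for
    other n. *)
Definition cupc (p q n : int) (u : C p -> M) (v : C q -> N) :
    C n -> bitens M N :=
  fun x => (-1) ^ (p * q) *: tmap u v (Delta n p q x).

(** [u ⌢ (a ⊗ n) = Σ (-1)^(p(q-p)) x ⊗ (u y ⊗ n)], with Σ x ⊗ y the component
    of [Delta a] in C m ⊗_A C p; here m = q - p, and the result is 0 for other
    m. *)
Definition capc (p q m : int) (u : C p -> M) :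
    tensE (C q) N -> tensE (C m) (bitens M N) :=
  tlift (fun a n => (-1) ^ (p * m) *:
    tlift (fun x y => pureE x (pureA (u y) n : bitens M N)) (Delta q m p a)).

Arguments cupc p q n u v : clear implicits.
Arguments capc p q m u z : clear implicits.

Definition cup (p q n : int) (x : cohom C M p) (y : cohom C N q) :
    cohom C (bitens M N) n :=
  ccls (cupc p q n (rep x) (rep y)).

Definition cap (p q m : int) (x : cohom C M p) (z : homol C N q) :
    homol C (bitens M N) m :=
  hcls (capc p q m (rep x) (rep z)).

End Products.

Arguments cupc {C eps} Delta {M N} p q n u v.
Arguments capc {C eps} Delta {M N} p q m u z.
Arguments cup {C eps} Delta {M N} p q n x y.
Arguments cap {C eps} Delta {M N} p q m x z.

Section ProductsE.
Variables (C : bicomplex) (eps : C 0 -> regbimod A) (Delta : diag_approx eps).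
Variables (M N : bimod A).

Lemma dg_chainE m n p p' q q' (x : C n) :
  m = p + q -> n = m + 1 -> p' = p + 1 -> q' = q + 1 ->
  Delta m p q (diff C n m x) = tmap (diff C p' p) id (Delta n p' q x)
    + (-1) ^ p *: tmap id (diff C q' q) (Delta n p q' x).
Proof. by move=> mE nE p'E q'E; subst; apply: dg_chain. Qed.

Lemma bhom_lin_ X Y (f : X -> Y) : is_bhom f -> linear f.
Proof. by case. Qed.

Let tmap_comp (X Y X' Y' X2 Y2 : bimod A) (f : X -> X') (g : Y -> Y')
    (f' : X' -> X2) (g' : Y' -> Y2) :
  is_bhom f -> is_bhom g -> is_bhom f' -> is_bhom g' -> forall z : bitens X Y,
  tmap f' g' (tmap f g z : bitens X' Y') =
  tmap (fun x => f' (f x)) (fun y => g' (g y)) z :> bitens X2 Y2.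
Proof.
move=> fh gh fh' gh'.
have l1 := bhom_lin_ (bhom_tmap fh gh); have l2 := bhom_lin_ (bhom_tmap fh' gh').
have l3 := bhom_lin_ (bhom_tmap (bhom_comp fh fh') (bhom_comp gh gh')).
apply: tensA_ext => [||x y]; [exact: (lin_comp l1 l2)|exact: l3|].
case: (fh) (gh) (fh') (gh') => [? ? ?] [? ? ?] [? ? ?] [? ? ?].
have [? ? ?] := bhom_comp fh fh'; have [? ? ?] := bhom_comp gh gh'.
by rewrite !tmapA_pure.
Qed.

Let tmap0 (X Y X' Y' : bimod A) (f : X -> X') (g : Y -> Y') :
  is_bhom f -> is_bhom g -> (forall x, f x = 0) \/ (forall y, g y = 0) ->
  forall z : bitens X Y, tmap f g z = 0 :> bitens X' Y'.
Proof.
move=> fh gh fg0; have l1 := bhom_lin_ (bhom_tmap fh gh).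
apply: tensA_ext => [||x y]; [exact: l1|exact: lin_cst0|].
case: (fh) (gh) => [? ? ?] [? ? ?]; rewrite tmapA_pure //.
have [pr pl] := pureA_bilin X' Y'.
by case: fg0 => ->; [exact: (lin0 (pl _))|exact: (lin0 (pr _))].
Qed.

Let cupu p q n (u : C p -> M) (v : C q -> N) : C n -> bitens M N :=
  fun x => tmap u v (Delta n p q x).

Let cupu_hom p q n u v : is_bhom u -> is_bhom v -> is_bhom (@cupu p q n u v).
Proof. by move=> uh vh; apply: (bhom_comp (dg_hom _ _ _ _) (bhom_tmap uh vh)). Qed.

Let cupu_diff p p' q q' m n u v (x : C n) : is_bhom u -> is_bhom v ->
  m = p + q -> n = m + 1 -> p' = p + 1 -> q' = q + 1 ->
  @cupu p q m u v (diff C n m x) =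
  @cupu p' q n (fun y => u (diff C p' p y)) v x
  + (-1) ^ p *: @cupu p q' n u (fun y => v (diff C q' q y)) x.
Proof.
move=> uh vh mE nE p'E q'E; rewrite /cupu (dg_chainE x mE nE p'E q'E).
have l := bhom_lin_ (bhom_tmap uh vh).
rewrite (linD l) (linZ l) (tmap_comp (diff_hom _ _ _) (@bhom_id _ _ _) uh vh).
by rewrite (tmap_comp (@bhom_id _ _ _) (diff_hom _ _ _) uh vh).
Qed.

Lemma cocycleP X n (u : C n -> X) : reflect
  (is_bhom u /\ forall x, u (diff C (n + 1) n x) = 0) (u \in cocycle C X n).
Proof. exact: asboolP. Qed.

Lemma cocycle0 X n m (u : C n -> X) x : u \in cocycle C X n -> u (diff C m n x) = 0.
Proof.
move=> /cocycleP[uh u0]; have [mE|mE] := eqVneq m (n + 1); first by subst.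
by rewrite diff_shape // (lin0 (bhom_lin_ uh)).
Qed.

Lemma cupcE p q n (u : C p -> M) (v : C q -> N) x :
  cupc Delta p q n u v x = (-1) ^ (p * q) *: @cupu p q n u v x.
Proof. by []. Qed.

Lemma cupc_hom p q n (u : C p -> M) (v : C q -> N) : is_bhom u -> is_bhom v ->
  is_bhom (cupc Delta p q n u v).
Proof.
move=> uh vh; have h := bhom_lin ((-1) ^ (p * q)) (@cupu_hom p q n u v uh vh)
  (@bhom_0 _ _ (C n) (bitens M N)).
by have <- : (fun x => (-1) ^ (p * q) *: cupu u v x + 0) = cupc Delta p q n u v
  by apply/funext => x; rewrite addr0.
Qed.

Lemma cupc_shape p q n (u : C p -> M) (v : C q -> N) x : is_bhom u -> is_bhom v -> n != p + q ->
  cupc Delta p q n u v x = 0.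
Proof.
move=> uh vh ne; rewrite cupcE /cupu dg_shape //.
by rewrite (lin0 (bhom_lin_ (bhom_tmap uh vh))) scaler0.
Qed.

Lemma cupc_cocycle p q n (u : C p -> M) (v : C q -> N) : u \in cocycle C M p -> v \in cocycle C N q ->
  cupc Delta p q n u v \in cocycle C (bitens M N) n.
Proof.
move=> uZ vZ; have /cocycleP[uh _] := uZ; have /cocycleP[vh _] := vZ.
apply/cocycleP; split=> [|x]; first exact: cupc_hom.
have [nE|] := eqVneq n (p + q); last by move=> ?; rewrite cupc_shape.
rewrite cupcE (cupu_diff (p' := p + 1) (q' := q + 1)) //.
rewrite {1 2}/cupu !tmap0 ?scaler0 ?addr0 ?scaler0 //.
- exact: (bhom_comp (diff_hom _ _ _) vh).
- by right=> y; rewrite cocycle0.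
- exact: (bhom_comp (diff_hom _ _ _) uh).
- by left=> y; rewrite cocycle0.
Qed.

Let signK (i : int) : (-1) ^ i * (-1) ^ i = 1 :> k.
Proof. by rewrite -expfzMl mulrNN mulr1 exp1rz. Qed.

Lemma coboundary_Z X n (u w : C n -> X) c : (forall x, u x = c *: w x) ->
  w \in coboundary C X n -> u \in coboundary C X n.
Proof.
move=> uw wB; have -> : u = c *: w by apply/funext => x; rewrite uw.
by rewrite rpredZ.
Qed.

Lemma coboundary_shape p q n (u : C p -> M) (v : C q -> N) : is_bhom u -> is_bhom v -> n != p + q ->
  cupc Delta p q n u v \in coboundary C (bitens M N) n.
Proof.
move=> uh vh ne; have -> : cupc Delta p q n u v = 0.
  by apply/funext => x; rewrite cupc_shape.
exact: rpred0.
Qed.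

Lemma cupc_coboundaryl p q n (u : C p -> M) (v : C q -> N) : u \in coboundary C M p ->
  u \in cocycle C M p -> v \in cocycle C N q ->
  cupc Delta p q n u v \in coboundary C (bitens M N) n.
Proof.
move=> /asboolP[w wh uE] /cocycleP[uh _] vZ; have /cocycleP[vh _] := vZ.
have [nE|] := eqVneq n (p + q); last exact: coboundary_shape.
apply: (@coboundary_Z _ _ _ (@cupu p q n u v) ((-1) ^ (p * q))) => //.
apply/asboolP; exists (@cupu (p - 1) q (n - 1) w v); first exact: cupu_hom.
move=> x; rewrite (cupu_diff (p' := p) (q' := q + 1)) //; last first.
- by rewrite subrK.
- by rewrite subrK.
- by rewrite nE addrAC.
rewrite [X in _ + _ *: X]tmap0 //.
- by rewrite scaler0 addr0; congr (tmap _ _ _); apply/funext.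
- exact: (bhom_comp (diff_hom _ _ _) vh).
- by right=> y; rewrite cocycle0.
Qed.

Lemma cupc_coboundaryr p q n (u : C p -> M) (v : C q -> N) : u \in cocycle C M p ->
  v \in coboundary C N q -> v \in cocycle C N q ->
  cupc Delta p q n u v \in coboundary C (bitens M N) n.
Proof.
move=> uZ /asboolP[w wh vE] /cocycleP[vh _]; have /cocycleP[uh _] := uZ.
have [nE|] := eqVneq n (p + q); last exact: coboundary_shape.
apply: (@coboundary_Z _ _ _ (fun x => (-1) ^ p *: @cupu p q n u v x)
  ((-1) ^ p * (-1) ^ (p * q))).
  by move=> x; rewrite cupcE scalerA mulrAC signK mul1r.
apply/asboolP; exists (@cupu p (q - 1) (n - 1) u w); first exact: cupu_hom.
move=> x; rewrite (cupu_diff (p' := p + 1) (q' := q)) //; last first.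
- by rewrite subrK.
- by rewrite subrK.
- by rewrite nE addrA.
rewrite [X in X + _]tmap0 //.
- rewrite add0r; congr (_ *: tmap _ _ _); exact/funext.
- exact: (bhom_comp (diff_hom _ _ _) uh).
- by left=> y; rewrite cocycle0.
Qed.

Let tmap_bilin (X Y X' Y' : bimod A) (f f' : X -> X') (g g' : Y -> Y') (a : k) :
  is_bhom f -> is_bhom f' -> is_bhom g -> is_bhom g' -> forall z : bitens X Y,
  (tmap (a *: f + f') g z = a *: tmap f g z + tmap f' g z :> bitens X' Y') *
  (tmap f (a *: g + g') z = a *: tmap f g z + tmap f g' z :> bitens X' Y').
Proof.
move=> fh fh' gh gh'; have hf : is_bhom (a *: f + f') := bhom_lin a fh fh'.
have hg : is_bhom (a *: g + g') := bhom_lin a gh gh'.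
have [pr pl] := pureA_bilin X' Y'.
have L u v uh vh := bhom_lin_ (@bhom_tmap _ _ X Y X' Y' u v uh vh).
case: (fh) (fh') (gh) (gh') (hf) (hg)
  => [? ? ?] [? ? ?] [? ? ?] [? ? ?] [? ? ?] [? ? ?].
move=> z; split; move: z.
  apply: tensA_ext => [||x y]; [exact: L|apply: lin_add; exact: L|].
  by rewrite !tmapA_pure // pl.
apply: tensA_ext => [||x y]; [exact: L|apply: lin_add; exact: L|].
by rewrite !tmapA_pure // pr.
Qed.

Let cupc_l p q n (v : C q -> N) : v \in cocycle C N q -> forall a u u',
  u \in cocycle C M p -> u' \in cocycle C M p ->
  cupc Delta p q n (a *: u + u') v =
    a *: cupc Delta p q n u v + cupc Delta p q n u' v.
Proof.
move=> /cocycleP[vh _] a u u' /cocycleP[uh _] /cocycleP[uh' _].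
apply/funext => x; change (cupc Delta p q n (a *: u + u') v x =
  a *: cupc Delta p q n u v x + cupc Delta p q n u' v x).
rewrite /cupc (tmap_bilin a uh uh' vh vh) scalerDr; congr (_ + _).
by rewrite !scalerA mulrC.
Qed.

Let cupc_r p q n (u : C p -> M) : u \in cocycle C M p -> forall a v v',
  v \in cocycle C N q -> v' \in cocycle C N q ->
  cupc Delta p q n u (a *: v + v') =
    a *: cupc Delta p q n u v + cupc Delta p q n u v'.
Proof.
move=> /cocycleP[uh _] a v v' /cocycleP[vh _] /cocycleP[vh' _].
apply/funext => x; change (cupc Delta p q n u (a *: v + v') x =
  a *: cupc Delta p q n u v x + cupc Delta p q n u v' x).
rewrite /cupc (tmap_bilin a uh uh vh vh') scalerDr; congr (_ + _).
by rewrite !scalerA mulrC.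
Qed.

Lemma cup_cls p q n (u : C p -> M) (v : C q -> N) :
  u \in cocycle C M p -> v \in cocycle C N q ->
  cup Delta p q n (ccls u) (ccls v) = ccls (cupc Delta p q n u v).
Proof.
exact: (clsF2 (@cupc_cocycle p q n) (@cupc_coboundaryl p q n)
  (@cupc_coboundaryr p q n) (@cupc_l p q n) (@cupc_r p q n)).
Qed.

Lemma cup_bilin p q n : bilin (@cup _ _ Delta M N p q n).
Proof.
exact: (clsF2_bilin (@cupc_cocycle p q n) (@cupc_coboundaryl p q n)
  (@cupc_coboundaryr p q n) (@cupc_l p q n) (@cupc_r p q n)).
Qed.

Section CapInner.
Variables (X Y : bimod A) (u : Y -> M).
Hypothesis uh : is_bhom u.

Definition capin (n : N) (t : bitens X Y) : tensE X (bitens M N) :=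
  tlift (fun x y => pureE x (pureA (u y) n : bitens M N)) t.

Let inner n x y : tensE X (bitens M N) := pureE x (pureA (u y) n : bitens M N).

Lemma inner_bilin n : bilin (inner n).
Proof.
have [pr pl] := pureE_bilin X (bitens M N); have [_ ql] := pureA_bilin M N.
have ul := bhom_lin_ uh.
by split=> [x|y] a v w; rewrite /inner ?ul ?ql ?pr ?pl.
Qed.

Lemma inner_bal n : balA (inner n).
Proof.
case: uh => _ uL _ a x y; rewrite /inner uL.
have := pureE_bal a 1 x (pureA (u y) n : bitens M N).
by rewrite lact1 ract1 => ->; congr (pureE _ _); exact: tlact_pure.
Qed.

Lemma capin_pure n x y : capin n (pureA x y) = pureE x (pureA (u y) n : bitens M N).
Proof. exact: (tliftA_pure _ _ (inner_bilin n) (inner_bal n)). Qed.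

Lemma capin_linear n : linear (capin n).
Proof. exact: (tliftA_linear (inner_bilin n) (inner_bal n)). Qed.

Lemma capin_linearr t : linear (capin^~ t).
Proof.
move=> a n n'; move: t; apply: tensA_ext => [||x y].
- exact: capin_linear.
- by apply: lin_add; exact: capin_linear.
rewrite !capin_pure; have [pr _] := pureE_bilin X (bitens M N).
by have [qr _] := pureA_bilin M N; rewrite qr pr.
Qed.

Lemma capin_bal a b n t :
  capin n (ract (lact b t) a) = capin (ract (lact a n) b) t.
Proof.
case: (uh) => _ _ uR; move: t.
apply: (tensA_ext (f := fun t => capin n (tract (tlact b t) a))) => [||x y].
- apply: lin_comp (capin_linear n).
  exact: (lin_comp (@tlact_linear _ _ _ _ b) (@tract_linear _ _ _ _ a)).
- exact: capin_linear.
rewrite tlact_pure tract_pure !capin_pure uR pureA_bal.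
have := pureE_bal 1 b x (pureA (u y) (lact a n) : bitens M N).
by rewrite lact1 ract1 => ->; congr (pureE _ _); exact: tract_pure.
Qed.

End CapInner.

Lemma capin_mapl (X X' Y : bimod A) (u : Y -> M) (f : X -> X') n
    (t : bitens X Y) : is_bhom u -> is_bhom f ->
  capin u n (tmap f id t : bitens X' Y) =
  tmap f id (capin u n t) :> tensE X' (bitens M N).
Proof.
move=> uh fh; move: t.
have l1 := bhom_lin_ (bhom_tmap fh (@bhom_id _ _ Y)).
have l2 := tmapE_linear fh (@bhom_id _ _ (bitens M N)).
apply: tensA_ext => [||x y].
- exact: (lin_comp l1 (capin_linear uh _)).
- exact: (lin_comp (capin_linear uh _) l2).
by case: (fh) => *; rewrite tmapA_pure // !capin_pure // tmapE_pure.
Qed.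

Lemma capin_mapr (X Y Y' : bimod A) (u : Y -> M) (g : Y' -> Y) n
    (t : bitens X Y') : is_bhom u -> is_bhom g ->
  capin u n (tmap id g t : bitens X Y) =
  capin (fun y => u (g y)) n t :> tensE X (bitens M N).
Proof.
move=> uh gh; move: t; have ugh := bhom_comp gh uh.
have l1 := bhom_lin_ (bhom_tmap (@bhom_id _ _ X) gh).
apply: tensA_ext => [||x y].
- exact: (lin_comp l1 (capin_linear uh _)).
- exact: (capin_linear ugh).
by case: (gh) => *; rewrite tmapA_pure // !capin_pure.
Qed.

Lemma capin_lin (X Y : bimod A) (u u' : Y -> M) a n (t : bitens X Y) :
  is_bhom u -> is_bhom u' ->
  capin (a *: u + u') n t = a *: capin u n t + capin u' n t
    :> tensE X (bitens M N).
Proof.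
move=> uh uh'; have hh : is_bhom (a *: u + u') := bhom_lin a uh uh'.
move: t; apply: tensA_ext => [||x y].
- exact: capin_linear.
- by apply: lin_add; exact: capin_linear.
rewrite !capin_pure //; have [pr _] := pureE_bilin X (bitens M N).
by have [_ ql] := pureA_bilin M N; rewrite -pr -ql.
Qed.

Let capo p q m (u : C p -> M) c (n : N) : tensE (C m) (bitens M N) :=
  capin u n (Delta q m p c).

Let capo_bilin p q m u : is_bhom u -> bilin (@capo p q m u).
Proof.
move=> uh; split=> [c|n]; first exact: capin_linearr.
exact: (lin_comp (bhom_lin_ (dg_hom Delta q m p)) (capin_linear uh n)).
Qed.

Let capo_bal p q m u : is_bhom u -> balE (@capo p q m u).
Proof.
move=> uh a b c n; have [_ dL dR] := dg_hom Delta q m p.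
by rewrite /capo dR dL capin_bal.
Qed.

Let capu p q m (u : C p -> M) : tensE (C q) N -> tensE (C m) (bitens M N) :=
  tlift (@capo p q m u).

Let capu_pure p q m u (c : C q) (n : N) : is_bhom u ->
  @capu p q m u (pureE c n) = capin u n (Delta q m p c).
Proof. by move=> uh; exact: (tliftE_pure c n (@capo_bilin p q m u uh) (@capo_bal p q m u uh)). Qed.
Let capu_linear p q m u : is_bhom u -> linear (@capu p q m u).
Proof. by move=> uh; exact: (tliftE_linear (@capo_bilin p q m u uh) (@capo_bal p q m u uh)). Qed.

Let capo_sign_bilin p q m (u : C p -> M) : is_bhom u ->
  bilin (fun c n => (-1) ^ (p * m) *: @capo p q m u c n).
Proof.
move=> /(@capo_bilin p q m u)[b1 b2].
by split=> *; apply: lin_scale; [exact: b1|exact: b2].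
Qed.
Let capo_sign_bal p q m (u : C p -> M) : is_bhom u ->
  balE (fun c n => (-1) ^ (p * m) *: @capo p q m u c n).
Proof. by move=> uh a b x y; rewrite (@capo_bal p q m u uh). Qed.

Lemma capc_linear p q m (u : C p -> M) : is_bhom u ->
  linear (capc Delta p q m u : tensE (C q) N -> tensE (C m) (bitens M N)).
Proof.
move=> uh; exact: (tliftE_linear (@capo_sign_bilin p q m u uh) (@capo_sign_bal p q m u uh)).
Qed.

Let capcE p q m (u : C p -> M) z : is_bhom u ->
  capc Delta p q m u z = (-1) ^ (p * m) *: @capu p q m u z.
Proof.
move=> uh; move: z; apply: tensE_ext => [||c n].
- exact: capc_linear.
- by apply: lin_scale; exact: capu_linear.
rewrite capu_pure //.
exact: (tliftE_pure _ _ (@capo_sign_bilin p q m u uh) (@capo_sign_bal p q m u uh)).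
Qed.

Let capu_shape p q m (u : C p -> M) z : is_bhom u -> q != m + p ->
  @capu p q m u z = 0.
Proof.
move=> uh ne; move: z; apply: tensE_ext => [||c n].
- exact: capu_linear.
- exact: lin_cst0.
by rewrite capu_pure // dg_shape // (lin0 (capin_linear uh n)).
Qed.

Let capu_diff (p p' q q' m m' : int) (u : C p -> M) (z : tensE (C q') N) : is_bhom u ->
  q = m + p -> q' = q + 1 -> p' = p + 1 -> m' = m + 1 ->
  @capu p q m u (@tdiff C N q' q z) =
  @tdiff C (bitens M N) m' m (@capu p q' m' u z) +
  (-1) ^ m *: @capu p' q' m (fun y => u (diff C p' p y)) z.
Proof.
move=> uh qE q'E p'E m'E; have udh := bhom_comp (diff_hom C p' p) uh.
move: z; apply: tensE_ext => [||c n].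
- exact: (lin_comp (@tdiff_linear C N q' q) (@capu_linear p q m u uh)).
- have l1 := lin_scale ((-1) ^ m) (@capu_linear p' q' m _ udh).
  have l2 := lin_comp (@capu_linear p q' m' u uh) (@tdiff_linear C (bitens M N) m' m).
  by have := lin_add 1 l2 l1; under eq_fun do rewrite scale1r.
rewrite tdiff_pure !capu_pure // (dg_chainE c qE q'E m'E p'E).
have l := capin_linear (X := C m) uh n.
rewrite (linD l) (linZ l) capin_mapl ?capin_mapr //; exact: diff_hom.
Qed.

Let capu0 p q m (u : C p -> M) z : (forall y, u y = 0) -> @capu p q m u z = 0.
Proof.
move=> u0; have -> : u = fun _ => 0 by apply/funext.
have uh := @bhom_0 _ _ (C p) M; move: z; apply: tensE_ext => [||c n].
- exact: capu_linear.
- exact: lin_cst0.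
rewrite capu_pure //; move: (Delta q m p c); apply: tensA_ext => [||x y].
- exact: capin_linear.
- exact: lin_cst0.
rewrite capin_pure //; have [pr _] := pureE_bilin (C m) (bitens M N).
by have [_ ql] := pureA_bilin M N; rewrite (lin0 (ql _)) (lin0 (pr _)).
Qed.

Lemma capc_cycle p q m (u : C p -> M) z :
  u \in cocycle C M p -> z \in cycle C N q ->
  capc Delta p q m u z \in cycle C (bitens M N) m.
Proof.
move=> uZ /eqP z0; have /cocycleP[uh _] := uZ; rewrite capcE //.
apply: rpredZ; have [qE|ne] := eqVneq q (m + p); last first.
  by rewrite capu_shape //; exact: rpred0.
have e1 : q - 1 = m - 1 + p by rewrite qE addrAC.
have e2 : q = q - 1 + 1 by rewrite subrK.
have e3 : m = m - 1 + 1 by rewrite subrK.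
apply/eqP; have := capu_diff z uh e1 e2 erefl e3.
rewrite z0 (lin0 (@capu_linear _ _ _ _ uh)) [X in _ *: X]capu0 => [|y].
  by rewrite scaler0 addr0 => <-.
exact: cocycle0.
Qed.

Lemma capc_boundary p q m (u : C p -> M) z : u \in cocycle C M p ->
  z \in boundary C N q -> z \in cycle C N q ->
  capc Delta p q m u z \in boundary C (bitens M N) m.
Proof.
move=> uZ /asboolP[y ->] _; have /cocycleP[uh _] := uZ; rewrite capcE //.
apply: rpredZ; have [qE|ne] := eqVneq q (m + p); last first.
  by rewrite capu_shape //; exact: rpred0.
apply/asboolP; exists (@capu p (q + 1) (m + 1) u y).
rewrite (capu_diff (p' := p + 1) (m' := m + 1)) // [X in _ *: X]capu0 => [|x].
  by rewrite scaler0 addr0.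
exact: cocycle0.
Qed.

Lemma capc_coboundary p q m (u : C p -> M) z : u \in coboundary C M p ->
  u \in cocycle C M p -> z \in cycle C N q ->
  capc Delta p q m u z \in boundary C (bitens M N) m.
Proof.
move=> /asboolP[w wh uE] /cocycleP[uh _] /eqP z0; rewrite capcE //.
apply: rpredZ; have [qE|ne] := eqVneq q (m + p); last first.
  by rewrite capu_shape //; exact: rpred0.
have e1 : q - 1 = m + (p - 1) by rewrite qE addrA.
have e2 : q = q - 1 + 1 by rewrite subrK.
have e3 : p = p - 1 + 1 by rewrite subrK.
have := capu_diff z wh e1 e2 e3 (erefl (m + 1)).
rewrite z0 (lin0 (@capu_linear _ _ _ _ wh)).
have -> : (fun y => w (diff C p (p - 1) y)) = u by apply/funext.
move=> /esym /eqP; rewrite addr_eq0 => /eqP tE.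
have -> : @capu p q m u z = (- (-1) ^ m) *:
    @tdiff C (bitens M N) (m + 1) m (capu (m + 1) w z).
  by rewrite tE scalerN scaleNr opprK scalerA signK scale1r.
by apply: rpredZ; apply/asboolP; eexists.
Qed.

Let capc_l p q m (z : tensE (C q) N) : z \in cycle C N q -> forall a u u',
  u \in cocycle C M p -> u' \in cocycle C M p ->
  capc Delta p q m (a *: u + u') z =
    a *: capc Delta p q m u z + capc Delta p q m u' z.
Proof.
move=> _ a u u' /cocycleP[uh _] /cocycleP[uh' _].
have hh : is_bhom (a *: u + u') := bhom_lin a uh uh'.
move: z; apply: tensE_ext => [||c n].
- exact: capc_linear.
- by apply: lin_add; exact: capc_linear.
rewrite !capcE // !capu_pure // capin_lin // scalerDr !scalerA.
by rewrite [a * _]mulrC.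
Qed.

Let capc_r p q m (u : C p -> M) : u \in cocycle C M p -> forall a z z',
  z \in cycle C N q -> z' \in cycle C N q ->
  capc Delta p q m u (a *: z + z') =
    a *: capc Delta p q m u z + capc Delta p q m u z'.
Proof. by move=> /cocycleP[uh _] a z z' _ _; exact: (@capc_linear p q m u uh). Qed.

Lemma cap_cls p q m (u : C p -> M) (z : tensE (C q) N) :
  u \in cocycle C M p -> z \in cycle C N q ->
  cap Delta p q m (ccls u) (hcls z) = hcls (capc Delta p q m u z).
Proof.
exact: (clsF2 (@capc_cycle p q m) (@capc_coboundary p q m)
  (@capc_boundary p q m) (@capc_l p q m) (@capc_r p q m)).
Qed.

Lemma cap_bilin p q m : bilin (@cap _ _ Delta M N p q m).
Proof.
exact: (clsF2_bilin (@capc_cycle p q m) (@capc_coboundary p q m)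
  (@capc_boundary p q m) (@capc_l p q m) (@capc_r p q m)).
Qed.
End ProductsE.

Section CupT.
Variables (C : bicomplex) (eps : C 0 -> regbimod A) (Delta : diag_approx eps).
Variables (M N : bimod A) (p q n : int).

Definition cupT : tensk (cohom C M p) (cohom C N q) -> cohom C (bitens M N) n :=
  tlift (cup Delta p q n).

Lemma cupT_linear : linear cupT.
Proof. exact: (tlift_linear (cup_bilin Delta M N p q n)). Qed.
Lemma cupT_pure x y : cupT (tpure _ _ x y) = cup Delta p q n x y.
Proof. exact: (tlift_pure (cup_bilin Delta M N p q n)). Qed.
End CupT.

Section Twist.
Variables (beta : {lrmorphism A -> A}) (M N : bimod A).

(** The identification of M ⊗_A (1_N_beta) with 1_(M ⊗_A N)_beta,
    [m ⊗ n ↦ m ⊗ n] *)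
Definition twist_tens_fun (t : bitens M (twist idfun beta N)) :
    twist idfun beta (bitens M N) :=
  tlift (fun m n => pureA m n) t.

Lemma twist_tens_hom : is_bhom twist_tens_fun.
Proof.
have pb : bilin (fun (m : M) (n : twist idfun beta N) => pureA m n : tensA M N).
  exact: pureA_bilin.
have pc : balA (fun (m : M) (n : twist idfun beta N) => pureA m n : tensA M N).
  by move=> a m n; exact: pureA_bal.
have fl : linear (twist_tens_fun : tensA _ _ -> tensA M N) := tliftA_linear pb pc.
have fp m n : twist_tens_fun (pureA m n) = pureA m n := tliftA_pure m n pb pc.
split=> [//|a|t b].
  apply: (tensA_ext (g := fun t => tlact a (twist_tens_fun t))) => [||m n].
  - exact: (lin_comp (@tlact_linear _ _ _ _ a) fl).
  - exact: (lin_comp fl (@tlact_linear _ _ _ _ a)).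
  - by rewrite [lact _ _]tlact_pure !fp tlact_pure.
move: t; apply: (tensA_ext (f := fun t : tensA _ _ => twist_tens_fun (tract t b))
  (g := fun t : tensA _ _ => tract (twist_tens_fun t : tensA M N) (beta b))) => [||m n].
- exact: (lin_comp (@tract_linear _ _ _ _ b) fl).
- exact: (lin_comp fl (@tract_linear _ _ _ _ (beta b))).
- by rewrite tract_pure !fp tract_pure.
Qed.

Definition twist_tens : bhom (bitens M (twist idfun beta N))
    (twist idfun beta (bitens M N)) := BHom twist_tens_hom.
End Twist.

Definition bhom1 X : bhom X X := BHom (@bhom_id k A X).

Definition chain_map1 C : chain_map C C :=
  @ChainMap C C (fun i x => x) (fun i => @bhom_id k A (C i)) (fun i j x => erefl).

Section Groups.
Variables (T : complete_resolution) (X : bimod A) (n : int).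

Definition tate_cohom : lmodType k := cohom T X n.
Definition tate_homol : lmodType k := homol T X n.
Definition hoch_cohom : lmodType k := cohom (trunc T) X n.
Definition hoch_homol : lmodType k := homol (trunc T) X n.

Definition tate_to_hoch : tate_homol -> hoch_homol :=
  @homol_map T (trunc T) X X (trunc_map T) (bhom1 X) n.
End Groups.

End Complexes.

Arguments aug {k A} _ _.
Arguments diag_approx {k A} C eps.
Arguments cup {k A C eps} Delta {M N} p q n x y.
Arguments cupT {k A C eps} Delta {M N} p q n t.
Arguments cap {k A C eps} Delta {M N} p q m x z.
Arguments homol_map {k A C D X Y} f g n z.
Arguments tate_to_hoch {k A} T {X n} z.

(* Main.v *)
(** Write e = coaug 1 and T ⊗_A X for the tensor product of the complete
    resolution with X.  If b, b' are dual bases for the Frobenius form, averaging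
    f ↦ Σ b_i f(b'_i -) turns right-linear maps into bimodule maps; since T is
    right-linearly contractible, this gives both the lifting and the extension
    property for bimodule maps T_j -> T_i ⊗_A X.  The norm
    p ⊗ x ↦ Σ b_i p ⊗ x b'_i identifies P ⊗_{A^e} 1_X_(ν^-1) with the invariants of
    P ⊗_A X for projective P.  For a cocycle v of degree n < 0 the map
    (1 ⊗ v)Δ : T -> (T ⊗_A X)[-n] is a chain map lifting v, and its value at e is
    an invariant cycle of degree -1 - n; lifting and extending chain maps shows that
    v ↦ ((1 ⊗ v)Δ)(e) induces an isomorphism of the degree n cohomology with the
    degree -1 - n homology.  The diagram commutes because capping with u and
    cupping with u both amount to chain maps T -> T ⊗_A M ⊗_A N with cohomologous
    augmentations, hence homotopic ones. *)

Require Import Defs.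
From HB Require Import structures.
From mathcomp Require Import all_boot all_order all_algebra all_field.
From mathcomp Require Import boolp functions.
From mathcomp Require Import zify.

Set Implicit Arguments.
Unset Strict Implicit.
Unset Printing Implicit Defensive.

Import GRing.Theory.
Local Open Scope ring_scope.


(** * Linear algebra *)

(** The coefficients X are arbitrary, so T_i ⊗_A X need not be projective, and lifting into it or
    extending to it cannot rest on projectivity alone. What survives tensoring with X is a one-sided
    form of Higman's criterion ([lhigman]): the identity is Σ b_i t(b'_i -) for a right-linear t.
    Averaging turns a right-linear g into a bimodule map; composing with t after g solves extension
    problems, composing with t before g solves lifting problems. Everything is thereby reduced to
    right-linear algebra, where T splits because A is free as a right module. The endomorphism (ε ⊗
    1)Δ need not be the identity, and no relation is assumed between the approximation on T and the
    one on its truncation. Each is compared with the identity by its own homotopy: in negative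
    degrees for T, in nonnegative degrees for the truncation. These are the degrees of the cocycles
    v and u that occur in the diagram. Evaluation at e loses nothing essential: e generates the
    image of d_0, so a bimodule map on T_(-1) that kills e vanishes on boundaries and can be
    extended to T_(-2). *)

Section Splitting.
Variable k : fieldType.

Definition finite_span (V : lmodType k) :=
  exists n (w : 'I_n -> V), forall x, exists c : 'rV[k]_n, x = \sum_i c 0 i *: w i.

(** A matrix of maximal rank among those with rows in [S] works, since adjoining one more vector of
    [S] cannot raise the rank. *)
Lemma submodule_rV n (S : submodule ('rV[k]_n : lmodType k)) :
  exists m : nat, exists2 B : 'M[k]_(m, n), forall i, row i B \in S
    & forall v, v \in S -> (v <= B)%MS.
Proof.
pose P r := `[< exists m, exists2 B : 'M[k]_(m, n), forall i, row i B \in S & \rank B = r >].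
have P0 : exists r, P r.
  by exists 0%N; apply/asboolP; exists 0%N, 0; [case|rewrite mxrank0].
have Pn r : P r -> (r <= n)%N by move=> /asboolP[m [B _ <-]]; exact: rank_leq_col.
case: (ex_maxnP P0 Pn) => r /asboolP[m [B BS Br]] rmax.
exists m, B => // v vS; apply: submx_trans (addsmxSr B v) _.
rewrite -(geq_leqif (mxrank_leqif_sup (addsmxSl B v))).
rewrite Br; apply: rmax; apply/asboolP; exists (m + 1)%N, (col_mx B v).
  by move=> i; case: (split_ordP i) => j ->; rewrite ?rowKu ?rowKd ?BS // ord1 row_id.
by rewrite addsmxE.
Qed.

Lemma finite_span_section (W : lmodType k) n (w : 'I_n -> W) :
  (forall x, exists c : 'rV[k]_n, x = \sum_i c 0 i *: w i) ->
  exists2 f : W -> 'rV[k]_n, linear f & forall x, x = \sum_i f x 0 i *: w i.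
Proof.
move=> wP; pose phi (c : 'rV[k]_n) := \sum_i c 0 i *: w i.
have phil : linear phi.
  move=> a u v; rewrite /phi scaler_sumr -big_split; apply: eq_bigr => i _ /=.
  by rewrite !mxE scalerDl scalerA.
have kerP : submod_closed (fun c : 'rV[k]_n => phi c == 0).
  split=> [|a u v /eqP u0 /eqP v0]; apply/eqP; first exact: (lin0 phil).
  by rewrite phil u0 v0 scaler0 addr0.
have [m [B BK KB]] := submodule_rV (Submodule kerP).
have KE v : (v <= B)%MS -> phi v = 0.
  move=> /submxP[D ->]; rewrite mulmx_sum_row (lin_sum phil) big1 // => i _.
  by rewrite (linZ phil); move/eqP: (BK i) => ->; rewrite scaler0.
(* Projection along the relations: [pr] vanishes exactly on the kernel of [phi], so [pr c] depends
   only on [phi c], and arbitrarily chosen preimages become linear in [x] after applying it. *)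
pose pr (c : 'rV[k]_n) := c - c *m pinvmx B *m B.
have prl : linear pr.
  by move=> a u v; rewrite /pr !mulmxDl -!scalemxAl scalerBr opprD addrACA.
have phipr c : phi (pr c) = phi c.
  by rewrite (linB phil) [X in _ - X]KE ?subr0 // submxMl.
have prK c c' : phi c = phi c' -> pr c = pr c'.
  move=> e; apply/eqP; rewrite -subr_eq0 -(linB prl) /pr subr_eq0 eq_sym; apply/eqP.
  by apply: mulmxKpV; apply: KB; apply/eqP; rewrite (linB phil) e subrr.
pose c x := classical_sets.xget 0 (fun c : 'rV[k]_n => x = phi c).
have cP x : phi (c x) = x.
  by have [c0 e] := wP x; rewrite /c; case: classical_sets.xgetP => [? _ ->|/(_ c0)].
exists (fun x => pr (c x)) => [a u v|x]; last by rewrite -/(phi _) phipr cP.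
by rewrite -prl; apply: prK; rewrite phil !cP.
Qed.

Lemma linear_splitting (V W : lmodType k) (d : V -> W) :
  finite_span W -> linear d ->
  exists2 s : W -> V, linear s & forall x, d (s (d x)) = d x.
Proof.
move=> [n [w wP]] dl; have [f fl fw] := finite_span_section wP.
pose phi (c : 'rV[k]_n) := \sum_i c 0 i *: w i.
have phil : linear phi.
  move=> a u v; rewrite /phi scaler_sumr -big_split; apply: eq_bigr => i _ /=.
  by rewrite !mxE scalerDl scalerA.
have imP : submod_closed (fun c : 'rV[k]_n => `[< exists x, phi c = d x >]).
  split=> [|a u v /asboolP[x ux] /asboolP[y vy]]; apply/asboolP.
    by exists 0; rewrite (lin0 phil) (lin0 dl).
  by exists (a *: x + y); rewrite phil dl ux vy.
have [m [B BS SB]] := submodule_rV (Submodule imP).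
have /choice[v vE] : forall i, exists x, phi (row i B) = d x.
  by move=> i; exact/asboolP/(BS i).
exists (fun y => \sum_i (f y *m pinvmx B) 0 i *: v i) => [a x y|x].
  rewrite fl mulmxDl -scalemxAl scaler_sumr -big_split; apply: eq_bigr => i _ /=.
  by rewrite !mxE scalerDl scalerA.
have fdx : phi (f (d x)) = d x by exact/esym/fw.
rewrite -[RHS]fdx -[in RHS](@mulmxKpV _ _ _ _ (f (d x)) B); last first.
  by apply: SB; apply/asboolP; exists x.
rewrite [in RHS]mulmx_sum_row (lin_sum phil) (lin_sum dl); apply: eq_bigr => i _.
by rewrite (linZ phil) (linZ dl) vE.
Qed.

Lemma span_seq (V : lmodType k) (s : seq V) :
  (forall x, x \in Defs.span (fun y => y \in s)) -> finite_span V.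
Proof.
move=> sP; exists (size s), (fun i => s`_i) => x.
have cl : submod_closed (fun x : V =>
    `[< exists c : 'rV[k]_(size s), x = \sum_i c 0 i *: s`_i >]).
  split=> [|a u v /asboolP[c ->] /asboolP[c' ->]]; apply/asboolP.
    by exists 0; rewrite big1 // => i _; rewrite mxE scale0r.
  exists (a *: c + c'); rewrite scaler_sumr -big_split; apply: eq_bigr => i _ /=.
  by rewrite !mxE scalerDl scalerA.
apply/asboolP; apply: (span_sub (S := Submodule cl) _ (sP x)) => {}x xs.
have xi : (index x s < size s)%N by rewrite index_mem.
apply/asboolP; exists (delta_mx 0 (Ordinal xi)).
rewrite (bigD1 (Ordinal xi)) //= mxE !eqxx scale1r nth_index // big1 ?addr0 // => i.
by move=> /negPf ne; rewrite mxE ne scale0r.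
Qed.
End Splitting.

Lemma bimod_finite_span (k : fieldType) (A : falgType k) (P : bimod A) :
  finitely_generated P -> finite_span P.
Proof.
move=> [s sP]; pose b := vbasis (@fullv k A).
pose L := [seq lact ac.1 (ract x ac.2) | ac <- [seq (a, c) | a <- b, c <- b], x <- s].
have aE (a : A) : a = \sum_i coord b i a *: b`_i by rewrite -coord_vbasis ?memvf.
have sumE (V : lmodType k) (f : A -> V) : linear f -> forall a,
    f a = \sum_i coord b i a *: f b`_i.
  by move=> fl a; rewrite {1}[a]aE (lin_sum fl); apply: eq_bigr => i _; rewrite (linZ fl).
(* The span of [L] is not visibly stable under the actions. The elements all of whose translates lie
   in this span form a subbimodule, and it contains the generators. *)
have Scl : submod_closed (fun y : P =>
    `[< forall a c, lact a (ract y c) \in Defs.span (fun y => y \in L) >]).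
  split=> [|c u v /asboolP uS /asboolP vS]; apply/asboolP => a c'.
    by rewrite (lin0 ((ract_bilin P).2 _)) (lin0 ((lact_bilin P).1 _)) rpred0.
  by rewrite (ract_bilin P).2 (lact_bilin P).1 rpredD ?rpredZ ?uS ?vS.
apply: (@span_seq _ _ L) => x.
have /asboolP/(_ 1 1) : x \in Submodule Scl.
  apply: sP => [a y c /asboolP yS|y ys]; apply/asboolP => a' c'.
    by rewrite -ractM lractA -lactM yS.
  rewrite (sumE _ (fun a => lact a _) ((lact_bilin P).2 _)); apply: rpred_sum => i _.
  rewrite (sumE _ (fun c => lact _ (ract _ c))); last first.
    exact: (lin_comp ((ract_bilin P).1 _) ((lact_bilin P).1 _)).
  apply/rpredZ/rpred_sum => j _; apply/rpredZ/mem_span.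
  have bb (l : 'I_(\dim (@fullv k A))) : b`_l \in tval b by rewrite mem_nth ?size_tuple.
  apply/allpairsP; exists ((b`_i, b`_j), y); split=> //.
  by apply/allpairsP; exists (b`_i, b`_j); split=> //=.
by rewrite lact1 ract1.
Qed.

(** * Dual bases and Higman's criterion *)

Section DualBases.
Variables (k : fieldType) (A : falgType k) (form : A -> A -> k).

Record dual_bases := DualBases {
  db_dim : nat;
  db : 'I_db_dim -> A;
  db' : 'I_db_dim -> A;
  dbE : forall x, x = \sum_i form (db' i) x *: db i;
  db'E : forall x, x = \sum_i form x (db i) *: db' i }.

Hypothesis ff : frobenius_form form.

Let form_l x : linear (form x : A -> k^o). Proof. by case: ff => -[]. Qed.
Let form_r x : linear (form^~ x : A -> k^o). Proof. by case: ff => -[]. Qed.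

(** Non-degeneracy makes the Gram matrix of a basis invertible, and its inverse supplies [b']. The
    expansion in [b'] is then tested by pairing with the basis on the right. *)
Lemma frobenius_dual_bases : inhabited dual_bases.
Proof.
have [_ _ nd nd'] := ff.
pose n := \dim (@fullv k A); pose b (i : 'I_n) := (vbasis (@fullv k A))`_i.
have bE x : x = \sum_i coord (vbasis (@fullv k A)) i x *: b i.
  by rewrite -coord_vbasis ?memvf.
pose G := \matrix_(i, j) form (b i) (b j).
have Gu : G \in unitmx.
  rewrite -row_free_unit; apply: inj_row_free => c cG.
  pose x := \sum_i c 0 i *: b i; have x0 : x = 0.
    apply: nd => y; rewrite [y]bE (lin_sum (form_l x)) big1 // => j _.
    rewrite (linZ (form_l x)) (lin_sum (form_r (b j))).
    have /(congr1 (fun M : 'rV_n => M 0 j)) := cG; rewrite !mxE => e.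
    rewrite -[RHS](mulr0 (coord (vbasis (@fullv k A)) j y)).
    congr (_ *: _); rewrite -[RHS]e; apply: eq_bigr => i _.
    by rewrite (linZ (form_r (b j))) mxE.
  have bfree : free (vbasis (@fullv k A)) := basis_free (vbasisP _).
  by apply/rowP => i; rewrite mxE; exact: (freeP bfree) (c 0) x0 i.
pose b' (i : 'I_n) := \sum_l invmx G i l *: b l.
have b'b i j : form (b' i) (b j) = (i == j)%:R.
  rewrite (lin_sum (form_r (b j))); have := congr1 (fun M : 'M_n => M i j) (mulVmx Gu).
  rewrite !mxE => <-; apply: eq_bigr => l _.
  by rewrite (linZ (form_r (b j))) mxE.
exists; apply: (@DualBases n b b') => x.
  rewrite {1}[x]bE; apply: eq_bigr => i _; congr (_ *: _).
  rewrite [x in RHS]bE (lin_sum (form_l _)) (bigD1 i) //= big1 => [|j ne].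
    by rewrite (linZ (form_l _)) b'b eqxx addr0; exact/esym/mulr1.
  by rewrite (linZ (form_l _)) b'b eq_sym (negPf ne) scaler0.
apply/eqP; rewrite -subr_eq0; apply/eqP; apply: nd => y.
rewrite (linB (form_r y)) [y]bE !(lin_sum (form_l _)) -sumrB big1 // => j _.
rewrite !(linZ (form_l _)) -scalerBr (lin_sum (form_r (b j))) (bigD1 j) //= big1 => [|i ne].
  by rewrite (linZ (form_r _)) b'b eqxx addr0 [X in _ - X]mulr1 subrr scaler0.
by rewrite (linZ (form_r _)) b'b (negPf ne) scaler0.
Qed.
End DualBases.

Section Casimir.
Variables (k : fieldType) (A : falgType k) (form : A -> A -> k).
Variable D : dual_bases form.
Hypothesis ff : frobenius_form form.
Local Notation b := (@db _ _ _ D).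
Local Notation b' := (@db' _ _ _ D).

Let bE x : x = \sum_i form (b' i) x *: b i. Proof. exact: dbE. Qed.
Let b'E x : x = \sum_i form x (b i) *: b' i. Proof. exact: db'E. Qed.

(** Centrality of the Casimir element Σ b_i ⊗ b'_i: both sides expand to the same double sum,
    because [form (b' j) (a * b i)] equals [form (b' j * a) (b i)]. An arbitrary bilinear [f] stands
    for the tensor product, so the identity can be used in any two slots. *)
Lemma casimir_mul (V : lmodType k) (f : A -> A -> V) a : bilin f ->
  \sum_i f (a * b i) (b' i) = \sum_i f (b i) (b' i * a).
Proof.
case: ff => _ fA _ _ [fr fl].
under eq_bigr => i _ do rewrite [X in f X]bE (lin_sum (fl _)).
under [RHS]eq_bigr => i _ do rewrite [X in f _ X]b'E (lin_sum (fr _)).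
rewrite exchange_big; apply: eq_bigr => i _; apply: eq_bigr => j _.
by rewrite (linZ (fl _)) (linZ (fr _)) -fA.
Qed.

Lemma casimir_unit_l : \sum_i form 1 (b i) *: b' i = 1.
Proof. by rewrite -db'E. Qed.

Lemma casimir_unit_r : \sum_i form (b' i) 1 *: b i = 1.
Proof. by rewrite -dbE. Qed.

Section Nakayama.
Variable nu : alg_aut A.
Hypothesis nuP : nakayama form nu.

Lemma casimir_nakayama (V : lmodType k) (f : A -> A -> V) : bilin f ->
  \sum_i f (nu (b' i)) (b i) = \sum_i f (b i) (b' i).
Proof.
move=> [fr fl]; under eq_bigr => i _ do rewrite [X in f X]bE (lin_sum (fl _)).
rewrite exchange_big; apply: eq_bigr => j _.
rewrite [X in f _ X]bE (lin_sum (fr _)); apply: eq_bigr => i _.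
by rewrite (linZ (fl _)) (linZ (fr _)) -nuP.
Qed.

(** Moving [a] from the right of b_i to the left of b'_i costs ν^(-1), since [form (b' j) (b i * a)]
    equals [form (aut_inv nu a * b' j) (b i)]. The twist of the homology coefficients originates
    here. *)
Lemma casimir_twist (V : lmodType k) (f : A -> A -> V) a : bilin f ->
  \sum_i f (b i * a) (b' i) = \sum_i f (b i) (aut_inv nu a * b' i).
Proof.
case: ff => _ fA _ _ [fr fl].
under eq_bigr => i _ do rewrite [X in f X]bE (lin_sum (fl _)).
under [RHS]eq_bigr => i _ do rewrite [X in f _ X]b'E (lin_sum (fr _)).
rewrite exchange_big; apply: eq_bigr => i _; apply: eq_bigr => j _.
rewrite (linZ (fl _)) (linZ (fr _)); congr (_ *: _).
by rewrite -fA -[a in LHS](aut_invK nu) -nuP fA.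
Qed.
End Nakayama.

Section Higman.
Implicit Types (P Q X Y : bimod A).

Lemma lact_sum X a J (s : seq J) (F : J -> X) :
  lact a (\sum_(j <- s) F j) = \sum_(j <- s) lact a (F j).
Proof. exact: (lin_sum ((lact_bilin X).1 a)). Qed.
Lemma ract_sum X a J (s : seq J) (F : J -> X) :
  ract (\sum_(j <- s) F j) a = \sum_(j <- s) ract (F j) a.
Proof. exact: (lin_sum ((ract_bilin X).2 a)). Qed.

(** The coinduced bimodule Hom_k(A ⊗ A, X) *)
Lemma bilin_closed X : submod_closed (fun f : A -> A -> X => `[< bilin f >]).
Proof.
split=> [|c f g /asboolP[fr fl] /asboolP[gr gl]]; apply/asboolP.
  by split=> ?; exact: lin_cst0.
by split=> ?; apply: lin_add.
Qed.

Definition coind_car X := subspace (Submodule (@bilin_closed X)).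

Lemma coind_act_subproof X (f : coind_car X) (a c : A) :
  `[< bilin (fun x y => val f (x * a) (c * y)) >].
Proof.
have /asboolP[fr fl] : `[< bilin (val f) >] := valP f.
apply/asboolP; split=> [x|y] l u v; first by rewrite mulrDr -scalerAr fr.
by rewrite mulrDl -scalerAl fl.
Qed.

Definition coind_act X a c (f : coind_car X) : coind_car X :=
  @Subspace _ _ (Submodule (@bilin_closed X)) _ (coind_act_subproof f a c).

Lemma coind_ext X (f g : coind_car X) : (forall x y, val f x y = val g x y) -> f = g.
Proof. by move=> e; apply: val_inj; do 2 apply/funext => ?. Qed.

Lemma coind_bilin X (f : coind_car X) : bilin (val f).
Proof. exact/asboolP/(valP f). Qed.

Definition coind X : bimod A.
Proof.
refine (@Bimod k A (coind_car X) (fun a => coind_act a 1) (fun f => coind_act 1^~ f)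
  _ _ _ _ _ _ _).
- split=> [a|f] c u v; apply: coind_ext => x y //=.
  by rewrite mulrDr -scalerAr (coind_bilin f).2.
- split=> [f|a] c u v; apply: coind_ext => x y //=.
  by rewrite mulrDl -scalerAl (coind_bilin f).1.
- by move=> f; apply: coind_ext => x y /=; rewrite mulr1 mul1r.
- by move=> u v f; apply: coind_ext => x y /=; rewrite !mul1r mulrA.
- by move=> f; apply: coind_ext => x y /=; rewrite mulr1 mul1r.
- by move=> f u v; apply: coind_ext => x y /=; rewrite !mulr1 mulrA.
- by move=> u f v; apply: coind_ext => x y /=; rewrite !mulr1 !mul1r.
Defined.

Definition coind_eval X (f : coind_car X) : X :=
  \sum_i \sum_j lact (b i) (ract (val f (b' i) (b j)) (b' j)).

(** Higman's criterion: [t] is the value at (1, 1) of a section of [coind_eval]. *)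
Lemma higman P : projective P -> exists2 t : P -> P, linear t &
  forall p, p = \sum_i \sum_j lact (b i) (ract (t (ract (lact (b' i) p) (b j))) (b' j)).
Proof.
move=> Pproj;
have lr := @lact_bilin _ _ P; have rr := @ract_bilin _ _ P.
have evh : is_bhom (@coind_eval P : coind P -> P).
  split=> [c u v|a f|f a].
  - rewrite /coind_eval scaler_sumr -big_split; apply: eq_bigr => i _.
    rewrite scaler_sumr -big_split; apply: eq_bigr => j _ /=.
    by rewrite rr.2 lr.1.
  - rewrite /coind_eval exchange_big [in RHS]exchange_big lact_sum.
    apply: eq_bigr => j _; under eq_bigr do rewrite /= mul1r.
    rewrite -(casimir_mul (f := fun x y => lact x (ract (val f y (b j)) (b' j)))).
      by rewrite lact_sum; apply: eq_bigr => i _; rewrite lactM.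
    split=> [x|y]; last exact: lr.2.
    apply: lin_comp (lr.1 x); apply: lin_comp (rr.2 _); exact: (coind_bilin f).2.
  rewrite /coind_eval ract_sum; apply: eq_bigr => i _.
  under eq_bigr do rewrite /= mulr1.
  rewrite (casimir_mul (f := fun x y => lact (b i) (ract (val f (b' i) x) y))).
    by rewrite ract_sum; apply: eq_bigr => j _; rewrite ractM lractA.
  split=> [x|y]; last by apply: lin_comp (lr.1 _); apply: lin_comp (rr.2 _); exact: (coind_bilin f).1.
  by apply: lin_comp (lr.1 _); exact: rr.1.
(* The preimage of [p] is (x, y) ↦ [form x 1 * form 1 y] times [p]: its evaluation multiplies [p] by
   Σ [form (b' i) 1] b_i on the left and by Σ [form 1 (b j)] b'_j on the right, and both sums are
   1. *)
have evs (p : P) : exists f : coind P, coind_eval f = p.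
  have pb : `[< bilin (fun x y => (form x 1 * form 1 y) *: p) >].
    have [[fr fl] _ _ _] := ff.
    apply/asboolP; split=> [x|y] c u v.
      by rewrite (fr 1 c u v : _ = c * _ + _) mulrDr scalerDl mulrCA scalerA.
    by rewrite (fl 1 c u v : _ = c * _ + _) mulrDl scalerDl -mulrA scalerA.
  exists (@Subspace _ _ (Submodule (@bilin_closed P)) _ pb); rewrite /coind_eval /=.
  rewrite -[RHS]lact1 -[in RHS]casimir_unit_r (lin_sum (lr.2 _)).
  apply: eq_bigr => i _; rewrite (linZ (lr.2 _)).
  rewrite -[in RHS](ract1 p) -[X in ract p X]casimir_unit_l (lin_sum (rr.1 _)).
  rewrite lact_sum scaler_sumr; apply: eq_bigr => j _.
  by rewrite (linZ (rr.1 _)) (linZ (rr.2 _)) !(linZ (lr.1 _)) scalerA.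
have [h [hl hL hR] hK] := Pproj _ _ _ _ evh evs (@bhom_id _ _ P).
exists (fun p => val (h p : coind_car P) 1 1) => [c u v|p]; first by rewrite hl.
rewrite -[LHS]hK; apply: eq_bigr => i _; apply: eq_bigr => j _.
by rewrite hR hL /= !mul1r mulr1.
Qed.
End Higman.
End Casimir.

(** * Right-linear maps and functoriality of the tensor product over A *)

Section RightLinear.
Variables (k : fieldType) (A : algType k).
Implicit Types (P Q X Y Z : bimod A).

Definition is_rhom X Y (f : X -> Y) : Prop :=
  linear f /\ forall x a, f (ract x a) = ract (f x) a.

Lemma bhom_rhom X Y (f : X -> Y) : is_bhom f -> is_rhom f.
Proof. by case. Qed.

Lemma rhom_comp X Y Z (f : X -> Y) (g : Y -> Z) :
  is_rhom f -> is_rhom g -> is_rhom (fun x => g (f x)).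
Proof. by move=> [fl fR] [gl gR]; split=> [|x a]; [exact: lin_comp|rewrite fR gR]. Qed.

Lemma bhom_linear X Y (f : X -> Y) : is_bhom f -> linear f.
Proof. by case. Qed.

Lemma bhom_sub X Y (f g : X -> Y) : is_bhom f -> is_bhom g ->
  is_bhom (fun x => f x - g x).
Proof.
move=> fh gh; have := bhom_lin (-1) gh fh.
by congr is_bhom; apply/funext => x; rewrite scaleN1r addrC.
Qed.

Lemma bhom_scale X Y (f : X -> Y) c : is_bhom f -> is_bhom (fun x => c *: f x).
Proof.
move=> fh; have := bhom_lin c fh (@bhom_0 _ _ X Y).
by congr is_bhom; apply/funext => x; rewrite addr0.
Qed.

Lemma lact_pure X Y a (x : X) (y : Y) :
  lact a (pureA x y : bitens X Y) = pureA (lact a x) y.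
Proof. exact: tlact_pure. Qed.

Lemma ract_pure X Y a (x : X) (y : Y) :
  ract (pureA x y : bitens X Y) a = pureA x (ract y a).
Proof. exact: tract_pure. Qed.

Lemma tmap_rhom P Q X (s : P -> Q) :
  is_rhom s -> is_rhom (tmap s id : bitens P X -> bitens Q X).
Proof.
move=> [sl sR]; have tl : linear (tmap s id : tensA P X -> tensA Q X) by exact: tmapA_linear.
split=> // t a; move: t; apply: (tensA_ext (f := fun t => tmap s id (tract t a))
  (g := fun t => tract (tmap s id t) a)) => [||p x].
- exact: lin_comp (@tract_linear _ _ _ _ a) tl.
- exact: lin_comp tl (@tract_linear _ _ _ _ a).
- by rewrite tract_pure !tmapA_pure // tract_pure.
Qed.

Lemma tmap_pure_r P Q X (s : P -> Q) p x : is_rhom s ->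
  (tmap s id : bitens P X -> bitens Q X) (pureA p x) = pureA (s p) x.
Proof. by case=> sl sR; exact: tmapA_pure. Qed.

Lemma tmap_pure_b (X Y X' Y' : bimod A) (f : X -> X') (g : Y -> Y') x y :
  is_bhom f -> is_bhom g ->
  (tmap f g : bitens X Y -> bitens X' Y') (pureA x y) = pureA (f x) (g y).
Proof. by move=> [fl fL fR] [gl gL gR]; exact: tmapA_pure. Qed.

Lemma bitens_ext X Y Z (f g : bitens X Y -> Z) : linear f -> linear g ->
  (forall x y, f (pureA x y) = g (pureA x y)) -> f =1 g.
Proof. exact: tensA_ext. Qed.

Lemma tmap_comp_b (X Y X' Y' X2 Y2 : bimod A) (f : X -> X') (g : Y -> Y')
    (f' : X' -> X2) (g' : Y' -> Y2) (z : bitens X Y) :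
  is_bhom f -> is_bhom g -> is_bhom f' -> is_bhom g' ->
  tmap f' g' (tmap f g z : bitens X' Y') =
  tmap (fun x => f' (f x)) (fun y => g' (g y)) z :> bitens X2 Y2.
Proof.
move=> fh gh fh' gh'; have h1 := bhom_tmap fh gh; have h2 := bhom_tmap fh' gh'.
have fh2 := bhom_comp fh fh'; have gh2 := bhom_comp gh gh'.
move: z; apply: bitens_ext => [||x y].
- exact: bhom_linear (bhom_comp h1 h2).
- exact: bhom_linear (bhom_tmap fh2 gh2).
- by rewrite !tmap_pure_b.
Qed.

Lemma tmap_addl (X Y X' Y' : bimod A) (f f' : X -> X') (g : Y -> Y') c (z : bitens X Y) :
  is_bhom f -> is_bhom f' -> is_bhom g ->
  tmap (fun x => c *: f x + f' x) g z = c *: tmap f g z + tmap f' g z :> bitens X' Y'.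
Proof.
move=> fh fh' gh; have fh2 := bhom_lin c fh fh'.
move: z; apply: bitens_ext => [||x y].
- exact: bhom_linear (bhom_tmap fh2 gh).
- by apply: lin_add; exact: bhom_linear (bhom_tmap _ gh).
- by rewrite !tmap_pure_b // (pureA_bilin _ _).2.
Qed.

Lemma tmap_addr (X Y X' Y' : bimod A) (f : X -> X') (g g' : Y -> Y') c (z : bitens X Y) :
  is_bhom f -> is_bhom g -> is_bhom g' ->
  tmap f (fun x => c *: g x + g' x) z = c *: tmap f g z + tmap f g' z :> bitens X' Y'.
Proof.
move=> fh gh gh'; have gh2 := bhom_lin c gh gh'.
move: z; apply: bitens_ext => [||x y].
- exact: bhom_linear (bhom_tmap fh gh2).
- by apply: lin_add; exact: bhom_linear (bhom_tmap fh _).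
- by rewrite !tmap_pure_b // (pureA_bilin _ _).1.
Qed.

Lemma tmap_0r (X Y X' Y' : bimod A) (f : X -> X') (z : bitens X Y) : is_bhom f ->
  tmap f (fun _ => 0) z = 0 :> bitens X' Y'.
Proof.
move=> fh; have g0 := @bhom_0 _ _ Y Y'.
move: z; apply: (bitens_ext (Z := bitens X' Y')) => [||x y].
- exact: bhom_linear (bhom_tmap fh g0).
- exact: lin_cst0.
- by rewrite tmap_pure_b // (lin0 ((pureA_bilin _ _).1 _)).
Qed.

End RightLinear.

(** * Averaging right-linear maps into bimodule maps *)

Section Averaging.
Variables (k : fieldType) (A : falgType k) (form : A -> A -> k).
Variable D : dual_bases form.
Hypothesis ff : frobenius_form form.
Local Notation b := (@db _ _ _ D).
Local Notation b' := (@db' _ _ _ D).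
Implicit Types (P Q X Y Z : bimod A).

Definition avg_l X Y (g : X -> Y) x : Y := \sum_i lact (b i) (g (lact (b' i) x)).
Definition avg_r X Y (g : X -> Y) x : Y := \sum_i ract (g (ract x (b i))) (b' i).

Lemma avg_l_bhom X Y (g : X -> Y) : is_rhom g -> is_bhom (avg_l g).
Proof.
move=> [gl gR]; split=> [c u v|a x|x a].
- rewrite /avg_l scaler_sumr -big_split; apply: eq_bigr => i _ /=.
  by rewrite (lact_bilin X).1 gl (lact_bilin Y).1.
- rewrite /avg_l lact_sum; under eq_bigr do rewrite -lactM.
  rewrite -(casimir_mul D ff (f := fun c c' => lact c (g (lact c' x)))).
    by apply: eq_bigr => i _; rewrite lactM.
  split=> [c|c]; last exact: (lact_bilin Y).2.
  by apply: lin_comp ((lact_bilin Y).1 c); apply: lin_comp gl; exact: (lact_bilin X).2.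
- by rewrite /avg_l ract_sum; apply: eq_bigr => i _; rewrite -lractA gR lractA.
Qed.

Lemma avg_r_rhom X Y (g : X -> Y) : linear g -> is_rhom (avg_r g).
Proof.
move=> gl; split=> [c u v|x a].
- rewrite /avg_r scaler_sumr -big_split; apply: eq_bigr => i _ /=.
  by rewrite (ract_bilin X).2 gl (ract_bilin Y).2.
- rewrite /avg_r ract_sum; under eq_bigr do rewrite -ractM.
  rewrite (casimir_mul D ff (f := fun c c' => ract (g (ract x c)) c')).
    by apply: eq_bigr => i _; rewrite ractM.
  split=> [c|c]; first exact: (ract_bilin Y).1.
  by apply: lin_comp ((ract_bilin Y).2 c); apply: lin_comp gl; exact: (ract_bilin X).1.
Qed.

(** Higman's criterion relative to the right action. It is inherited by P ⊗_A X for every X, and it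
    acts as relative projectivity when it holds for a source and as relative injectivity when it
    holds for a target. *)
Definition lhigman Y (t : Y -> Y) := is_rhom t /\ forall y, avg_l t y = y.

Lemma projective_lhigman P : projective P -> exists t : P -> P, lhigman t.
Proof.
move=> /(higman D ff)[t tl tP]; exists (avg_r t); split; first exact: avg_r_rhom.
by move=> p; rewrite [RHS]tP; apply: eq_bigr => i _; rewrite lact_sum.
Qed.

Lemma projective_rhigman P : projective P ->
  exists2 t : P -> P, linear t & forall p, avg_r t p = p.
Proof.
move=> /(higman D ff)[t tl tP]; exists (avg_l t) => [c u v|p].
  rewrite /avg_l scaler_sumr -big_split; apply: eq_bigr => i _ /=.
  by rewrite (lact_bilin P).1 tl (lact_bilin P).1.
rewrite [RHS]tP exchange_big; apply: eq_bigr => j _; rewrite ract_sum.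
by apply: eq_bigr => i _; rewrite lractA lractA.
Qed.

Lemma lhigman_bitens P X (t : P -> P) : lhigman t ->
  lhigman (tmap t id : bitens P X -> bitens P X).
Proof.
move=> [th tK]; have th2 := tmap_rhom X th; split=> //.
apply: bitens_ext => [||p x] //; first exact: bhom_linear (avg_l_bhom th2).
rewrite -[p in RHS]tK (lin_sum ((pureA_bilin P X).2 x)); apply: eq_bigr => i _.
by rewrite lact_pure tmap_pure_r // lact_pure.
Qed.

(** The average of t f s extends [f]: on [d x] every b'_i passes through [d], where f s d = f
    applies, and then through [f], which leaves the average of [t] at [f x]. *)
Lemma higman_extend P Q Y (d : P -> Q) (f : P -> Y) (s : Q -> P) (t : Y -> Y) :
  lhigman t -> is_bhom d -> is_bhom f -> is_rhom s ->
  (forall x, f (s (d x)) = f x) -> exists2 g : Q -> Y, is_bhom g & forall x, g (d x) = f x.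
Proof.
move=> [th tK] [_ dL _] fh sh fsd; have [_ fL _] := fh.
exists (avg_l (fun q => t (f (s q)))) => [|x].
  exact: avg_l_bhom (rhom_comp (rhom_comp sh (bhom_rhom fh)) th).
by rewrite -[RHS]tK; apply: eq_bigr => i _; rewrite -dL fsd fL.
Qed.

Lemma higman_lift P Y Y' (t : P -> P) (d : Y' -> Y) (f : P -> Y) (h0 : P -> Y') :
  lhigman t -> is_bhom d -> is_bhom f -> is_rhom h0 -> (forall p, d (h0 p) = f p) ->
  exists2 h : P -> Y', is_bhom h & forall p, d (h p) = f p.
Proof.
move=> [th tK] [dl dL _] fh h0h dh0; have [fl fL _] := fh.
exists (avg_l (fun p => h0 (t p))) => [|p].
  exact: avg_l_bhom (rhom_comp th h0h).
rewrite -[in RHS](tK p) (lin_sum dl) (lin_sum fl); apply: eq_bigr => i _.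
by rewrite dL dh0 fL.
Qed.
End Averaging.

(** * Lifting and extension along a complete resolution *)

Section Resolution.
Variables (k : fieldType) (A : falgType k) (form : A -> A -> k).
Variable D : dual_bases form.
Hypothesis ff : frobenius_form form.
Variable T : complete_resolution A.
Implicit Types (i j l : int).

Local Notation d i j := (@diff _ _ (cres T) i j).

Lemma cres_lhigman j : exists t : T j -> T j, lhigman D t.
Proof. exact/(projective_lhigman D ff)/cres_proj. Qed.

Lemma cres_exact i j l (x : T j) : i = j + 1 -> j = l + 1 -> d j l x = 0 ->
  exists y : T i, d i j y = x.
Proof.
move=> -> jl; have {jl} -> : l = j - 1 by rewrite jl addrK.
exact: cres_acyclic.
Qed.

Lemma coaug0 : coaug T 0 = 0.
Proof. by case: (coaug_hom T) => l _ _; exact: lin0 l. Qed.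

Lemma aug_diff (x : T 1) : aug T (d 1 0 x) = 0.
Proof. by apply: (@coaug_inj _ _ T); rewrite -aug_factor diffK coaug0. Qed.

(** [p] is a right-linear projection along the cycles.  A k-linear section of d
    composed with [p] is right-linear on the image of d, and averaging on the right
    keeps it there. *)
Lemma section_down i j l (p : T j -> T j) : i = j + 1 -> j = l + 1 -> is_rhom p ->
  (forall x, d j l (p x) = d j l x) -> (forall y, p (d i j y) = 0) ->
  exists2 s : T l -> T j, is_rhom s & forall x, s (d j l x) = p x.
Proof.
move=> iE jE [pl pR] dp pd; have [dl _ dR] := diff_hom T j l.
have [t tl tK] := projective_rhigman D ff (@cres_proj _ _ T j).
have [s sl sd] := linear_splitting (bimod_finite_span (@cres_fg _ _ T l)) dl.
have psd x : p (s (d j l x)) = p x.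
  have [|y yE] := @cres_exact i j l (s (d j l x) - x) iE jE.
    by rewrite (linB dl) sd subrr.
  by apply/eqP; rewrite -subr_eq0 -(linB pl) -yE pd.
exists (avg_r D (fun x => t (p (s x)))) => [|x].
  by apply: (avg_r_rhom D ff) => c u v; rewrite sl pl tl.
by rewrite -[RHS]tK; apply: eq_bigr => a _; rewrite -dR psd pR.
Qed.

(** The map 1 - s d takes values in cycles, hence in boundaries, where a k-linear section [u] of d
    inverts d. Averaging on the right makes the result right-linear and keeps the identity, because
    1 - s d is already right-linear. *)
Lemma section_up i j l (s : T l -> T j) : i = j + 1 -> j = l + 1 -> is_rhom s ->
  (forall x, d j l (s (d j l x)) = d j l x) ->
  exists2 s' : T j -> T i, is_rhom s' & forall x, d i j (s' x) = x - s (d j l x).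
Proof.
move=> iE jE [sl sR] sd; have [dl _ dR] := diff_hom T j l; have [dl' _ dR'] := diff_hom T i j.
have [t tl tK] := projective_rhigman D ff (@cres_proj _ _ T j).
have [u ul ud] := linear_splitting (bimod_finite_span (@cres_fg _ _ T j)) dl'.
pose q x := x - s (d j l x).
have ql : linear q by move=> c x y; rewrite /q dl sl scalerBr opprD addrACA.
have duq x : d i j (u (q x)) = q x.
  have [|y <-] := @cres_exact i j l (q x) iE jE; last by [].
  by rewrite (linB dl) sd subrr.
exists (avg_r D (fun x => u (q (t x)))) => [|x].
  by apply: (avg_r_rhom D ff) => c x y; rewrite tl ql ul.
rewrite -/(q x) -[in RHS](tK x) (lin_sum dl') (lin_sum ql); apply: eq_bigr => a _.
by rewrite dR' duq /q dR sR (linB ((ract_bilin _).2 _)).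
Qed.

(** The splitting starts at A: with ε(x0) = 1, the map x ↦ x0 ε(x) is a right-linear projection of
    T_0 that kills boundaries. It spreads upward by [section_up] and downward by [section_down]. *)
Lemma cres_section j l : j = l + 1 ->
  exists2 s : T l -> T j, is_rhom s & forall x, d j l (s (d j l x)) = d j l x.
Proof.
have [x0 x0E] := aug_surj T 1; have [el eL eR] := aug_hom T; have [cl cL cR] := coaug_hom T.
have base : exists2 s : T (- 1) -> T 0, is_rhom s & forall x, d 0 (- 1) (s (d 0 (- 1) x)) = d 0 (- 1) x.
  have dp x : d 0 (- 1) (ract x0 (aug T x)) = d 0 (- 1) x.
    by rewrite !aug_factor eR x0E /= mul1r.
  have [|y|s sh sd] := @section_down 1 0 (- 1) (fun x => ract x0 (aug T x)) erefl erefl _ dp.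
  - split=> [c x y|x a]; first by rewrite el (ract_bilin _).1.
    by rewrite eR /= ractM.
  - by rewrite aug_diff (lin0 ((ract_bilin _).1 _)).
  - by exists s => // x; rewrite sd dp.
case: l => n.
  elim: n j => [|n IH] j jE.
    rewrite jE; have [s sh sd] := base.
    have [s' sh' sd'] := @section_up 1 0 (- 1) s erefl erefl sh sd.
    exists s' => // x; rewrite sd'.
    by rewrite diffK (lin0 sh.1) subr0.
  have [s sh sd] := IH n.+1 ltac:(lia).
  have [s' sh' sd'] := @section_up j n.+1 n s jE ltac:(lia) sh sd.
  by exists s' => // x; rewrite sd' diffK (lin0 sh.1) subr0.
elim: n j => [|n IH] j jE; first by rewrite jE; exact: base.
have [s sh sd] := IH (Negz n + 1) erefl.
have nE : j = Negz n by lia.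
rewrite {}nE {j jE}; have [dl _ _] := diff_hom T (Negz n + 1) (Negz n).
have [|||s' sh' sd'] := @section_down (Negz n + 1) (Negz n) (Negz n.+1)
  (fun x => x - d (Negz n + 1) (Negz n) (s x)) erefl ltac:(lia).
- have [_ dr] := bhom_rhom (diff_hom T (Negz n + 1) (Negz n)).
  split=> [c x y|x a]; first by rewrite sh.1 dl scalerBr opprD addrACA.
  by rewrite sh.2 dr (linB ((ract_bilin _).2 _)).
- by move=> x; rewrite (linB (bhom_linear (diff_hom T _ _))) diffK subr0.
- by move=> y; rewrite sd subrr.
exists s' => // x; rewrite sd' (linB (bhom_linear (diff_hom T _ _))) diffK subr0 //.
Qed.
End Resolution.

(** * The complex T ⊗_A X *)

Section Coefficients.
Variables (k : fieldType) (A : falgType k) (form : A -> A -> k).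
Variable D : dual_bases form.
Hypothesis ff : frobenius_form form.
Variables (T : complete_resolution A) (X : bimod A).
Implicit Types (i j l : int) (a : nat).

Local Notation d i j := (@diff _ _ (cres T) i j).
Local Notation Y j := (bitens (T j) X).

Definition tensd i j : Y i -> Y j := tmap (d i j) id.

Lemma tensd_bhom i j : is_bhom (@tensd i j).
Proof. exact: bhom_tmap (diff_hom _ _ _) (@bhom_id _ _ _). Qed.

Lemma tensd_pure i j t x : @tensd i j (pureA t x) = pureA (d i j t) x.
Proof. exact: tmap_pure_b (diff_hom _ _ _) (@bhom_id _ _ _). Qed.

Lemma tensdK i j l y : @tensd j l (@tensd i j y) = 0.
Proof.
move: y; apply: bitens_ext => [||t x].
- exact: bhom_linear (bhom_comp (tensd_bhom i j) (tensd_bhom j l)).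
- exact: lin_cst0.
- by rewrite !tensd_pure diffK (lin0 ((pureA_bilin _ _).2 _)).
Qed.

(** ε ⊗ 1 followed by A ⊗_A X = X *)
Definition taug : Y 0 -> X := tlift (fun t x => lact (aug T t : A) x).

Let taug_bilin : bilin (fun (t : T 0) (x : X) => lact (aug T t : A) x).
Proof.
have [el _ _] := aug_hom T; split=> [t|x]; first exact: (lact_bilin X).1.
exact: lin_comp el ((lact_bilin X).2 x).
Qed.

Let taug_bal : balA (fun (t : T 0) (x : X) => lact (aug T t : A) x).
Proof. by move=> a t x; have [_ _ eR] := aug_hom T; rewrite eR /= lactM. Qed.

Lemma taug_pure t x : taug (pureA t x) = lact (aug T t : A) x.
Proof. exact: (tliftA_pure t x taug_bilin taug_bal). Qed.

Lemma taug_bhom : is_bhom taug.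
Proof.
have tl : linear (taug : tensA _ _ -> X) := tliftA_linear taug_bilin taug_bal.
split=> // [a t|t a].
  move: t; apply: (bitens_ext (Z := X) (f := fun t => taug (lact a t)) (g := fun t => lact a (taug t))) => [||t x].
  - exact: lin_comp ((lact_bilin (Y 0)).1 a) tl.
  - exact: lin_comp tl ((lact_bilin X).1 a).
  - have [_ eL _] := aug_hom T.
    by rewrite lact_pure !taug_pure eL /= lactM.
move: t; apply: (bitens_ext (Z := X) (f := fun t => taug (ract t a)) (g := fun t => ract (taug t) a)) => [||t x].
- exact: lin_comp ((ract_bilin (Y 0)).2 a) tl.
- exact: lin_comp tl ((ract_bilin X).2 a).
- by rewrite ract_pure !taug_pure lractA.
Qed.

Local Notation e := (coaug T 1).

Lemma coaug1_central c : lact c e = ract e c.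
Proof. by have [_ cL cR] := coaug_hom T; rewrite -cL -cR /= mulr1 mul1r. Qed.

Lemma coaugE c : coaug T c = lact c e.
Proof. by have [_ cL cR] := coaug_hom T; rewrite -cL /= mulr1. Qed.

Lemma tensd_taug y : @tensd 0 (- 1) y = pureA e (taug y).
Proof.
move: y; apply: (bitens_ext (Z := Y (-1)) (g := fun y => pureA e (taug y) : Y (-1))) => [||t x].
- exact: bhom_linear (tensd_bhom _ _).
- exact: lin_comp (bhom_linear taug_bhom) ((pureA_bilin _ _).1 _).
- by rewrite tensd_pure taug_pure aug_factor coaugE coaug1_central pureA_bal.
Qed.

(** The map x ↦ e ⊗ x is injective because [coaug] has a right-linear retraction. *)
Lemma taug_eq0 y : (taug y = 0) <-> (@tensd 0 (- 1) y = 0).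
Proof.
split=> [y0|]; first by rewrite tensd_taug y0 (lin0 ((pureA_bilin _ _).1 _)).
rewrite tensd_taug => e0.
have [s sh sd] := @cres_section _ _ _ D ff T 0 (- 1) erefl.
have [x0 x0E] := aug_surj T 1.
have se : aug T (s e) = 1.
  by apply: (@coaug_inj _ _ T); rewrite -aug_factor -[in LHS]x0E -aug_factor sd aug_factor x0E.
have sl := bhom_linear taug_bhom.
have := congr1 (fun z => taug (tmap s id z : Y 0)) e0.
by rewrite (tmap_pure_r _ _ sh) taug_pure se lact1 (lin0 (tmap_rhom X sh).1) (lin0 sl).
Qed.

Lemma tens_lift j i l m (f : T j -> Y i) : is_bhom f -> m = i + 1 -> i = l + 1 ->
  (forall x, @tensd i l (f x) = 0) ->
  exists2 h : T j -> Y m, is_bhom h & forall x, @tensd m i (h x) = f x.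
Proof.
move=> fh mE iE f0; have [t tH] := cres_lhigman D ff T j.
have [s sh sd] := @cres_section _ _ _ D ff T i l iE.
have [s' sh' sd'] := section_up D ff mE iE sh sd.
(* The maps s' ⊗ 1 and s ⊗ 1 contract T ⊗_A X in degree i; they are well defined over A because s'
   and s are right-linear. *)
have contr y : @tensd m i (tmap s' id y : Y m) = y - tmap s id (@tensd i l y : Y l).
  have l1 := bhom_linear (tensd_bhom m i); have l2 := bhom_linear (tensd_bhom i l).
  have l3 := (tmap_rhom X sh).1; have l4 := (tmap_rhom X sh').1.
  move: y; apply: (bitens_ext (Z := Y i) (f := fun y => @tensd m i (tmap s' id y : Y m))
    (g := fun y => y - tmap s id (@tensd i l y : Y l))) => [||p x].
  - exact: lin_comp l4 l1.
  - by move=> c u v; rewrite l2 l3 scalerBr opprD addrACA.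
  - rewrite tmap_pure_r // !tensd_pure tmap_pure_r // sd'.
    exact: linB ((pureA_bilin _ _).2 x) _ _.
have h0h : is_rhom (fun x => tmap s' id (f x) : Y m).
  exact: rhom_comp (bhom_rhom fh) (tmap_rhom X sh').
apply: (higman_lift ff tH (tensd_bhom m i) fh h0h) => x.
by rewrite contr f0 (lin0 (tmap_rhom X sh).1) subr0.
Qed.

Lemma taug_lift j (f : T j -> X) : is_bhom f ->
  exists2 h : T j -> Y 0, is_bhom h & forall x, taug (h x) = f x.
Proof.
move=> fh; have [t tH] := cres_lhigman D ff T j; have [x0 x0E] := aug_surj T 1.
have [fl fL fR] := fh.
have h0h : is_rhom (fun x => pureA x0 (f x) : Y 0).
  by split=> [|x a]; [exact: lin_comp fl ((pureA_bilin _ _).1 _)|rewrite fR ract_pure].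
apply: (higman_lift ff tH taug_bhom fh h0h) => x; by rewrite taug_pure x0E lact1.
Qed.

Lemma cres_extend i j l (Q : bimod A) (t : Q -> Q) (f : T j -> Q) :
  lhigman D t -> is_bhom f -> i = j + 1 -> j = l + 1 ->
  (forall x, f (d i j x) = 0) ->
  exists2 g : T l -> Q, is_bhom g & forall x, g (d j l x) = f x.
Proof.
move=> tH fh iE jE f0; have [s sh sd] := @cres_section _ _ _ D ff T j l jE.
apply: (higman_extend ff tH (diff_hom _ _ _) fh sh) => x.
have [|y yE] := @cres_exact _ _ T i j l (s (d j l x) - x) iE jE.
  by rewrite (linB (bhom_linear (diff_hom _ _ _))) sd subrr.
by apply/eqP; rewrite -subr_eq0 -(linB (bhom_linear fh)) -yE f0.
Qed.

Lemma tens_lhigman j : exists t : Y j -> Y j, lhigman D t.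
Proof.
have [t tH] := cres_lhigman D ff T j.
by exists (tmap t id); exact: (lhigman_bitens ff).
Qed.

(** An invariant [y] amounts to the bimodule map a ↦ a y on A. Composed with ε it kills the
    boundaries in T_0, hence extends along d_0. *)
Lemma extend_coaug (Q : bimod A) (t : Q -> Q) (y : Q) :
  lhigman D t -> (forall c, lact c y = ract y c) ->
  exists2 g : T (- 1) -> Q, is_bhom g & g e = y.
Proof.
move=> tH yc; have [el eL eR] := aug_hom T; have [x0 x0E] := aug_surj T 1.
have fh : is_bhom (fun x : T 0 => lact (aug T x : A) y).
  split=> [|a x|x a]; first exact: lin_comp el ((lact_bilin Q).2 y).
    by rewrite eL /= lactM.
  by rewrite eR /= lactM yc lractA.
have [x|g gh gE] := @cres_extend 1 0 (- 1) Q t _ tH fh erefl erefl.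
  by rewrite aug_diff (lin0 ((lact_bilin Q).2 y)).
by exists g => //; rewrite -x0E -aug_factor gE x0E lact1.
Qed.
End Coefficients.

(** * Chain maps attached to cocycles *)

Section Slice.
Variables (k : fieldType) (A : algType k) (C : bicomplex A).
Variables (eps : C 0 -> regbimod A) (Dl : diag_approx C eps).

(** The component C_j -> C_i ⊗_A X of (1 ⊗ v)Δ; it vanishes unless j = i + n. *)
Definition slice (X : bimod A) n (v : C n -> X) j i : C j -> bitens (C i) X :=
  fun x => tmap id v (Dl j i n x).

Lemma slice_bhom (X : bimod A) n (v : C n -> X) j i : is_bhom v -> is_bhom (@slice X n v j i).
Proof.
by move=> vh; exact: bhom_comp (dg_hom _ _ _ _) (bhom_tmap (@bhom_id _ _ _) vh).
Qed.

(** No sign appears, because the signed half of the differential acts on the factor to which the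
    cocycle [v] is applied, and [v] kills it. *)
Lemma slice_chain (X : bimod A) n (v : C n -> X) j i j' i' x : v \in cocycle C X n ->
  j = i + n -> j' = j + 1 -> i' = i + 1 ->
  slice v i (@diff _ _ C j' j x) = tmap (@diff _ _ C i' i) id (slice v i' x) :> bitens (C i) X.
Proof.
move=> vZ jE j'E i'E; have /cocycleP[vh v0] := vZ.
rewrite /slice (dg_chainE _ x jE j'E i'E (erefl (n + 1))).
have l := bhom_linear (bhom_tmap (@bhom_id _ _ (C i)) vh).
rewrite (linD l) (linZ l) !tmap_comp_b; try by [exact: bhom_id|exact: diff_hom|exact: vh].
have -> : (fun y => v (@diff _ _ C (n + 1) n y)) = fun _ => 0 by apply/funext.
by rewrite tmap_0r ?scaler0 ?addr0 //; exact: bhom_id.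
Qed.
End Slice.

(** * Comparison homotopies *)

Section Homotopy.
Variables (k : fieldType) (A : falgType k) (form : A -> A -> k).
Variable D : dual_bases form.
Hypothesis ff : frobenius_form form.
Variables (T : complete_resolution A).
Implicit Types (i j l m n : int) (a b : nat).

Local Notation d i j := (@diff _ _ (cres T) i j).

Lemma diff_linear i j : linear (d i j).
Proof. exact: bhom_linear (diff_hom _ _ _). Qed.

Lemma cres_lift j i l m (f : T j -> T i) : is_bhom f -> m = i + 1 -> i = l + 1 ->
  (forall x, d i l (f x) = 0) ->
  exists2 h : T j -> T m, is_bhom h & forall x, d m i (h x) = f x.
Proof.
move=> fh mE iE f0; have [t tH] := cres_lhigman D ff T j.
have [s sh sd] := @cres_section _ _ _ D ff T i l iE.
have [s' sh' sd'] := section_up D ff mE iE sh sd.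
apply: (higman_lift ff tH (diff_hom _ _ _) fh (rhom_comp (bhom_rhom fh) sh')) => x.
by rewrite sd' f0 (lin0 sh.1) subr0.
Qed.

(** Comparison with the identity by successive lifting. The maps are indexed by natural numbers so
    that endomorphisms built on the truncation qualify; in degree 0 the term [h1] is taken to be
    zero. *)
Lemma counit_htpy_up (c : forall b, T (Posz b) -> T (Posz b)) :
  (forall b, is_bhom (c b)) ->
  (forall b x, c b (d (Posz b.+1) b x) = d (Posz b.+1) b (c b.+1 x)) ->
  (forall x, aug T (c 0 x) = aug T x) ->
  forall b l, Posz b = l + 1 -> exists2 h : T b -> T (Posz b.+1), is_bhom h &
    exists2 h1 : T l -> T b, is_bhom h1 &
    forall x, x - c b x = d (Posz b.+1) b (h x) + h1 (d b l x).
Proof.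
move=> ch cd c0; elim=> [|b IH] l lE.
  have fh : is_bhom (fun x => x - c 0 x) := bhom_sub (@bhom_id _ _ _) (ch 0).
  have [|h hh hE] := cres_lift (m := 1) (l := -1) fh erefl erefl.
    move=> x; rewrite (linB (@diff_linear _ _)) !aug_factor c0 subrr //.
  exists h => //; exists (fun _ => 0); first exact: bhom_0.
  by move=> x; rewrite hE addr0.
have lb : l = b by lia.
subst l; have [h hh [h1 h1h hE]] := IH (Posz b - 1) ltac:(lia).
have fh : is_bhom (fun x => (x - c b.+1 x) - h (d (Posz b.+1) b x)).
  exact: bhom_sub (bhom_sub (@bhom_id _ _ _) (ch _)) (bhom_comp (diff_hom _ _ _) hh).
have [|h' hh' hE'] := cres_lift (m := Posz b.+2) (l := b) fh ltac:(lia) ltac:(lia).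
  move=> x; rewrite !(linB (@diff_linear _ _)) -cd hE diffK.
  by rewrite (lin0 (bhom_linear h1h)) addr0 subrr.
by exists h' => //; exists h => // x; rewrite hE' subrK.
Qed.

(** The dual argument, by extension instead of lifting. It starts in degree -1, where 1 - c kills
    the image of d_0 because c commutes with d and preserves ε. *)
Lemma counit_htpy_down (c : forall j, T j -> T j) :
  (forall j, is_bhom (c j)) ->
  (forall i j x, c j (d i j x) = d i j (c i x)) ->
  (forall x, aug T (c 0 x) = aug T x) ->
  forall a j l, j = Negz a -> j = l + 1 -> exists2 h : T j -> T (j + 1), is_bhom h &
    exists2 h1 : T l -> T j, is_bhom h1 &
    forall x, x - c j x = d (j + 1) j (h x) + h1 (d j l x).
Proof.
move=> ch cd c0; elim=> [|a IH] j l jE lE.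
  rewrite {}jE in lE *.
  have fh : is_bhom (fun x => x - c (-1) x) := bhom_sub (@bhom_id _ _ _) (ch (-1)).
  have [t tH] := cres_lhigman D ff T (-1).
  have [|h hh hE] := cres_extend ff (i := 0) tH fh erefl lE.
    move=> x; rewrite cd -(linB (@diff_linear _ _)) aug_factor.
    by rewrite (linB (bhom_linear (aug_hom T))) c0 subrr coaug0.
  exists (fun _ => 0); first exact: bhom_0.
  by exists h => // x; rewrite hE (lin0 (@diff_linear _ _)) add0r.
have [h hh [h1 h1h hE]] := IH (j + 1) j ltac:(lia) erefl.
have fh : is_bhom (fun x => (x - c j x) - d (j + 1) j (h1 x)).
  exact: bhom_sub (bhom_sub (@bhom_id _ _ _) (ch _)) (bhom_comp h1h (diff_hom _ _ _)).
have [t tH] := cres_lhigman D ff T j.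
have [|h' hh' hE'] := cres_extend ff (i := j + 1) tH fh erefl lE.
  move=> x; rewrite cd -(linB (@diff_linear _ _)) hE (linD (@diff_linear _ _)) diffK.
  by rewrite add0r subrr.
by exists h1 => //; exists h' => // x; rewrite hE' [RHS]addrC subrK.
Qed.

Section Coeff.
Variable X : bimod A.
Local Notation Y j := (bitens (T j) X).
Local Notation dY i j := (@tensd _ _ T X i j).

Let dYl i j : linear (dY i j). Proof. exact: bhom_linear (tensd_bhom _ _ _ _). Qed.

Lemma tens_lift_aug j a l (f : T j -> Y a) : is_bhom f -> Posz a = l + 1 ->
  (forall x, dY a l (f x) = 0) ->
  exists2 h : T j -> Y (Posz a.+1), is_bhom h & forall x, dY (Posz a.+1) a (h x) = f x.
Proof. by move=> fh aE; apply: (tens_lift D ff fh) => //; lia. Qed.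

Lemma taug_lift_htpy j j1 (f : T j -> Y 0) (w : T j1 -> X) : is_bhom f -> is_bhom w ->
  (forall x, taug (f x) = w (d j j1 x)) ->
  exists2 h : T j -> Y 1, is_bhom h & exists2 h1 : T j1 -> Y 0, is_bhom h1 &
    forall x, f x = dY 1 0 (h x) + h1 (d j j1 x).
Proof.
move=> fh wh fw; have [h1 h1h h1E] := taug_lift D ff wh.
have fh' : is_bhom (fun x => f x - h1 (d j j1 x)).
  exact: bhom_sub fh (bhom_comp (diff_hom _ _ _) h1h).
have [|h hh hE] := tens_lift_aug (a := 0) (l := -1) fh' erefl.
  move=> x; apply/(taug_eq0 D ff).
  by rewrite (linB (bhom_linear (taug_bhom _ _))) fw h1E subrr.
by exists h => //; exists h1 => // x; rewrite hE subrK.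
Qed.

(** The nonnegative half of T ⊗_A X plays the role of a resolution of X. The augmentation of [g] is
    only asked to be the coboundary of [w], which leaves room for the homotopy between (ε ⊗ 1)Δ and
    the identity. *)
Lemma homotopy_up n n1 (g : forall j a, T j -> Y a) (w : T n1 -> X) : n = n1 + 1 ->
  (forall j a, is_bhom (g j a)) -> is_bhom w ->
  (forall j a j' x, j = Posz a + n -> j' = j + 1 ->
    g j a (d j' j x) = dY (Posz a.+1) a (g j' a.+1 x)) ->
  (forall x, taug (g n 0 x) = w (d n n1 x)) ->
  forall a j j1, j = Posz a + n -> j = j1 + 1 ->
  exists2 h : T j -> Y (Posz a.+1), is_bhom h & exists2 h1 : T j1 -> Y a, is_bhom h1 &
    forall x, g j a x = dY (Posz a.+1) a (h x) + h1 (d j j1 x).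
Proof.
move=> nE gh wh gd gw; elim=> [|a IH] j j1 jE j1E.
  have jn : j = n by lia.
  have j1n : j1 = n1 by lia.
  by clear jE j1E; subst j j1; exact: (taug_lift_htpy (gh n 0) wh gw).
have [h hh [h1 h1h hE]] := IH j1 (j1 - 1) ltac:(lia) ltac:(lia).
have fh : is_bhom (fun x => g j a.+1 x - h (d j j1 x)).
  exact: bhom_sub (gh _ _) (bhom_comp (diff_hom _ _ _) hh).
have [|h' hh' hE'] := tens_lift_aug (l := a) fh ltac:(lia).
  move=> x; rewrite (linB (@dYl _ _)) -(gd j1 a j) ?hE; try lia.
  by rewrite diffK (lin0 (bhom_linear h1h)) addr0 subrr.
by exists h' => //; exists h => // x; rewrite hE' subrK.
Qed.
End Coeff.
End Homotopy.

Section Counit.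
Variables (k : fieldType) (A : falgType k) (form : A -> A -> k).
Variable D : dual_bases form.
Hypothesis ff : frobenius_form form.
Variables (T : complete_resolution A).
Implicit Types (i j l m n : int) (a b : nat).

Local Notation d i j := (@diff _ _ (cres T) i j).

Lemma taug_tmapr (X X' : bimod A) (g : X -> X') (z : bitens (T 0) X) : is_bhom g ->
  taug (tmap id g z : bitens (T 0) X') = g (taug z).
Proof.
move=> gh; have [_ gL _] := gh; have i0 := @bhom_id _ _ (T 0).
have th Z := bhom_linear (taug_bhom T Z).
move: z; apply: (bitens_ext (Z := X') (f := fun z => taug (tmap id g z : bitens (T 0) X'))
  (g := fun z => g (taug z))) => [||t x].
- exact: lin_comp (bhom_linear (bhom_tmap i0 gh)) (th _).
- exact: lin_comp (th _) (bhom_linear gh).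
- by rewrite tmap_pure_b // !taug_pure gL.
Qed.

Lemma taug_tmapl (X : bimod A) (z : bitens (T 1) X) :
  taug (tmap (d 1 0) id z : bitens (T 0) X) = 0.
Proof.
have th := bhom_linear (taug_bhom T X).
move: z; apply: (bitens_ext (Z := X) (f := fun z => taug (@tensd _ _ T X 1 0 z))) => [||t x].
- exact: lin_comp (bhom_linear (tensd_bhom _ _ _ _)) th.
- exact: lin_cst0.
- by rewrite tensd_pure taug_pure aug_diff (lin0 ((lact_bilin X).2 x)).
Qed.

Lemma aug_taug (z : bitens (T 0) (T 0)) :
  aug T (taug z) = tlift (fun x y : T 0 => (aug T x : A) * aug T y : regbimod A) z.
Proof.
have [el eL eR] := aug_hom T.
have bl : bilin (fun x y : T 0 => (aug T x : A) * aug T y : regbimod A).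
  by split=> x c u v; rewrite el /= ?mulrDr ?mulrDl -?scalerAr -?scalerAl.
have bal : balA (fun x y : T 0 => (aug T x : A) * aug T y : regbimod A).
  by move=> c x y; rewrite eL eR /= mulrA.
move: z; apply: (bitens_ext (Z := regbimod A)) => [||x y].
- exact: lin_comp (bhom_linear (taug_bhom T _)) el.
- exact: tliftA_linear bl bal.
- by rewrite taug_pure (tliftA_pure x y bl bal) eL.
Qed.

Section Complete.
Variable Dl : diag_approx T (aug T).

(** The endomorphism (ε ⊗ 1)Δ of T; its deviation from the identity is the source of the coboundary
    terms in what follows. *)
Definition counit j (x : T j) : T j := taug (Dl j 0 j x).

Lemma counit_bhom j : is_bhom (@counit j).
Proof. exact: bhom_comp (dg_hom _ _ _ _) (taug_bhom _ _). Qed.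

Lemma counit_diff i j x : counit (d i j x) = d i j (counit x).
Proof.
have [iE|ne] := eqVneq i (j + 1); last first.
  by rewrite !diff_shape // (lin0 (bhom_linear (@counit_bhom _))).
rewrite /counit (@dg_chainE _ _ _ _ Dl j i 0 1 j i x (esym (add0r j)) iE erefl iE).
rewrite (linD (bhom_linear (taug_bhom _ _))) (linZ (bhom_linear (taug_bhom _ _))).
by rewrite taug_tmapl add0r taug_tmapr ?scale1r //; exact: diff_hom.
Qed.

Lemma aug_counit x : aug T (counit x) = aug T x.
Proof. by rewrite aug_taug dg_aug. Qed.

(** Since [v] kills boundaries, only v h1 d is left of v(d h + h1 d). The bound on [n] reflects that
    the homotopy is built downward from degree -1. *)
Lemma slice_aug (X : bimod A) n n1 (v : T n -> X) : v \in cocycle T X n ->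
  n < 0 -> n = n1 + 1 -> exists2 g : T n1 -> X, is_bhom g &
  forall x, v x - taug (slice Dl v 0 x) = g (d n n1 x).
Proof.
move=> vZ n0 nE; have /cocycleP[vh v0] := vZ.
case: n => [//|a] in v vZ nE vh v0 n0 *.
have [h hh [h1 h1h hE]] :=
  counit_htpy_down D ff counit_bhom counit_diff aug_counit (erefl (Negz a)) nE.
exists (fun x => v (h1 x)) => [|x]; first exact: bhom_comp h1h vh.
rewrite taug_tmapr // -(linB (bhom_linear vh)) -/(counit x) hE (linD (bhom_linear vh)).
by rewrite v0 add0r.
Qed.
End Complete.

Section Truncated.
Variable Dl : diag_approx (trunc T) (aug T).

Lemma slice_aug_trunc (X : bimod A) b l (v : trunc T (Posz b) -> X) :
  v \in cocycle (trunc T) X (Posz b) ->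
  Posz b = l + 1 -> exists2 g : T l -> X, is_bhom g &
  forall x : T (Posz b), v x - taug (slice Dl v 0 (x : trunc T (Posz b)) : bitens (T 0) X) = g (d b l x).
Proof.
move=> vZ bE; have /cocycleP[vh v0] := vZ.
pose c a (x : T (Posz a)) : T (Posz a) := taug (Dl (Posz a) 0 (Posz a) x).
have ch a : is_bhom (@c a).
  exact: bhom_comp (dg_hom Dl (Posz a) 0 (Posz a)) (taug_bhom _ _).
have cd a x : c a (d (Posz a.+1) a x) = d (Posz a.+1) a (c a.+1 x).
  have aE : Posz a.+1 = Posz a + 1 by lia.
  have := @dg_chainE _ _ _ _ Dl (Posz a) (Posz a.+1) 0 1 (Posz a) (Posz a.+1) x
    (esym (add0r (Posz a))) aE erefl aE.
  move=> /(congr1 (@taug _ _ T (T (Posz a)))) E.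
  rewrite /c [LHS]E (linD (bhom_linear (taug_bhom _ _))) (linZ (bhom_linear (taug_bhom _ _))).
  by rewrite taug_tmapl add0r taug_tmapr ?scale1r //; exact: (diff_hom T (Posz a.+1) (Posz a)).
have c0 x : aug T (c 0 x) = aug T x by rewrite aug_taug; exact: (dg_aug Dl).
have [h hh [h1 h1h hE]] := counit_htpy_up D ff ch cd c0 bE.
exists (fun x => v (h1 x)) => [|x]; first exact: bhom_comp h1h vh.
have -> : taug (slice Dl v 0 (x : trunc T (Posz b)) : bitens (T 0) X) = v (c b x).
  exact: (@taug_tmapr (T (Posz b))).
have vd y : v (d (Posz b.+1) b y) = 0.
  exact: (@cocycle0 _ _ (trunc T) X (Posz b) (Posz b.+1) v y vZ).
by rewrite -(linB (bhom_linear vh)) hE (linD (bhom_linear vh)) vd add0r.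
Qed.
End Truncated.
End Counit.

(** * Cocycles versus maps into T ⊗_A X *)

Section Duality.
Variables (k : fieldType) (A : falgType k) (form : A -> A -> k).
Variable D : dual_bases form.
Hypothesis ff : frobenius_form form.
Variables (T : complete_resolution A) (Dl : diag_approx T (aug T)) (X : bimod A).
Implicit Types (i j l m n : int) (a b : nat).

Local Notation d i j := (@diff _ _ (cres T) i j).
Local Notation Y j := (bitens (T j) X).
Local Notation dY i j := (@tensd _ _ T X i j).
Local Notation e := (coaug T 1).

Let dYl i j : linear (dY i j). Proof. exact: bhom_linear (tensd_bhom _ _ _ _). Qed.

Lemma slice_tensd n (v : T n -> X) j j' a x : v \in cocycle T X n ->
  j = Posz a + n -> j' = j + 1 ->
  slice Dl v (Posz a) (d j' j x) = dY (Posz a.+1) a (slice Dl v (Posz a.+1) x).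
Proof. by move=> vZ jE j'E; apply: slice_chain => //; lia. Qed.

(** Downward induction on the degree: d g factors through d as g' d, and a homotopy
    for g' yields one for g. *)
Lemma slice_approximates n a j j' j1 l (g : T j -> Y (Posz a)) : is_bhom g -> n < 0 ->
  j = Posz a + n -> j' = j + 1 -> j = j1 + 1 -> Posz a = l + 1 ->
  (forall x, dY a l (g (d j' j x)) = 0) ->
  exists2 v : T n -> X, v \in cocycle T X n &
  exists2 h : T j -> Y (Posz a.+1), is_bhom h & exists2 h1 : T j1 -> Y a, is_bhom h1 &
    forall x, g x = slice Dl v a x + dY (Posz a.+1) a (h x) + h1 (d j j1 x).
Proof.
move=> gh n0; elim: a j j' j1 l g gh => [|a IH] j j' j1 l g gh jE j'E j1E lE gd.
  have jn : j = n by lia.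
  clear jE; subst n j'; pose v x := taug (g x).
  have vh : is_bhom v := bhom_comp gh (taug_bhom _ _).
  have vZ : v \in cocycle T X j.
    apply/cocycleP; split=> // x; apply/(taug_eq0 D ff).
    have l1 : l = -1 by lia.
    by subst l; exact: gd.
  have [w wh wE] := slice_aug D ff Dl vZ n0 j1E.
  have sh := slice_bhom Dl j 0 vh.
  have [|h hh [h1 h1h hE]] := taug_lift_htpy D ff (bhom_sub gh sh) wh.
    by move=> x; rewrite (linB (bhom_linear (taug_bhom _ _))) wE.
  exists v => //; exists h => //; exists h1 => // x.
  by rewrite -addrA -hE addrC subrK.
have [t tH] := tens_lhigman D ff T X a.
have la : l = Posz a by lia.
subst l; have fh : is_bhom (fun x => dY (Posz a.+1) a (g x)) := bhom_comp gh (tensd_bhom _ _ _ _).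
have [g' g'h g'E] := cres_extend ff tH fh j'E j1E gd.
have [|v vZ [h hh [h1 h1h hE]]] := IH j1 j (j1 - 1) (Posz a - 1) g' g'h
  ltac:(lia) ltac:(lia) ltac:(lia) ltac:(lia).
  by move=> x; rewrite g'E tensdK.
have /cocycleP[vh _] := vZ; have sh := slice_bhom Dl j (Posz a.+1) vh.
have fh' : is_bhom (fun x => (g x - slice Dl v (Posz a.+1) x) - h (d j j1 x)).
  exact: bhom_sub (bhom_sub gh sh) (bhom_comp (diff_hom _ _ _) hh).
have [|h' hh' hE'] := tens_lift_aug D ff (l := Posz a) fh' ltac:(lia).
  move=> x; rewrite !(linB (@dYl _ _)) -g'E hE diffK (lin0 (bhom_linear h1h)) addr0.
  rewrite (slice_tensd (j := j1) (j' := j) x vZ) //; last by lia.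
  by rewrite [X in X - _ - _]addrC addrK subrr.
exists v => //; exists h' => //; exists h => // x.
by rewrite hE' -addrA subrK addrC subrK.
Qed.

(** A null homotopy descends one degree at a time: the slice minus d h1 vanishes on boundaries, so
    it extends along d. At a = 0, applying ε ⊗ 1 leaves [v] up to the coboundary from
    [slice_aug]. *)
Lemma slice_null_coboundary n a j j1 (v : T n -> X) (h : T j -> Y (Posz a.+1))
    (h1 : T j1 -> Y (Posz a)) : v \in cocycle T X n -> n < 0 ->
  j = Posz a + n -> j = j1 + 1 -> is_bhom h -> is_bhom h1 ->
  (forall x, slice Dl v a x = dY (Posz a.+1) a (h x) + h1 (d j j1 x)) ->
  v \in coboundary T X n.
Proof.
move=> vZ n0; have /cocycleP[vh _] := vZ.
elim: a j j1 h h1 => [|a IH] j j1 h h1 jE j1E hh h1h vE.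
  have jn : j = n by lia.
  have j1n : j1 = n - 1 by lia.
  clear jE j1E; subst j j1.
  have [w wh wE] := slice_aug D ff Dl vZ n0 (esym (subrK 1 n)).
  apply/asboolP; exists (fun x => 1 *: w x + taug (h1 x)).
    exact: bhom_lin wh (bhom_comp h1h (taug_bhom _ _)).
  move=> x; rewrite scale1r -wE vE (linD (bhom_linear (taug_bhom _ _))).
  have -> : taug (dY 1 0 (h x)) = 0 by exact: taug_tmapl.
  by rewrite add0r subrK.
have sh := slice_bhom Dl j1 (Posz a) vh.
have fh : is_bhom (fun x => slice Dl v a x - dY (Posz a.+1) a (h1 x)).
  exact: bhom_sub sh (bhom_comp h1h (tensd_bhom _ _ _ _)).
have [t tH] := tens_lhigman D ff T X a.
have [|h2 h2h h2E] := cres_extend ff tH fh j1E (esym (subrK 1 j1)).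
  move=> x; rewrite (slice_tensd (j := j1) (j' := j) x vZ) //; last by lia.
  by rewrite vE (linD (@dYl _ _)) tensdK add0r subrr.
apply: (IH j1 (j1 - 1) h1 h2) => //; try lia.
by move=> x; rewrite h2E [RHS]addrC subrK.
Qed.

Lemma slice_coboundary n a j j1 (v : T n -> X) : v \in cocycle T X n ->
  v \in coboundary T X n -> n < 0 -> j = Posz a + n -> j = j1 + 1 ->
  exists2 h : T j -> Y (Posz a.+1), is_bhom h & exists2 h1 : T j1 -> Y a, is_bhom h1 &
    forall x, slice Dl v a x = dY (Posz a.+1) a (h x) + h1 (d j j1 x).
Proof.
move=> vZ /asboolP[u uh vu] n0; have /cocycleP[vh _] := vZ.
have [w wh wE] := slice_aug D ff Dl vZ n0 (esym (subrK 1 n)).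
have uwh := bhom_sub uh wh.
apply: (@homotopy_up _ _ _ D ff T X n (n - 1) (fun j a => @slice _ _ _ _ Dl X n v j (Posz a)) _
  (esym (subrK 1 n)) _ uwh).
- by move=> i b; exact: slice_bhom.
- by move=> i b i' x iE i'E; exact: slice_tensd.
- by move=> x; rewrite -vu -wE opprB addrC subrK.
Qed.
End Duality.

(** * The norm and Tate duality *)

Section SubquotMaps.
Variables (k : fieldType) (V V' : lmodType k).
Variables (Z B : submodule V) (Z' B' : submodule V') (F : V -> V').
Hypothesis FZ : forall z, z \in Z -> F z \in Z'.
Hypothesis Flin : forall a u v, u \in Z -> v \in Z -> F (a *: u + v) = a *: F u + F v.
Hypothesis FB : forall z, z \in Z -> z \in B -> F z \in B'.

(** Linearity of [F] is asked on [Z] only: cocycles live among all functions C n -> X, and v ↦ (1 ⊗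
    v)Δ is known to be linear only on bimodule maps. *)
Definition subquot_map (q : subquot Z B) : subquot Z' B' := cls Z' B' (F (rep q)).

Let FD u v : u \in Z -> v \in Z -> F (u - v) = F u - F v.
Proof. by move=> uZ vZ; rewrite addrC -scaleN1r Flin // scaleN1r addrC. Qed.

Lemma subquot_map_cls z : z \in Z -> subquot_map (cls Z B z) = cls Z' B' (F z).
Proof.
move=> zZ; have rZ := rep_mem (cls Z B z).
have rB : rep (cls Z B z) - z \in B by apply: (cls_eqP B rZ zZ).1; rewrite repK.
by apply/cls_eqP; rewrite ?FZ // -FD // FB // rpredB.
Qed.

Lemma subquot_map_linear : linear subquot_map.
Proof.
move=> a p q; rewrite -[p]repK -[q]repK -cls_lin ?rep_mem //.
by rewrite !subquot_map_cls ?rpredD ?rpredZ ?rep_mem // Flin ?cls_lin ?FZ ?rep_mem.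
Qed.

Lemma subquot_map_inj : (forall z, z \in Z -> F z \in B' -> z \in B) -> injective subquot_map.
Proof.
move=> FB' p q; rewrite -[p]repK -[q]repK !subquot_map_cls ?rep_mem //.
have pZ := rep_mem p; have qZ := rep_mem q.
move=> /(cls_eqP B' (FZ pZ) (FZ qZ)); rewrite -FD // => h.
by apply/cls_eqP => //; apply: FB' => //; rewrite rpredB.
Qed.

Lemma subquot_map_surj : (forall y, y \in Z' -> exists2 z, z \in Z & y - F z \in B') ->
  forall q, exists p, subquot_map p = q.
Proof.
move=> FS q; have [z zZ zB] := FS _ (rep_mem q); exists (cls Z B z).
rewrite subquot_map_cls // -[q]repK; apply/esym/cls_eqP; rewrite ?FZ ?rep_mem //.
Qed.
End SubquotMaps.

Section Norm.
Variables (k : fieldType) (A : falgType k) (form : A -> A -> k).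
Variable D : dual_bases form.
Hypothesis ff : frobenius_form form.
Variable nu : alg_aut A.
Hypothesis nuP : nakayama form nu.
Local Notation b := (@db _ _ _ D).
Local Notation b' := (@db' _ _ _ D).
Implicit Types (P Q X : bimod A).
Local Notation tw X := (twist idfun (aut_inv nu) X).

Definition norm P X : tensE P (tw X) -> bitens P X :=
  tlift (fun (p : P) (x : tw X) =>
    \sum_i (pureA (lact (b i) p) (ract (x : X) (b' i)) : bitens P X)).

Lemma norm_bilin P X : bilin (fun (p : P) (x : tw X) =>
    \sum_i (pureA (lact (b i) p) (ract (x : X) (b' i)) : bitens P X)).
Proof.
have [pr pl] := pureA_bilin P X.
split=> [p|x] c u v; rewrite scaler_sumr -big_split; apply: eq_bigr => i _ /=.
  by rewrite (ract_bilin X).2 pr.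
by rewrite (lact_bilin P).1 pl.
Qed.

Lemma norm_bal P X : balE (fun (p : P) (x : tw X) =>
    \sum_i (pureA (lact (b i) p) (ract (x : X) (b' i)) : bitens P X)).
Proof.
move=> a c p x /=.
under eq_bigr do rewrite -lractA -lactM pureA_bal -lractA.
rewrite (casimir_twist D ff nuP (f := fun y z =>
  pureA (lact y p) (ract (lact a (x : X)) z) : bitens P X)).
  by apply: eq_bigr => i _; rewrite ractM.
have [pr pl] := pureA_bilin P X.
split=> y; first exact: lin_comp ((ract_bilin X).1 _) (pr _).
exact: lin_comp ((lact_bilin P).2 _) (pl _).
Qed.

Lemma norm_pure P X (p : P) (x : X) :
  norm (pureE p (x : tw X)) = \sum_i (pureA (lact (b i) p) (ract x (b' i)) : bitens P X).
Proof. exact: (@tliftE_pure _ _ P (tw X) _ _ p x (@norm_bilin P X) (@norm_bal P X)). Qed.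

Lemma norm_linear P X : linear (@norm P X).
Proof. exact: (@tliftE_linear _ _ P (tw X) _ _ (@norm_bilin P X) (@norm_bal P X)). Qed.

Lemma norm_central P X c (z : tensE P (tw X)) : lact c (norm z) = ract (norm z) c.
Proof.
have nl := @norm_linear P X; move: z.
apply: (tensE_ext (U := bitens P X) (f := fun z => lact c (norm z))
  (g := fun z => ract (norm z) c)) => [||p x].
- exact: lin_comp nl ((lact_bilin _).1 c).
- exact: lin_comp nl ((ract_bilin _).2 c).
rewrite norm_pure lact_sum ract_sum.
under eq_bigr do rewrite lact_pure -lactM.
under [RHS]eq_bigr do rewrite ract_pure -ractM.
have [pr pl] := pureA_bilin P X.
have fb : bilin (fun y z => pureA (lact y p) (ract (x : X) z) : bitens P X).
  split=> y; first exact: (lin_comp ((ract_bilin X).1 x) (pr (lact y p))).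
  exact: (lin_comp ((lact_bilin P).2 p) (pl (ract (x : X) y))).
exact: (casimir_mul D ff c fb).
Qed.

Lemma norm_tmap P Q X (g : P -> Q) (z : tensE P (tw X)) : is_bhom g ->
  norm (tmap g id z : tensE Q (tw X)) = tmap g id (norm z : bitens P X).
Proof.
move=> gh; have gh2 := bhom_tmap gh (@bhom_id _ _ X).
have l1 := tmapE_linear gh (@bhom_id _ _ (tw X)); move: z.
apply: (tensE_ext (U := bitens Q X) (f := fun z => norm (tmap g id z : tensE Q (tw X)))
  (g := fun z => tmap g id (norm z : bitens P X))) => [||p x].
- exact: lin_comp l1 (@norm_linear _ _).
- exact: lin_comp (@norm_linear _ _) (bhom_linear gh2).
rewrite (tmapE_pure gh (@bhom_id _ _ (tw X))) !norm_pure (lin_sum (bhom_linear gh2)).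
apply: eq_bigr => i _; rewrite (tmap_pure_b _ _ gh (@bhom_id _ _ X)).
by have [_ gL _] := gh; rewrite gL.
Qed.

(** The inverse sends p ⊗ x to Σ t(p b_j) ⊗ b'_j x, with Higman's [t] for P. One composite is the
    identity by Higman's formula, after [casimir_nakayama] has exchanged the two Casimir factors.
    The other is y ↦ Σ b_i T(y) b'_i, where T is [avg_r D t] tensored with 1; on an invariant y it
    is the left average of T, hence y. *)
Lemma norm_inverse P X : projective P ->
  exists2 f : bitens P X -> tensE P (tw X), linear f &
    (forall z, f (norm z) = z) /\
    (forall y, (forall c, lact c y = ract y c) -> norm (f y) = y).
Proof.
move=> /(higman D ff)[t tl tP].
pose f0 (p : P) (x : X) : tensE P (tw X) :=
  \sum_j pureE (t (ract p (b j))) (lact (b' j) x : tw X).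
have [pr pl] := pureE_bilin P (tw X).
have f0b : bilin f0.
  split=> [p|x] c u v; rewrite /f0 scaler_sumr -big_split; apply: eq_bigr => i _ /=.
    by rewrite (lact_bilin X).1 (pr _ c).
  by rewrite (ract_bilin P).2 tl pl.
have f0bal : balA f0.
  move=> a p x; rewrite /f0.
  under eq_bigr do rewrite -ractM.
  rewrite (casimir_mul D ff (f := fun y z => pureE (t (ract p y)) (lact z x : tw X))).
    by apply: eq_bigr => i _; rewrite lactM.
  split=> y; first exact: lin_comp ((lact_bilin X).2 _) (pr _).
  exact: lin_comp (lin_comp ((ract_bilin P).1 _) tl) (pl _).
have fl : linear (tlift f0 : bitens P X -> tensE P (tw X)) := tliftA_linear f0b f0bal.
have fp p x : tlift f0 (pureA p x) = f0 p x := tliftA_pure p x f0b f0bal.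
exists (tlift f0) => //; split.
  apply: (tensE_ext (f := fun z => tlift f0 (norm z))) => [||p x].
  - exact: lin_comp (@norm_linear _ _) fl.
  - by [].
  have pE : p = \sum_i \sum_j
      lact (nu (b' i)) (ract (t (ract (lact (b i) p) (b j))) (b' j)).
    rewrite [LHS]tP; apply/esym.
    apply: (casimir_nakayama D nuP (f := fun y z =>
      \sum_j lact y (ract (t (ract (lact z p) (b j))) (b' j)))).
    split=> y c u v; rewrite scaler_sumr -big_split; apply: eq_bigr => j _ /=.
      by rewrite (lact_bilin P).2 (ract_bilin P).2 tl (ract_bilin P).2 (lact_bilin P).1.
    exact: (lact_bilin P).2.
  rewrite norm_pure (lin_sum fl) [p in RHS]pE (lin_sum (pl x)); apply: eq_bigr => i _.
  rewrite fp (lin_sum (pl x)); apply: eq_bigr => j _.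
  rewrite -(lractA (nu (b' i))) pureE_bal; congr (pureE _ _).
  by rewrite /= aut_funK lractA.
have tLH : lhigman D (avg_r D t).
  by split; [exact: avg_r_rhom|move=> p; rewrite [RHS]tP; apply: eq_bigr => i _; rewrite lact_sum].
have [Th TK] := lhigman_bitens ff X tLH.
move=> y yc; rewrite -[RHS]TK.
transitivity (\sum_i ract (lact (b i) (tmap (avg_r D t) id y : bitens P X)) (b' i)).
  move: y {yc}; apply: (bitens_ext (Z := bitens P X) (f := fun y => norm (tlift f0 y))) => [||p x].
  - exact: lin_comp fl (@norm_linear _ _).
  - move=> c u v; rewrite Th.1 scaler_sumr -big_split; apply: eq_bigr => i _ /=.
    by rewrite tlact_linear; exact: (@tract_linear _ _ P X (b' i)).
  rewrite fp /f0 (lin_sum (@norm_linear _ _)).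
  under eq_bigr do rewrite norm_pure.
  rewrite exchange_big; apply: eq_bigr => i _.
  rewrite tmap_pure_r; last by case: tLH.
  rewrite lact_pure ract_pure lact_sum (lin_sum ((pureA_bilin _ _).2 _)).
  by apply: eq_bigr => j _; rewrite lractA -pureA_bal lractA.
by apply: eq_bigr => i _; rewrite lractA -Th.2 -yc.
Qed.
End Norm.

Lemma inj_surj_bijective (U V : Type) (f : U -> V) :
  injective f -> (forall y, exists x, f x = y) -> bijective f.
Proof.
by move=> fi /choice[g gK]; exists g => // x; apply: fi; rewrite gK.
Qed.

Section TateDuality.
Variables (k : fieldType) (A : falgType k) (form : A -> A -> k).
Variable D : dual_bases form.
Hypothesis ff : frobenius_form form.
Variable nu : alg_aut A.
Hypothesis nuP : nakayama form nu.
Variables (T : complete_resolution A) (Dl : diag_approx T (aug T)).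
Implicit Types (X : bimod A) (m n : int) (a : nat).
Local Notation tw X := (twist idfun (aut_inv nu) X).
Local Notation d i j := (@diff _ _ (cres T) i j).
Local Notation e := (coaug T 1).

Lemma norm_tdiff X i j (z : tensE (T i) (tw X)) :
  norm D (@tdiff _ _ T (tw X) i j z) = @tensd _ _ T X i j (norm D z).
Proof. exact: (norm_tmap D ff nuP z (diff_hom T i j)). Qed.

Lemma norm_injective X i : injective (@norm _ _ _ D nu (T i) X).
Proof.
have [f _ [fK _]] := norm_inverse D ff nuP X (@cres_proj _ _ T i).
exact: can_inj fK.
Qed.

Lemma norm_image X i (y : bitens (T i) X) : (forall c, lact c y = ract y c) ->
  exists z : tensE (T i) (tw X), norm D z = y.
Proof.
have [f _ [_ fK]] := norm_inverse D ff nuP X (@cres_proj _ _ T i).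
by move=> /fK; exists (f y).
Qed.

Lemma bhom_central (Q : bimod A) (f : T (- 1) -> Q) c : is_bhom f ->
  lact c (f e) = ract (f e) c.
Proof. by move=> [_ fL fR]; rewrite -fL -fR coaug1_central. Qed.

Lemma diff_coaug1 j : d (- 1) j e = 0.
Proof. by have [x <-] := aug_surj T 1; rewrite -aug_factor diffK. Qed.

(** An invariant [y] is itself a norm, say of [w]; injectivity of the norm then turns the hypothesis
    into z = d w. *)
Lemma norm_boundary X a (z : tensE (T a) (tw X)) (y : bitens (T (Posz a.+1)) X) :
  (forall c, lact c y = ract y c) -> norm D z = @tensd _ _ T X (Posz a.+1) a y ->
  z \in boundary T (tw X) a.
Proof.
move=> /norm_image[w wE] zE; apply/asboolP.
have aE : Posz a + 1 = Posz a.+1 by lia.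
rewrite aE; exists w; apply: norm_injective.
by rewrite norm_tdiff wE.
Qed.

(** The last clause determines [G] on representatives without naming the inverse of the norm; it is
    the form in which cap and cup products are compared. *)
Theorem tate_duality X a n : Posz a + n = - 1 ->
  exists G : cohom T X n -> homol T (tw X) a, [/\ linear G, bijective G &
    forall v z, v \in cocycle T X n -> norm D z = slice Dl v a e ->
      z \in Defs.cycle T (tw X) a /\ G (ccls v) = hcls z].
Proof.
move=> anE; have n0 : n < 0 by lia.
have [f fl [fK fK']] := norm_inverse D ff nuP X (@cres_proj _ _ T a).
pose F (v : T n -> X) := f (slice Dl v a e).
have nF v : v \in cocycle T X n -> norm D (F v) = slice Dl v a e.
  move=> /cocycleP[vh _]; apply: fK' => c; apply: bhom_central.
  exact: (slice_bhom Dl _ _ vh).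
have FZ v : v \in cocycle T X n -> F v \in Defs.cycle T (tw X) a.
  move=> vZ; apply/eqP/norm_injective; rewrite norm_tdiff nF //.
  rewrite (lin0 (@norm_linear _ _ _ D ff nu nuP _ _)).
  have /cocycleP[vh _] := vZ.
  (* The slice commutes with d in all degrees. For a = 0 the differential lands in degree -1, so the
     result is a cycle of T and not merely of its truncation. *)
  have <- : slice Dl v (Posz a - 1) (d (- 1) (- 2) e) =
      @tensd _ _ T X a (Posz a - 1) (slice Dl v a e).
    by apply: slice_chain => //; lia.
  by rewrite diff_coaug1 (lin0 (bhom_linear (slice_bhom Dl _ _ vh))).
have Flin c u v : u \in cocycle T X n -> v \in cocycle T X n ->
    F (c *: u + v) = c *: F u + F v.
  move=> /cocycleP[uh _] /cocycleP[vh _]; rewrite /F -fl; congr f.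
  exact: tmap_addr (@bhom_id _ _ _) uh vh.
have FB v : v \in cocycle T X n -> v \in coboundary T X n -> F v \in boundary T (tw X) a.
  move=> vZ vB.
  have [h hh [h1 h1h hE]] := slice_coboundary D ff Dl vZ vB n0 (esym anE) (j1 := - 2) erefl.
  apply: (norm_boundary (y := h e)); first by move=> c; exact: bhom_central.
  by rewrite nF // hE diff_coaug1 (lin0 (bhom_linear h1h)) addr0.
have aE : Posz a.+1 = Posz a + 1 by lia.
have FB' v : v \in cocycle T X n -> F v \in boundary T (tw X) a -> v \in coboundary T X n.
  move=> vZ /asboolP; rewrite -aE => -[w wE]; have /cocycleP[vh _] := vZ.
  have sE : slice Dl v a e = @tensd _ _ T X (Posz a.+1) a (norm D w).
    by rewrite -norm_tdiff -wE nF.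
  have [t tH] := tens_lhigman D ff T X (Posz a.+1).
  (* With g(e) the norm of [w], the difference slice - d g kills e, hence the image of d_0, and
     therefore factors through T_(-2): this is a null homotopy in degree -1. *)
  have [g gh gE] := extend_coaug ff T tH (fun c => norm_central D ff nuP c w).
  have sh := slice_bhom Dl (-1) a vh.
  have fh : is_bhom (fun x => slice Dl v a x - @tensd _ _ T X (Posz a.+1) a (g x)).
    exact: bhom_sub sh (bhom_comp gh (tensd_bhom _ _ _ _)).
  have [t' tH'] := tens_lhigman D ff T X a.
  have [|h1 h1h h1E] := cres_extend ff (i := 0) (l := -2) tH' fh erefl erefl.
    move=> x; rewrite aug_factor coaugE.
    by have [_ -> _] := fh; rewrite gE sE subrr (lin0 ((lact_bilin _).1 _)).
  apply: (slice_null_coboundary D ff vZ n0 (esym anE) (j1 := -2) erefl gh h1h) => x.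
  by rewrite h1E [RHS]addrC subrK.
have FS z : z \in Defs.cycle T (tw X) a -> exists2 v, v \in cocycle T X n & z - F v \in boundary T (tw X) a.
  move=> /eqP z0; have [t tH] := tens_lhigman D ff T X a.
  (* The cycle [z] is realised by a map with value [norm D z] at e; since d_0 x = ε(x) e, its
     composite with both differentials vanishes, as approximation by a slice requires. *)
  have [g gh gE] := extend_coaug ff T tH (fun c => norm_central D ff nuP c z).
  have [|||x|v vZ [h hh [h1 h1h hE]]] := slice_approximates D ff Dl gh n0 (esym anE)
    (j' := 0) (j1 := -2) (l := Posz a - 1).
  - by [].
  - by [].
  - by rewrite subrK.
  - have [_ gL _] := gh; have [_ tL _] := tensd_bhom T X a (Posz a - 1).
    rewrite aug_factor coaugE gL gE tL -norm_tdiff z0.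
    by rewrite (lin0 (@norm_linear _ _ _ D ff nu nuP _ _)) (lin0 ((lact_bilin _).1 _)).
  exists v => //; apply: (norm_boundary (y := h e)); first by move=> c; exact: bhom_central.
  rewrite (linB (@norm_linear _ _ _ D ff nu nuP _ _)) nF // -gE hE diff_coaug1.
  by rewrite (lin0 (bhom_linear h1h)) addr0 addrC addKr.
exists (subquot_map (Z := cocycle T X n) (B := coboundary T X n) (Defs.cycle T (tw X) a) (boundary T (tw X) a) F).
split.
- exact: (subquot_map_linear FZ Flin FB).
- apply: inj_surj_bijective; first exact: (subquot_map_inj FZ Flin FB FB').
  exact: (subquot_map_surj FZ Flin FB FS).
- move=> v z vZ zE; have <- : F v = z by apply: norm_injective; rewrite nF.
  by split; [exact: FZ|exact: (subquot_map_cls FZ Flin FB)].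
Qed.
End TateDuality.

(** * Compatibility of the products *)

Section Associativity.
Variables (k : fieldType) (A : algType k) (M N : bimod A).
Implicit Types (P Q : bimod A).

Definition assoc_at P (n : N) : bitens P M -> bitens P (bitens M N) :=
  tlift (fun p m => pureA p (pureA m n : bitens M N)).

Let at_bilin P n : bilin (fun (p : P) (m : M) => pureA p (pureA m n : bitens M N)).
Proof.
have [pr pl] := pureA_bilin P (bitens M N); have [_ ql] := pureA_bilin M N.
split=> [p|m]; first exact: (lin_comp (ql n) (pr p)).
exact: pl.
Qed.

Let at_bal P n : balA (fun (p : P) (m : M) => pureA p (pureA m n : bitens M N)).
Proof. by move=> c p m; rewrite pureA_bal lact_pure. Qed.

Lemma assoc_at_pure P n (p : P) m : assoc_at n (pureA p m) = pureA p (pureA m n : bitens M N).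
Proof. exact: (tliftA_pure p m (@at_bilin P n) (@at_bal P n)). Qed.

Lemma assoc_at_linear P n : linear (@assoc_at P n).
Proof. exact: (tliftA_linear (@at_bilin P n) (@at_bal P n)). Qed.

Let assoc_bilin P : bilin (fun (t : bitens P M) n => assoc_at n t).
Proof.
split=> [t|n]; last exact: assoc_at_linear.
move=> c u v; move: t; apply: (bitens_ext (Z := bitens P (bitens M N))) => [||p m].
- exact: assoc_at_linear.
- by apply: lin_add; exact: assoc_at_linear.
- by rewrite !assoc_at_pure (pureA_bilin M N).1 (pureA_bilin P (bitens M N)).1.
Qed.

Let assoc_bal P : balA (fun (t : bitens P M) n => assoc_at n t).
Proof.
move=> c t n; move: t; apply: (bitens_ext (Z := bitens P (bitens M N))
  (f := fun t => assoc_at n (ract t c))) => [||p m].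
- exact: lin_comp ((ract_bilin (bitens P M)).2 c) (@assoc_at_linear P n).
- exact: assoc_at_linear.
- by rewrite ract_pure !assoc_at_pure pureA_bal.
Qed.

Definition assoc P : bitens (bitens P M) N -> bitens P (bitens M N) :=
  tlift (fun (t : bitens P M) n => assoc_at n t).

Lemma assoc_pure P (t : bitens P M) n : assoc (pureA t n) = assoc_at n t.
Proof. exact: (tliftA_pure t n (@assoc_bilin P) (@assoc_bal P)). Qed.

Lemma assoc_bhom P : is_bhom (@assoc P).
Proof.
have al : linear (@assoc P) := tliftA_linear (@assoc_bilin P) (@assoc_bal P).
split=> // [c|t c].
  apply: (bitens_ext (Z := bitens P (bitens M N)) (f := fun t => assoc (lact c t))
    (g := fun t => lact c (assoc t))) => [||t n].
  - exact: lin_comp ((lact_bilin (bitens (bitens P M) N)).1 c) al.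
  - exact: lin_comp al ((lact_bilin (bitens P (bitens M N))).1 c).
  rewrite lact_pure !assoc_pure.
  move: t; apply: (bitens_ext (Z := bitens P (bitens M N)) (f := fun t => assoc_at n (lact c t))
    (g := fun t => lact c (assoc_at n t))) => [||p m].
  - exact: lin_comp ((lact_bilin (bitens P M)).1 c) (@assoc_at_linear P n).
  - exact: lin_comp (@assoc_at_linear P n) ((lact_bilin (bitens P (bitens M N))).1 c).
  - by rewrite lact_pure !assoc_at_pure lact_pure.
move: t; apply: (bitens_ext (Z := bitens P (bitens M N)) (f := fun t => assoc (ract t c))
  (g := fun t => ract (assoc t) c)) => [||t n].
- exact: lin_comp ((ract_bilin (bitens (bitens P M) N)).2 c) al.
- exact: lin_comp al ((ract_bilin (bitens P (bitens M N))).2 c).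
rewrite ract_pure !assoc_pure.
move: t; apply: (bitens_ext (Z := bitens P (bitens M N))
  (g := fun t => ract (assoc_at n t) c)) => [||p m].
- exact: assoc_at_linear.
- exact: lin_comp (@assoc_at_linear P n) ((ract_bilin (bitens P (bitens M N))).2 c).
- by rewrite !assoc_at_pure ract_pure ract_pure.
Qed.

Lemma assoc_natural P Q (g : P -> Q) z : is_bhom g ->
  assoc (tmap (tmap g id : bitens P M -> bitens Q M) id z : bitens (bitens Q M) N) =
  tmap g id (assoc z).
Proof.
move=> gh; have iM := @bhom_id _ _ M; have iN := @bhom_id _ _ N.
have iMN := @bhom_id _ _ (bitens M N); have gM := bhom_tmap gh iM.
move: z; apply: (bitens_ext (Z := bitens Q (bitens M N))
  (f := fun z => assoc (tmap (tmap g id : bitens P M -> bitens Q M) id z : bitens (bitens Q M) N))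
  (g := fun z => tmap g id (assoc z))) => [||t n].
- exact: lin_comp (bhom_linear (bhom_tmap gM iN)) (bhom_linear (assoc_bhom Q)).
- exact: lin_comp (bhom_linear (assoc_bhom P)) (bhom_linear (bhom_tmap gh iMN)).
rewrite tmap_pure_b // !assoc_pure; move: t.
apply: (bitens_ext (Z := bitens Q (bitens M N))
  (f := fun t => assoc_at n (tmap g id t : bitens Q M))
  (g := fun t => tmap g id (assoc_at n t))) => [||p m].
- exact: lin_comp (bhom_linear gM) (@assoc_at_linear Q n).
- exact: lin_comp (@assoc_at_linear P n) (bhom_linear (bhom_tmap gh iMN)).
- by rewrite tmap_pure_b // !assoc_at_pure tmap_pure_b.
Qed.
End Associativity.

Section CapProduct.
Variables (k : fieldType) (A : falgType k) (form : A -> A -> k).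
Variable D : dual_bases form.
Hypothesis ff : frobenius_form form.
Variable nu : alg_aut A.
Hypothesis nuP : nakayama form nu.
Variables (T : complete_resolution A).
Variables (M N : bimod A).
Local Notation tw X := (twist idfun (aut_inv nu) X).

Lemma taug_assoc (t : bitens (bitens (T 0) M) N) :
  taug (assoc t) = tmap (@taug _ _ T M) id t.
Proof.
have th := taug_bhom T; have iN := @bhom_id _ _ N.
move: t; apply: (bitens_ext (Z := bitens M N) (f := fun t => taug (assoc t))) => [||t n].
- exact: lin_comp (bhom_linear (assoc_bhom M N (T 0))) (bhom_linear (th _)).
- exact: bhom_linear (bhom_tmap (th M) iN).
rewrite tmap_pure_b // assoc_pure; move: t.
apply: (bitens_ext (Z := bitens M N) (f := fun t => taug (assoc_at n t))
  (g := fun t => pureA (taug t) n)) => [||p m].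
- exact: lin_comp (@assoc_at_linear _ _ M N (T 0) n) (bhom_linear (th _)).
- exact: lin_comp (bhom_linear (th M)) ((pureA_bilin M N).2 n).
- by rewrite assoc_at_pure !taug_pure lact_pure.
Qed.

Variable Dt : diag_approx (trunc T) (aug T).

Lemma capc_pure p q m (u : trunc T p -> M) (y : trunc T q) (x : tw N) : is_bhom u ->
  capc Dt m u (pureE y x) = (-1) ^ (p * m) *: capin u x (Dt q m p y).
Proof.
move=> uh.
have fb : bilin (fun (y : trunc T q) (x : tw N) => (-1) ^ (p * m) *: capin u x (Dt q m p y)).
  split=> [z|z]; apply: lin_scale; first exact: capin_linearr.
  exact: lin_comp (bhom_linear (dg_hom Dt q m p)) (capin_linear uh z).
have fe : balE (fun (y : trunc T q) (x : tw N) => (-1) ^ (p * m) *: capin u x (Dt q m p y)).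
  move=> a c z t; have [_ dL dR] := dg_hom Dt q m p.
  by rewrite dR dL capin_bal.
exact: (tliftE_pure y x fb fe).
Qed.

(** Under the norm, capping with u is the map (1 ⊗ u)Δ ⊗ 1 up to sign. *)
Lemma norm_cap a b c (u : trunc T (Posz b) -> M) (z : tensE (trunc T (Posz c)) (tw N)) :
  is_bhom u ->
  norm D (tmap id (twist_tens (aut_inv nu) M N) (capc Dt (Posz a) u z)
     : tensE (T (Posz a)) (tw (bitens M N))) =
  (-1) ^ (Posz b * Posz a) *:
    assoc (tmap (@slice _ _ _ _ Dt M (Posz b) u (Posz c) (Posz a)) id
      (norm D z : bitens (trunc T (Posz c)) N)).
Proof.
move=> uh; pose tt := twist_tens (aut_inv nu) M N.
have tth : is_bhom tt := bhom_prop tt.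
have ttl := tmapE_linear (@bhom_id _ _ (T (Posz a))) tth.
have sh := slice_bhom Dt (Posz c) (Posz a) uh.
have shN := bhom_tmap sh (@bhom_id _ _ N).
have al := bhom_linear (assoc_bhom M N (T (Posz a))).
have nl X i : linear (@norm _ _ _ D nu (T i) X) :=
  @norm_linear _ _ _ D ff nu nuP (T i) X.
have ttp (m : M) (n : N) : tt (pureA m (n : tw N)) = pureA m n :> bitens M N.
  have pb : bilin (fun (m : M) (n : tw N) => pureA m (n : N) : tensA M N).
    exact: pureA_bilin.
  have pc : balA (fun (m : M) (n : tw N) => pureA m (n : N) : tensA M N).
    by move=> x m' n'; exact: pureA_bal.
  exact: (tliftA_pure m (n : tw N) pb pc).
pose L (z : tensE (trunc T (Posz c)) (tw N)) : bitens (T (Posz a)) (bitens M N) :=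
  norm D (tmap id tt (capc Dt (Posz a) u z) : tensE (T (Posz a)) (tw (bitens M N))).
pose R (z : tensE (trunc T (Posz c)) (tw N)) : bitens (T (Posz a)) (bitens M N) :=
  (-1) ^ (Posz b * Posz a) *:
    assoc (tmap (@slice _ _ _ _ Dt M (Posz b) u (Posz c) (Posz a)) id
      (norm D z : bitens (trunc T (Posz c)) N)).
have Ll : linear L.
  exact: (lin_comp (lin_comp (@capc_linear _ _ _ _ Dt M (tw N) (Posz b) (Posz c) (Posz a) u uh) ttl) (nl (bitens M N) (Posz a))).
have Rl : linear R.
  apply: lin_scale; exact: lin_comp (lin_comp (nl N (Posz c)) (bhom_linear shN)) al.
move: z; apply: (tensE_ext Ll Rl) => y x; rewrite /L /R capc_pure // (linZ ttl) (linZ (nl _ _)).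
congr (_ *: _).
have uhT : is_bhom (u : T (Posz b) -> M) := uh.
pose U : bitens (T (Posz a)) (T (Posz b)) -> bitens (T (Posz a)) M := tmap id u.
have Uh : is_bhom U := bhom_tmap (@bhom_id _ _ _) uhT.
(* The component of the approximation may be replaced by an arbitrary tensor [t], which reduces the
   identity to pure tensors. *)
have core (t : bitens (T (Posz a)) (T (Posz b))) :
    norm D (tmap id tt (capin (u : T (Posz b) -> M) (x : tw N) t)
      : tensE (T (Posz a)) (tw (bitens M N))) =
    \sum_i assoc_at (ract (x : N) (db' i)) (lact (@db _ _ _ D i) (U t)).
  move: t; apply: (bitens_ext (Z := bitens (T (Posz a)) (bitens M N))
    (f := fun t => norm D (tmap id tt (capin (u : T (Posz b) -> M) (x : tw N) t)
      : tensE (T (Posz a)) (tw (bitens M N))))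
    (g := fun t => \sum_i assoc_at (ract (x : N) (db' i)) (lact (@db _ _ _ D i) (U t))))
    => [||p q].
  - have cl := @capin_linear _ _ M (tw N) (T (Posz a)) (T (Posz b)) u uhT x.
    exact: (lin_comp (lin_comp cl ttl) (nl (bitens M N) (Posz a))).
  - move=> s v w; rewrite scaler_sumr -big_split; apply: eq_bigr => i _.
    rewrite (bhom_linear Uh) (lact_bilin (bitens (T (Posz a)) M)).1.
    exact: assoc_at_linear.
  rewrite capin_pure // (tmapE_pure (@bhom_id _ _ (T (Posz a))) tth) ttp norm_pure //.
  apply: eq_bigr => i _; rewrite /U (tmap_pure_b _ _ (@bhom_id _ _ _) uhT).
  by rewrite lact_pure assoc_at_pure ract_pure.
rewrite [LHS]core norm_pure // (lin_sum (bhom_linear shN)) (lin_sum al); apply: eq_bigr => i _.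
rewrite (tmap_pure_b _ _ sh (@bhom_id _ _ N)) assoc_pure; congr (assoc_at _ _).
by have [_ -> _] := sh.
Qed.
End CapProduct.

Lemma trunc_cocycle (k : fieldType) (A : algType k) (T : bicomplex A) (M : bimod A)
    (b : nat) (u : T (Posz b) -> M) :
  (u : trunc T (Posz b) -> M) \in cocycle (trunc T) M (Posz b) <->
  u \in cocycle T M (Posz b).
Proof.
have bE : Posz b + 1 = Posz b.+1 by lia.
split=> uZ; have /cocycleP[uh _] := uZ; apply/cocycleP; split=> //; rewrite bE => x.
  exact: (@cocycle0 _ _ (trunc T) M (Posz b) (Posz b.+1) u x uZ).
exact: (@cocycle0 _ _ T M (Posz b) (Posz b.+1) u x uZ).
Qed.

Section Compatibility.
Variables (k : fieldType) (A : falgType k) (form : A -> A -> k).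
Variable D : dual_bases form.
Hypothesis ff : frobenius_form form.
Variable nu : alg_aut A.
Hypothesis nuP : nakayama form nu.
Variables (T : complete_resolution A).
Variables (Dl : diag_approx T (aug T)) (Dt : diag_approx (trunc T) (aug T)).
Variables (M N : bimod A).
Local Notation tw X := (twist idfun (aut_inv nu) X).
Local Notation d i j := (@diff _ _ (cres T) i j).
Local Notation e := (coaug T 1).

Variables (a b : nat) (n n' : int).
Hypothesis nE : Posz (a + b) + n = - 1.
Hypothesis n'E : n' = Posz b + n.
Variables (u : T (Posz b) -> M) (v : T n -> N).
Hypothesis uZ : (u : trunc T (Posz b) -> M) \in cocycle (trunc T) M (Posz b).
Hypothesis vZ : v \in cocycle T N n.

Let uh : is_bhom u. Proof. by have /cocycleP[] := uZ. Qed.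
Let vh : is_bhom v. Proof. by have /cocycleP[] := vZ. Qed.

Local Notation sgn := ((-1) ^ (Posz b * Posz a) : k).
Local Notation w := (@cupc _ _ _ _ Dl M N (Posz b) n n' u v).

Let su c i : T (Posz c) -> bitens (T (Posz i)) M :=
  @slice _ _ _ _ Dt M (Posz b) u (Posz c) (Posz i).
Let suh c i : is_bhom (@su c i).
Proof. exact: (@slice_bhom _ _ (trunc T) _ Dt M (Posz b) u (Posz c) (Posz i) uh). Qed.

(** First (1 ⊗ v)Δ on T, then (1 ⊗ u)Δ on the truncation. The target degree is a natural number
    because [Dt] lives in nonnegative degrees only. *)
Let cap_slice j i (x : T j) : bitens (T (Posz i)) (bitens M N) :=
  assoc (tmap (@su (i + b) i) id (slice Dl v (Posz (i + b)) x)).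

Let cap_slice_bhom j i : is_bhom (@cap_slice j i).
Proof.
have h1 := slice_bhom Dl j (Posz (i + b)) vh.
have h2 := bhom_tmap (@suh (i + b) i) (@bhom_id _ _ N).
exact: bhom_comp (bhom_comp h1 h2) (assoc_bhom M N (T (Posz i))).
Qed.

Let cap_slice_chain j i j' (x : T j') : j = Posz i + n' -> j' = j + 1 ->
  cap_slice i (d j' j x) = @tensd _ _ T (bitens M N) (Posz i.+1) i (cap_slice i.+1 x).
Proof.
move=> jE j'E; have dh := diff_hom T (Posz i.+1) (Posz i).
have iM := @bhom_id _ _ M; have iN := @bhom_id _ _ N.
have dh' := diff_hom T (Posz (i.+1 + b)) (Posz (i + b)).
rewrite /cap_slice (slice_chain Dl (j := j) (i' := Posz (i.+1 + b)) x vZ) //; try lia.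
rewrite (tmap_comp_b _ dh' iN (@suh (i + b) i) iN); apply: etrans (assoc_natural _ dh).
rewrite (tmap_comp_b _ (@suh (i.+1 + b) i.+1) iN (bhom_tmap dh iM) iN).
congr (assoc (tmap _ _ _)); apply/funext => y.
have e1 : Posz (i + b) = Posz i + Posz b by lia.
have e2 : Posz (i.+1 + b) = Posz (i + b) + 1 by lia.
have e3 : Posz i.+1 = Posz i + 1 by lia.
exact: (@slice_chain _ _ (trunc T) _ Dt M (Posz b) u (Posz (i + b)) (Posz i)
  (Posz (i.+1 + b)) (Posz i.+1) y uZ e1 e2 e3).
Qed.

Lemma cap_cup_boundary (z : tensE (T (Posz (a + b))) (tw N))
    (y : tensE (T (Posz a)) (tw (bitens M N))) :
  norm D z = slice Dl v (Posz (a + b)) e -> norm D y = slice Dl w (Posz a) e ->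
  y - (tmap id (twist_tens (aut_inv nu) M N) (@capc _ _ _ _ Dt M (tw N) (Posz b) (Posz (a + b)) (Posz a) u z)
       : tensE (T (Posz a)) (tw (bitens M N))) \in boundary T (tw (bitens M N)) (Posz a).
Proof.
move=> zE yE; have n'0 : n' < 0 by lia.
have wZ := @cupc_cocycle _ _ _ _ Dl M N (Posz b) n n' u v ((trunc_cocycle u).1 uZ) vZ.
have /cocycleP[wh _] := wZ.
pose g j i (x : T j) := slice Dl w (Posz i) x - sgn *: cap_slice i x.
have gh j i : is_bhom (@g j i).
  exact: bhom_sub (slice_bhom Dl j (Posz i) wh) (bhom_scale _ (@cap_slice_bhom j i)).
have gd j i j' (x : T j') : j = Posz i + n' -> j' = j + 1 ->
    g j i (d j' j x) = @tensd _ _ T (bitens M N) (Posz i.+1) i (g j' i.+1 x).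
  move=> jE j'E; have tl := bhom_linear (@tensd_bhom _ _ T (bitens M N) (Posz i.+1) i).
  by rewrite (linB tl) (linZ tl) /g -(cap_slice_chain x jE j'E) (slice_tensd Dl x wZ jE j'E).
have [gw gwh gwE] : exists2 gw : T (n' - 1) -> bitens M N, is_bhom gw &
    forall x, taug (g n' 0 x) = gw (d n' (n' - 1) x).
  (* Three corrections enter: [w1] for the approximation on the truncation at [u], [w2] for the one
     on T at the cup cocycle, and [w3] because the cup product of the coboundary of [w1] with [v] is
     a coboundary. *)
  have b1 : Posz b = Posz b - 1 + 1 by rewrite subrK.
  have [w1 w1h w1E] := slice_aug_trunc D ff Dt uZ b1.
  have [w2 w2h w2E] := slice_aug D ff Dl wZ n'0 (esym (subrK 1 n')).
  pose u' (y : T (Posz b)) : M := taug (su 0 y).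
  have u'h : is_bhom u' := bhom_comp (@suh b 0) (taug_bhom _ _).
  have diffB : (fun y => w1 (d b (Posz b - 1) y)) \in coboundary T M (Posz b).
    by apply/asboolP; exists w1.
  have dh : is_bhom (fun y => w1 (d b (Posz b - 1) y)) := bhom_comp (diff_hom _ _ _) w1h.
  have diffZ : (fun y => w1 (d b (Posz b - 1) y)) \in cocycle T M (Posz b).
    by apply/cocycleP; split=> // x; rewrite diffK (lin0 (bhom_linear w1h)).
  have /asboolP[w3 w3h w3E] := @cupc_coboundaryl _ _ _ _ Dl M N (Posz b) n n' _ v diffB diffZ vZ.
  exists (fun x => w3 x - w2 x) => [|x]; first exact: bhom_sub.
  rewrite -w2E -w3E /g (linB (bhom_linear (taug_bhom _ _))) (linZ (bhom_linear (taug_bhom _ _))).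
  have capE : taug (cap_slice 0 x) = tmap u' v (Dl n' (Posz b) n x).
    rewrite /cap_slice taug_assoc /slice.
    have iT := @bhom_id _ _ (T (Posz b)); have iN := @bhom_id _ _ N.
    rewrite (tmap_comp_b _ (@suh b 0) iN (taug_bhom T M) iN).
    exact: (tmap_comp_b (Dl n' (Posz b) n x) iT vh u'h iN).
  have u'E : u' = fun y => (-1) *: w1 (d b (Posz b - 1) y) + u y.
    by apply/funext => t; rewrite -w1E scaleN1r opprB subrK.
  (* From n = -(a + b + 1), the exponents b n and b a differ by the even number b (b + 1), up to the
     sign of b n. Thus the sign of the cap product matches that of the cup product. *)
  have sgnE : sgn = (-1) ^ (Posz b * n).
    have -> : n = - Posz (a + b).+1 by lia.
    rewrite mulrN -exprnN invr_sign -[LHS]signr_odd -[RHS]signr_odd !oddM /= oddD.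
    by case: (odd a); case: (odd b).
  rewrite sgnE capE u'E tmap_addl // scaleN1r scalerDr scalerN.
  by rewrite opprB [in RHS]addrCA opprD opprK [_ - w x]addrC !addrA.
(* In degree -1 the term h1 d vanishes at e, so the values of the two chain maps differ by the
   boundary of the invariant element h(e). *)
have [h hh [h1 h1h hE]] := homotopy_up D ff (esym (subrK 1 n')) gh gwh gd gwE (a := a)
  (j := - 1) (j1 := - 2) ltac:(lia) erefl.
apply: (@norm_boundary _ _ _ D ff nu nuP T (bitens M N) a _ (h e)).
  by move=> c; exact: bhom_central.
have nl := @norm_linear _ _ _ D ff nu nuP (T (Posz a)) (bitens M N).
rewrite (linB nl) yE norm_cap //.
have -> : @tensd _ _ T (bitens M N) (Posz a.+1) a (h e) = g (-1) a e.
  by rewrite hE diff_coaug1 (lin0 (bhom_linear h1h)) addr0.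
by rewrite /g /cap_slice -zE.
Qed.
End Compatibility.

(** * Truncation and tensor products of maps *)

Lemma tdiff_trunc (k : fieldType) (A : algType k) (C : bicomplex A) (X : bimod A) (c : nat)
    (z : tensE (C (Posz c)) X) l :
  @tdiff _ _ C X (Posz c) l z = 0 -> @tdiff _ _ (trunc C) X (Posz c) l z = 0.
Proof.
case: l => [//|l] _; move: z.
apply: (tensE_ext (X := trunc C (Posz c)) (Y := X)
  (f := fun z => @tdiff _ _ (trunc C) X (Posz c) (Negz l) z) (g := fun _ => 0)) => [||t x].
- exact: tdiff_linear.
- exact: lin_cst0.
- by rewrite tdiff_pure (lin0 ((pureE_bilin _ _).2 x)).
Qed.

Section TensorMaps.
Variables (k : fieldType) (U V U' V' : lmodType k).

(** The projection modulo the image of [f] is linear and kills every pure tensor, hence is zero. *)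
Lemma tensk_surj (f : tensk U V -> tensk U' V') (g : U -> U') (h : V -> V') : linear f ->
  (forall x y, f (tpure _ _ x y) = tpure _ _ (g x) (h y)) ->
  (forall x, exists y, g y = x) -> (forall x, exists y, h y = x) ->
  forall w, exists z, f z = w.
Proof.
move=> fl fp gs hs w.
have Sc : submod_closed (fun w => `[< exists z, f z = w >]).
  split=> [|a u v /asboolP[x <-] /asboolP[y <-]]; apply/asboolP.
    by exists 0; rewrite (lin0 fl).
  by exists (a *: x + y); rewrite fl.
pose S := Submodule Sc.
suff /asboolP : w \in S by [].
have := @tens_ext _ _ _ _ _ _ (quot S) (qpi S) (fun _ => 0) (@qpi_linear _ _ S) (@lin_cst0 _ _ _).
move=> /(_ _ w) e; rewrite -[w]subr0; apply/qpi_eqP.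
rewrite [qpi S 0](lin0 (@qpi_linear _ _ S)); apply: e => x y.
have [x' <-] := gs x; have [y' <-] := hs y; rewrite -fp.
rewrite -[RHS](lin0 (@qpi_linear _ _ S)); apply/qpi_eqP; rewrite subr0.
by apply/asboolP; eexists.
Qed.
End TensorMaps.

Lemma linear_can (k : fieldType) (U V : lmodType k) (f : U -> V) (g : V -> U) :
  linear f -> cancel f g -> cancel g f -> linear g.
Proof. by move=> fl fK gK a u v; rewrite -[u in LHS]gK -[v in LHS]gK -fl fK. Qed.

Lemma tensk_map_linear (k : fieldType) (U V U' V' : lmodType k) (g : U -> U') (h : V -> V') :
  linear g -> linear h -> linear (tmap g h : tensk U V -> tensk U' V').
Proof. by move=> gl hl; apply: tmap_linear. Qed.

Lemma tensk_map_pure (k : fieldType) (U V U' V' : lmodType k) (g : U -> U') (h : V -> V') x y :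
  linear g -> linear h ->
  (tmap g h : tensk U V -> tensk U' V') (tpure _ _ x y) = tpure _ _ (g x) (h y).
Proof. by move=> gl hl; apply: tmap_pure. Qed.

Lemma tensk_map_bij (k : fieldType) (U V U' V' : lmodType k) (g : U -> U') (h : V -> V') :
  linear g -> linear h -> bijective g -> bijective h ->
  bijective (tmap g h : tensk U V -> tensk U' V').
Proof.
move=> gl hl [g' gK gK'] [h' hK hK'].
have gl' := linear_can gl gK gK'; have hl' := linear_can hl hK hK'.
exists (tmap g' h' : tensk U' V' -> tensk U V).
  apply: (tens_ext (f := fun z => (tmap g' h' : tensk U' V' -> tensk U V) (tmap g h z))) => [||x y].
  - exact: lin_comp (tensk_map_linear gl hl) (tensk_map_linear gl' hl').
  - by [].
  - by rewrite !tensk_map_pure // gK hK.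
apply: (tens_ext (f := fun z => (tmap g h : tensk U V -> tensk U' V') (tmap g' h' z))) => [||x y].
- exact: lin_comp (tensk_map_linear gl' hl') (tensk_map_linear gl hl).
- by [].
- by rewrite !tensk_map_pure // gK' hK'.
Qed.

Section Restriction.
Variables (k : fieldType) (A : falgType k) (T : complete_resolution A) (M : bimod A) (b : nat).

(** The cocycles coincide, and so do the coboundaries for b > 0. For b = 0 the truncation has no
    nonzero coboundary while T may have some coming from T_(-1); hence injectivity is claimed only
    for b ≠ 0. *)
Lemma hoch_to_tate : exists R : hoch_cohom T M (Posz b) -> tate_cohom T M (Posz b),
  [/\ linear R, forall x, exists y, R y = x, b != 0%N -> injective R &
    forall u, u \in cocycle (trunc T) M (Posz b) -> u \in cocycle T M (Posz b) /\
      R (ccls u) = ccls (u : T (Posz b) -> M)].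
Proof.
pose F (u : trunc T (Posz b) -> M) : T (Posz b) -> M := u.
have FZ u : u \in cocycle (trunc T) M (Posz b) -> F u \in cocycle T M (Posz b).
  exact: (trunc_cocycle u).1.
have Flin c u v : u \in cocycle (trunc T) M (Posz b) -> v \in cocycle (trunc T) M (Posz b) ->
  F (c *: u + v) = c *: F u + F v by [].
have FB u : u \in cocycle (trunc T) M (Posz b) -> u \in coboundary (trunc T) M (Posz b) ->
    F u \in coboundary T M (Posz b).
  move=> _ /asboolP[g gh gE]; case: b u g gh gE @F FZ Flin => [|b'] u g gh gE F FZ Flin.
    apply/asboolP; exists (fun _ => 0); first exact: bhom_0.
    by move=> x; rewrite /F gE; exact: lin0 (bhom_linear gh).
  by apply/asboolP; exists g.
exists (subquot_map (Z := cocycle (trunc T) M (Posz b)) (B := coboundary (trunc T) M (Posz b))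
  (cocycle T M (Posz b)) (coboundary T M (Posz b)) F); split.
- exact: (subquot_map_linear FZ Flin FB).
- apply: (subquot_map_surj FZ Flin FB) => u uZ; exists u; first exact: (trunc_cocycle u).2.
  by rewrite subrr; exact: rpred0.
- move=> b0; apply: (subquot_map_inj FZ Flin FB) => u uZ /asboolP[g gh gE].
  rewrite {FZ Flin FB}/F in gE *; case: b b0 u uZ g gh gE => // b' _ u uZ g gh gE.
  by apply/asboolP; exists g.
- by move=> u uZ; split; [exact: FZ|exact: (subquot_map_cls FZ Flin FB)].
Qed.
End Restriction.

Lemma boundary_cycle (k : fieldType) (A : algType k) (C : bicomplex A) (X : bimod A) n
    (z : tensE (C n) X) : z \in boundary C X n -> z \in Defs.cycle C X n.
Proof.
move=> /asboolP[y ->]; apply/eqP; move: y.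
apply: (tensE_ext (f := fun y => @tdiff _ _ C X n (n - 1) (@tdiff _ _ C X (n + 1) n y))) => [||c x].
- exact: lin_comp (@tdiff_linear _ _ C X (n + 1) n) (@tdiff_linear _ _ C X n (n - 1)).
- exact: lin_cst0.
- by rewrite !tdiff_pure diffK (lin0 ((pureE_bilin _ _).2 x)).
Qed.

Section TruncatedHomology.
Variables (k : fieldType) (A : algType k) (T : complete_resolution A) (X : bimod A) (c : nat).

Lemma trunc_cycle (z : tensE (T (Posz c)) X) : z \in Defs.cycle T X (Posz c) ->
  (z : tensE (trunc T (Posz c)) X) \in Defs.cycle (trunc T) X (Posz c).
Proof. by move=> /eqP z0; apply/eqP; exact: tdiff_trunc. Qed.

Lemma trunc_boundary (z : tensE (T (Posz c)) X) : z \in boundary T X (Posz c) ->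
  (z : tensE (trunc T (Posz c)) X) \in boundary (trunc T) X (Posz c).
Proof.
have cE : Posz c + 1 = Posz c.+1 by lia.
by move=> /asboolP[y yE]; apply/asboolP; rewrite cE in y yE *; exists y.
Qed.

Lemma tate_to_hoch_cls (z : tensE (T (Posz c)) X) : z \in Defs.cycle T X (Posz c) ->
  tate_to_hoch T (hcls z) = hcls (z : tensE (trunc T (Posz c)) X).
Proof.
move=> zZ; rewrite [LHS](homol_mapE (trunc_map T) (bhom1 X) zZ); congr (hcls _).
have iT := @bhom_id _ _ (T (Posz c)); have iX := @bhom_id _ _ X.
move: z {zZ}; apply: (tensE_ext (X := T (Posz c)) (Y := X) (f := tmap id id)) => [||t x].
- exact: tmapE_linear iT iX.
- by [].
- exact: tmapE_pure iT iX _ _.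
Qed.
End TruncatedHomology.

(** * Assembly of the diagram *)

Section Diagram.
Variables (k : fieldType) (A : falgType k) (form : A -> A -> k).
Variable D : dual_bases form.
Hypothesis ff : frobenius_form form.
Variable nu : alg_aut A.
Hypothesis nuP : nakayama form nu.
Variables (T : complete_resolution A).
Variables (Dl : diag_approx T (aug T)) (Dt : diag_approx (trunc T) (aug T)).
Variables (M N : bimod A).
Local Notation tw X := (twist idfun (aut_inv nu) X).
Local Notation e := (coaug T 1).

Variables (a b : nat) (n n' : int).
Hypothesis nE : Posz (a + b) + n = - 1.
Hypothesis n'E : n' = Posz b + n.

Lemma cap_cup_classes (u : trunc T (Posz b) -> M) (v : T n -> N)
    (z : tensE (T (Posz (a + b))) (tw N)) (z' : tensE (T (Posz a)) (tw (bitens M N))) :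
  u \in cocycle (trunc T) M (Posz b) -> v \in cocycle T N n ->
  z \in Defs.cycle T (tw N) (Posz (a + b)) ->
  z' \in Defs.cycle T (tw (bitens M N)) (Posz a) ->
  norm D z = slice Dl v (Posz (a + b)) e ->
  norm D z' = slice Dl (@cupc _ _ _ _ Dl M N (Posz b) n n' u v) (Posz a) e ->
  tate_to_hoch T (hcls z') =
  homol_map (chain_map1 (trunc T)) (twist_tens (aut_inv nu) M N) (Posz a)
    (cap Dt (Posz b) (Posz (a + b)) (Posz a) (ccls u) (tate_to_hoch T (hcls z))).
Proof.
move=> uZ vZ zZ z'Z zE z'E.
have zZ' := trunc_cycle zZ; have z'Z' := trunc_cycle z'Z.
have cZ := @capc_cycle _ _ _ _ Dt M (tw N) (Posz b) (Posz (a + b)) (Posz a) u z uZ zZ'.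
pose tt := twist_tens (aut_inv nu) M N.
pose c := @capc _ _ _ _ Dt M (tw N) (Posz b) (Posz (a + b)) (Posz a) u z.
pose c' : tensE (T (Posz a)) (tw (bitens M N)) := tmap id tt c.
have c'B : z' - c' \in boundary T (tw (bitens M N)) (Posz a).
  exact: (cap_cup_boundary ff nuP Dt nE n'E uZ vZ zE z'E).
(* Capping on the truncation only yields a cycle there. That it is a cycle of T, which says more in
   degree 0, is inherited from [z']. *)
have c'Z : c' \in Defs.cycle T (tw (bitens M N)) (Posz a).
  have -> : c' = z' - (z' - c') by rewrite opprB addrC subrK.
  by apply: rpredB; [exact: z'Z|exact: boundary_cycle].
rewrite (tate_to_hoch_cls zZ) (tate_to_hoch_cls z'Z).
rewrite (@cap_cls _ _ _ _ Dt M (tw N) (Posz b) (Posz (a + b)) (Posz a) u z uZ zZ').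
rewrite (homol_mapE (chain_map1 (trunc T)) tt cZ).
apply: (cls_eqP (boundary (trunc T) (tw (bitens M N)) (Posz a)) z'Z' (trunc_cycle c'Z)).2.
exact: trunc_boundary.
Qed.

Lemma cap_cup_diagram :
  exists (capf : tensk (hoch_cohom T M (Posz b)) (tate_homol T (tw N) (Posz (a + b)))
                 -> tate_homol T (tw (bitens M N)) (Posz a))
         (left : tensk (hoch_cohom T M (Posz b)) (tate_homol T (tw N) (Posz (a + b)))
                 -> tensk (tate_cohom T M (Posz b)) (tate_cohom T N n))
         (right : tate_homol T (tw (bitens M N)) (Posz a) -> tate_cohom T (bitens M N) n'),
    [/\ linear capf, linear left & linear right] /\
    [/\ forall x y, tate_to_hoch T (capf (tpure _ _ x y)) =
          homol_map (chain_map1 (trunc T)) (twist_tens (aut_inv nu) M N) (Posz a)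
            (cap Dt (Posz b) (Posz (a + b)) (Posz a) x (tate_to_hoch T y)),
        forall z, right (capf z) = cupT Dl (Posz b) n n' (left z),
        bijective right,
        b != 0%N -> bijective left
      & forall w, exists z, left z = w].
Proof.
have [GN [GNl GNb GNE]] := tate_duality D ff nuP Dl N nE.
have n'E' : Posz a + n' = - 1 by lia.
have [GM [GMl GMb GME]] := tate_duality D ff nuP Dl (bitens M N) n'E'.
have [R [Rl Rs Ri RE]] := hoch_to_tate T M b.
have [HN HNK HNK'] := GNb; have [HM HMK HMK'] := GMb.
have HNl := linear_can GNl HNK HNK'; have HMl := linear_can GMl HMK HMK'.
pose left : tensk (hoch_cohom T M (Posz b)) (tate_homol T (tw N) (Posz (a + b)))
  -> tensk (tate_cohom T M (Posz b)) (tate_cohom T N n) := tmap R HN.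
have leftl : linear left := tensk_map_linear Rl HNl.
have leftE x y : left (tpure _ _ x y) = tpure _ _ (R x) (HN y) := tensk_map_pure x y Rl HNl.
(* The upper arrow is defined by going around the square, which makes commutativity formal. The
   substance is the next claim, that it restricts the Hochschild cap product. *)
exists (fun z => GM (cupT Dl (Posz b) n n' (left z))), left, HM; split; split.
- exact: lin_comp (lin_comp leftl (@cupT_linear _ _ _ _ Dl M N (Posz b) n n')) GMl.
- exact: leftl.
- exact: HMl.
- move=> x y; rewrite leftE cupT_pure.
  have xE : @ccls _ _ (trunc T) M (Posz b) (rep x) = x := repK x.
  have uZ : rep x \in cocycle (trunc T) M (Posz b) := rep_mem x.
  have vE : @ccls _ _ T N n (rep (HN y)) = HN y := repK (HN y).
  have vZ : rep (HN y) \in cocycle T N n := rep_mem (HN y).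
  move: (rep x) (rep (HN y)) xE uZ vE vZ => u v xE uZ vE vZ.
  have [uZ' RuE] := RE _ uZ; have /cocycleP[vh _] := vZ.
  have [z zE] := norm_image D ff nuP (y := slice Dl v (Posz (a + b)) e)
    (fun c => bhom_central c (slice_bhom Dl (- 1) _ vh)).
  have [zZ GzE] := GNE _ _ vZ zE.
  have wZ := @cupc_cocycle _ _ _ _ Dl M N _ _ n' u v uZ' vZ.
  have /cocycleP[wh _] := wZ.
  have [z' z'E] := norm_image D ff nuP (y := slice Dl _ (Posz a) e)
    (fun c => bhom_central c (slice_bhom Dl (- 1) _ wh)).
  have [z'Z Gz'E] := GME _ _ wZ z'E.
  have yE : y = hcls z by rewrite -GzE vE HNK'.
  rewrite -xE RuE -vE (@cup_cls _ _ _ _ Dl M N (Posz b) n n' u v uZ' vZ) Gz'E yE.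
  exact: (cap_cup_classes uZ vZ zZ z'Z zE z'E).
- by move=> z; rewrite HMK.
- exact: Bijective HMK' HMK.
- move=> b0; apply: (tensk_map_bij Rl HNl (inj_surj_bijective (Ri b0) Rs)).
  exact: Bijective HNK' HNK.
- apply: (tensk_surj leftl leftE Rs) => x; exists (GN x); exact: HNK.
Qed.
End Diagram.


Theorem cap_cup_diagram_int (k : fieldType) (A : falgType k)
    (form : A -> A -> k) (nu : alg_aut A) (T : complete_resolution A)
    (Dl : diag_approx T (aug T)) (Dt : diag_approx (trunc T) (aug T))
    (M N : bimod A) (r s : int) :
  frobenius_form form -> nakayama form nu ->
  0 <= r -> 1 <= s -> r - s <= - 1 ->
  let N_nu := twist idfun (aut_inv nu) N in
  let MN_nu := twist idfun (aut_inv nu) (bitens M N) in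
  exists (capf : tensk (hoch_cohom T M r) (tate_homol T N_nu (s - 1))
                 -> tate_homol T MN_nu (s - r - 1))
         (left : tensk (hoch_cohom T M r) (tate_homol T N_nu (s - 1))
                 -> tensk (tate_cohom T M r) (tate_cohom T N (- s)))
         (right : tate_homol T MN_nu (s - r - 1) -> tate_cohom T (bitens M N) (r - s)),
    [/\ linear capf, linear left & linear right] /\
    [/\ forall (x : hoch_cohom T M r) (y : tate_homol T N_nu (s - 1)),
          tate_to_hoch T (capf (tpure _ _ x y)) =
          homol_map (chain_map1 (trunc T)) (twist_tens (aut_inv nu) M N) (s - r - 1)
            (cap Dt r (s - 1) (s - r - 1) x (tate_to_hoch T y)),
        forall z, right (capf z) = cupT Dl r (- s) (r - s) (left z),
        bijective right,
        r != 0 -> bijective left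
      & forall w, exists z, left z = w].
Proof.
move=> ff nuP r0 s1 rs; have [D] := frobenius_dual_bases ff.
(* The square is indexed by b = r and a = s - r - 1, which is nonnegative by r - s <= -1; the
   homology degrees are then a + b and a, where truncation changes no term. *)
have [b rE] : exists b, r = Posz b by case: r r0 {rs} => // b _; exists b.
have [a aE] : exists a, s - r - 1 = Posz a.
  by case E : (s - r - 1) => [a|a]; [exists a|lia].
have mE : s - 1 = Posz (a + b) by lia.
have nE : Posz (a + b) + - s = - 1 by lia.
have n'E : r - s = Posz b + - s by lia.
rewrite {}aE {}mE; move: (- s) (r - s) n'E nE => n n' n'E nE.
subst r; exact: (cap_cup_diagram D ff nuP Dl Dt M N nE n'E).
Qed.

Theorem corollary4p5 (k : fieldType) (A : falgType k)
    (form : A -> A -> k) (nu : alg_aut A)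
    (T : complete_resolution A)
    (hDelta : diag_approx T (aug T))
    (Delta : diag_approx (trunc T) (aug T))
    (M N : bimod A) (r s : int) :
  frobenius_form form -> nakayama form nu ->
  0 <= r -> 1 <= s -> r - s <= - 1 ->
  let N_nu := twist idfun (aut_inv nu) N in
  let MN_nu := twist idfun (aut_inv nu) (bitens M N) in
  exists (capT : {linear tensk (hoch_cohom T M r) (tate_homol T N_nu (s - 1))
                         -> tate_homol T MN_nu (s - r - 1)})
         (left : {linear tensk (hoch_cohom T M r) (tate_homol T N_nu (s - 1))
                         -> tensk (tate_cohom T M r) (tate_cohom T N (- s))})
         (right : {linear tate_homol T MN_nu (s - r - 1)
                         -> tate_cohom T (bitens M N) (r - s)}),
    [/\ forall (x : hoch_cohom T M r) (y : tate_homol T N_nu (s - 1)),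
          tate_to_hoch T (capT (tpure _ _ x y)) =
          homol_map (chain_map1 (trunc T)) (twist_tens (aut_inv nu) M N) (s - r - 1)
            (cap Delta r (s - 1) (s - r - 1) x (tate_to_hoch T y)),
        forall z, right (capT z) = cupT hDelta r (- s) (r - s) (left z),
        bijective right,
        r != 0 -> bijective left
      & r = 0 -> forall w, exists z, left z = w].
Proof.
move=> ff nuP r0 s1 rs N_nu MN_nu.
have [capf [left [right [[cl ll rl] [capE cupE rb lb ls]]]]] :=
  cap_cup_diagram_int hDelta Delta M N ff nuP r0 s1 rs.
pose capL : {linear _ -> _} := HB.pack capf (GRing.isLinear.Build _ _ _ _ capf cl).
pose leftL : {linear _ -> _} := HB.pack left (GRing.isLinear.Build _ _ _ _ left ll).
pose rightL : {linear _ -> _} := HB.pack right (GRing.isLinear.Build _ _ _ _ right rl).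
exists capL, leftL, rightL; split.
- exact: capE.
- exact: cupE.
- exact: rb.
- exact: lb.
- by move=> _; exact: ls.
Qed.
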